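(* Let $n\ge 1$ and let $h:\mathbb B^n\to\mathbb R$ be a real-valued invariant harmonic function on the unit ball $\mathbb B^n\subset\mathbb C^n$ with $|h|\le 1$ on $\mathbb B^n$. Then $$\|\nabla h(z)\|\le \frac{2\,\Gamma(n+1)}{\sqrt{\pi}\,\Gamma(n+\frac12)}\,\frac{1}{1-\|z\|^2},\qquad z\in\mathbb B^n.$$ Moreover, the inequality is sharp: for every $z\in\mathbb B^n$ there is a real-valued invariant harmonic function $h$ on $\mathbb B^n$ with $|h|\le 1$ for which equality holds at $z$.
   Context: $\mathbb B^n=\{z\in\mathbb C^n:\|z\|<1\}$, where $\|\cdot\|$ is the Euclidean norm. A (twice continuously differentiable) function $f$ on $\mathbb B^n$ is called invariant harmonic if $\Delta_B f\equiv 0$ on $\mathbb B^n$, where $$\Delta_B f(z)=4(1-\|z\|^2)\sum_{i,j=1}^n(\delta_{ij}-z_i\overline z_j)\frac{\partial^2 f}{\partial z_i\partial\overline z_j}(z)$$ ($\delta_{ij}$ is the Kronecker delta; $\Delta_B$ is the Laplace–Beltrami operator of the Bergman metric). With $z_j=x_j+\sqrt{-1}\,y_j$, $\nabla h=(\partial h/\partial x_1,\partial h/\partial y_1,\dots,\partial h/\partial x_n,\partial h/\partial y_n)$ is the Euclidean gradient on $\mathbb C^n\cong\mathbb R^{2n}$ and $\|\nabla h\|$ is its Euclidean norm. *)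

(* Defs.v *)
From HB Require Import structures.
From mathcomp Require Import all_boot all_order all_algebra.
From mathcomp Require Import complex.
From mathcomp Require Import all_classical all_reals all_analysis.
Set Implicit Arguments.
Unset Strict Implicit.
Unset Printing Implicit Defensive.
Import Order.TTheory GRing.Theory Num.Theory.
Import numFieldNormedType.Exports.
Local Open Scope classical_set_scope.
Local Open Scope ring_scope.
Local Open Scope complex_scope.

(* C^n is carried by R^n x R^n, the point (x, y) standing for x + iy: this is a
   normed module over R, as required by the derivatives 'D_v.  The library norm
   on this type is a sup norm; it is used only for its topology, and the
   Euclidean norm is [enorm] below. *)
Definition Cn (R : realType) (n : nat) : normedModType R :=
  ('rV[R]_n * 'rV[R]_n)%type.

Section BergmanBall.
Context {R : realType} {n : nat}.
Implicit Types (z : Cn R n) (f : Cn R n -> R[i]) (h : Cn R n -> R).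

Definition zcoord z (j : 'I_n) : R[i] := z.1 0 j +i* z.2 0 j.

Definition enorm z : R :=
  Num.sqrt (\sum_(j < n) (z.1 0 j ^+ 2 + z.2 0 j ^+ 2)).

Definition Bn : set (Cn R n) := [set z | enorm z < 1].

Definition e_x (j : 'I_n) : Cn R n := (delta_mx 0 j, 0).
Definition e_y (j : 'I_n) : Cn R n := (0, delta_mx 0 j).

Definition C1_on (D : set (Cn R n)) h : Prop :=
  forall z, D z -> forall j : 'I_n,
    [/\ derivable h z (e_x j), derivable h z (e_y j),
        {for z, continuous ('D_(e_x j) h)} & {for z, continuous ('D_(e_y j) h)}].

Definition C2_on (D : set (Cn R n)) h : Prop :=
  C1_on D h /\
  forall j : 'I_n, C1_on D ('D_(e_x j) h) /\ C1_on D ('D_(e_y j) h).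

Definition Cderive (v : Cn R n) f : Cn R n -> R[i] :=
  fun z => 'D_v (fun w => complex.Re (f w)) z
           +i* 'D_v (fun w => complex.Im (f w)) z.

Definition dz (j : 'I_n) f : Cn R n -> R[i] :=
  fun z => (Cderive (e_x j) f z - (0 +i* 1) * Cderive (e_y j) f z) / 2.

Definition dzbar (j : 'I_n) f : Cn R n -> R[i] :=
  fun z => (Cderive (e_x j) f z + (0 +i* 1) * Cderive (e_y j) f z) / 2.

Definition LaplaceBeltrami f : Cn R n -> R[i] :=
  fun z => 4 * (1 - enorm z ^+ 2)%:C *
    \sum_(i < n) \sum_(j < n)
      ((i == j)%:R - zcoord z i * (zcoord z j)^*) * dz i (dzbar j f) z.

Definition invariant_harmonic f : Prop :=
  [/\ C2_on Bn (fun z => complex.Re (f z)),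
      C2_on Bn (fun z => complex.Im (f z)) &
      forall z, Bn z -> LaplaceBeltrami f z = 0].

(* Real-valued functions on the ball are total functions on C^n whose values
   off the ball are irrelevant: every condition is local and imposed on the
   open set [Bn] only. *)
Definition real_invariant_harmonic h : Prop :=
  invariant_harmonic (fun z => (h z)%:C).

Definition grad_norm h z : R :=
  Num.sqrt (\sum_(j < n) ('D_(e_x j) h z ^+ 2 + 'D_(e_y j) h z ^+ 2)).

End BergmanBall.

Arguments Bn : clear implicits.

Definition Gamma {R : realType} (a : R) : R :=
  \int[@lebesgue_measure R]_(t in `]0%R, +oo[) (t `^ (a - 1) * expR (- t)).

(* Main.v *)
From HB Require Import structures.
Require Import Defs.
From mathcomp Require Import all_boot all_order all_algebra.
From mathcomp Require Import complex.
From mathcomp Require Import all_classical all_reals all_analysis.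
From mathcomp Require Import measurable_realfun.
From mathcomp Require Import ring lra.
Set Implicit Arguments.
Unset Strict Implicit.
Unset Printing Implicit Defensive.
Import Order.TTheory GRing.Theory Num.Theory.
Import numFieldNormedType.Exports.
Local Open Scope classical_set_scope.
Local Open Scope ring_scope.
Local Open Scope complex_scope.

(** The equation is invariant under the automorphisms of the ball, so the problem reduces to the
    gradient at the origin. There the derivative of h in the direction Re z_1 is compared with that
    of an explicit function [Hext], invariant harmonic with boundary values the sign of Re z_1
    ([origin_dx_le]). Unitary maps turn this into a bound for the full gradient at 0
    ([origin_gradient_le]), and the automorphism [trans z], which sends 0 to z, carries it to z. The
    differential of [trans z] at 0 is multiplication by s^2 = 1 - |z|^2 along z and by s on the
    orthogonal complement. By Cauchy-Schwarz the gradient of h at z is therefore at most 1/(1 -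
    |z|^2) times that of the composite at 0 ([grad_norm_le]), and equality holds when the gradient
    is aligned with z ([grad_norm_attained]).

    The extremal function is [Hext] = (2/pi) F(T, p) with T = 2 Re z_1 / (1 - |z|^2), p = (1 -
    |z_1|^2) / (1 - |z|^2) and F(T, p) the integral over 0 <= x <= 1 of (1 - x^2)^(n-1) Im((1 + x^2
    (p-1) - i x T)^(-n)) / x. In the variables T and p the equation becomes a linear second order
    PDE, and the corresponding operator applied to the integrand gives an exact derivative in x
    whose boundary terms vanish ([Fext0_pde], [LB_Hext0]). The bound |[Hext]| <= 1 and the boundary
    values rest on two facts. F increases in T >= 0, because its T-derivative becomes visibly
    nonnegative once the segment of integration is bent into a circular arc ([Pfam_ge0]). And F
    tends to pi/2 as T grows, uniformly for p <= M T ([Fext0_limit]).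

    For the comparison, h is averaged over a finite torus rotating z_2, ..., z_n, and then replaced
    by its odd part under the reflection z -> (-conj z_1, conj z_2, ..., conj z_n). On the first
    axis this leaves half of h(x) - h(-x). On the hyperplane Re z_1 = 0 the reflection only
    conjugates z_2, ..., z_n; the conjugate of a number is a rotation of it, so the average is
    almost unchanged and its odd part almost zero ([odd_avg_flat]). Composing [Hext] with a small
    translation by a > 0 along the first axis pushes the half ball Re z_1 >= 0 into Re z_1 >= a/4,
    where [Hext] tends to 1 uniformly at the sphere. The maximum principle on the half ball then
    bounds the odd average by the translated [Hext] up to e ([half_ball_comparison]). Letting e tend
    to 0, then taking a = x^2 and letting x tend to 0, gives the derivative bound at the origin.

    The constant comes from the T-derivative of F at T = 0, p = 1, which is n times the integral of
    (1 - x^2)^(n-1). Wallis' recursion and the values of Gamma at half-integers identify it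
    ([sharp_const_Gamma]). *)

(** * Differentiability from continuous partial derivatives *)

Section DirectionalCalculus.
Context {R : realType} {V : normedModType R}.
Implicit Types (D : set V) (f g : V -> R) (z v : V).

Lemma is_derive_line f (a v : V) (s : R) : derivable f (s *: v + a) v ->
  is_derive s 1 (fun t : R => f (t *: v + a)) ('D_v f (s *: v + a)).
Proof.
have E : (fun h : R => h^-1 *: (((fun t : R => f (t *: v + a)) \o shift s) (h *: 1)
    - f (s *: v + a))) =
  (fun h => h^-1 *: ((f \o shift (s *: v + a)) (h *: v) - f (s *: v + a))).
  by apply/funext => h /=; rewrite [h *: 1]mulr1 scalerDl addrA.
by move=> df; split; rewrite /derivable /derive E.
Qed.

(** The increment [c] may have either sign, because it will be a coordinate of an arbitrary small
    vector. *)
Lemma MVT_line f (a v : V) (c : R) :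
  (forall t, `|t| <= `|c| -> derivable f (t *: v + a) v) ->
  exists2 t, `|t| <= `|c| & f (c *: v + a) - f a = 'D_v f (t *: v + a) * c.
Proof.
move=> df.
have cont (b d : R) : (forall t, t \in `[b, d] -> `|t| <= `|c|) ->
    {within `[b, d], continuous (fun t => f (t *: v + a))}.
  move=> bd; apply: derivable_within_continuous => t tbd.
  exact: (@ex_derive _ _ _ _ _ _ _ (is_derive_line (df t (bd t tbd)))).
have [c0|c0] := leP 0 c.
  have bd (t : R) : t \in `[0, c] -> `|t| <= `|c|.
    by rewrite in_itv/= => /andP[? ?]; rewrite !ger0_norm.
  have [t tc] := MVT_segment c0
    (fun t h => is_derive_line (df t (bd t (subset_itv_oo_cc h)))) (cont _ _ bd).
  by rewrite scale0r add0r subr0 => ->; exists t => //; apply: bd.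
have bd (t : R) : t \in `[c, 0] -> `|t| <= `|c|.
  by rewrite in_itv/= => /andP[? ?]; rewrite !ler0_norm ?lerN2 // ltW.
have [t tc] := MVT_segment (ltW c0)
  (fun t h => is_derive_line (df t (bd t (subset_itv_oo_cc h)))) (cont _ _ bd).
rewrite scale0r add0r sub0r => E; exists t; first exact: bd.
by rewrite -[LHS]opprB E mulrN opprK.
Qed.

End DirectionalCalculus.

Section PartialsDifferentiable.
Context {R : realType} {V : normedModType R} {I : finType}.
Variables (e : I -> V) (c : I -> {linear V -> R}).
Hypothesis c_le : forall i v, `|c i v| <= `|v|.
Hypothesis c_sum : forall v, v = \sum_i c i v *: e i.
Variables (D : set V) (f : V -> R) (z : V).
Hypothesis oD : open D.
Hypothesis Dz : D z.
Hypothesis df : forall i w, D w -> derivable f w (e i).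
Hypothesis cf : forall i, {for z, continuous ('D_(e i) f)}.

(** Telescoping over the coordinates: adding the term of one more direction is a move along a single
    line, where the mean value theorem replaces the increment by a partial derivative at a nearby
    point. Continuity at [z] makes that derivative differ from its value at [z] by less than
    [eps / 2], and the other half of [eps] goes to the remaining directions. *)
Lemma partials_increment (r : seq I) (eps : R) : 0 < eps ->
  exists2 d, 0 < d & forall v, `|v| < d ->
  `|f (\sum_(i <- r) c i v *: e i + z) - f z - \sum_(i <- r) c i v * 'D_(e i) f z|
    <= eps * `|v|.
Proof.
elim: r eps => [|i r IH] eps e0.
  exists 1 => // v _; rewrite !big_nil add0r !subrr normr0 mulr_ge0 //; exact: ltW.
have e2 : 0 < eps / 2 by rewrite divr_gt0.
have [d1 d10 H1] := IH _ e2.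
have : \forall w \near z, D w /\ `|'D_(e i) f z - 'D_(e i) f w| < eps / 2.
  near=> w; split; near: w; first exact: open_nbhs_nbhs.
  by move: (@cf i) => /cvgrPdist_lt; apply.
move=> /nbhs_ballP[d2 /= d20 H2].
(* Since coordinates are bounded by the norm, every partial sum of [v] has norm at most [K * |v|];
   the added 1 only makes [K] positive. *)
pose K := \sum_(j <- i :: r) `|e j| + 1.
have K0 : 0 < K by apply: ltr_wpDl => //; apply: sumr_ge0.
exists (Num.min d1 (d2 / K)) => [|v]; first by rewrite lt_min d10 divr_gt0.
rewrite lt_min ltr_pdivlMr // => /andP[vd1 vd2].
rewrite !big_cons; set S := \sum_(_ <- r) _ *: _; set T := \sum_(_ <- r) _ * _.
have bnd t : `|t| <= `|c i v| -> ball z d2 (t *: e i + (S + z)).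
  move=> tc; rewrite -ball_normE /= distrC addrA addrK.
  apply: le_lt_trans vd2; rewrite /K big_cons mulrC mulrDl mul1r.
  apply: le_trans (ler_normD _ _) _; rewrite -[leLHS]addr0 lerD // mulrDl lerD //.
    by rewrite normrZ mulrC; apply: ler_wpM2r => //; apply: le_trans tc _.
  apply: le_trans (ler_norm_sum _ _ _) _; rewrite mulr_suml; apply: ler_sum => j _.
  by rewrite normrZ mulrC; apply: ler_wpM2r.
have [|t tc E] := @MVT_line _ _ f (S + z) (e i) (c i v).
  by move=> t /bnd /H2[Dt _]; apply: df.
have -> : f (c i v *: e i + S + z) - f z - (c i v * 'D_(e i) f z + T) =
   ('D_(e i) f (t *: e i + (S + z)) - 'D_(e i) f z) * c i v + (f (S + z) - f z - T).
  by rewrite -[in LHS](addrA _ S z) mulrBl -E; ring.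
rewrite [leRHS](_ : _ = eps / 2 * `|v| + eps / 2 * `|v|); last by field.
apply: le_trans (ler_normD _ _) _; apply: lerD; last exact: H1.
rewrite normrM ler_pM // distrC; have [_] := H2 _ (bnd _ tc); exact: ltW.
Unshelve. all: by end_near. Qed.

Lemma partials_differentiable :
  differentiable f z /\ forall v, 'd f z v = \sum_i c i v * 'D_(e i) f z.
Proof.
pose L v := \sum_i c i v * 'D_(e i) f z.
have linL : linear (L : V -> R).
  move=> k u v; rewrite /L scaler_sumr -big_split /=; apply: eq_bigr => i _.
  by rewrite linearP mulrDl [k *: (_ * _)]mulrA.
pose lL := GRing.isLinear.Build R V R _ L linL.
pose LL : {linear V -> R} := HB.pack L lL.
have cL : continuous (LL : V -> R).
  apply/(linear_bounded_continuous LL)/linear_boundedP.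
  near=> k => v; rewrite /= /L.
  apply: le_trans (ler_norm_sum _ _ _) _.
  apply: le_trans (_ : (\sum_i `|'D_(e i) f z|) * `|v| <= _); last first.
    by rewrite ler_wpM2r //; near: k; apply: nbhs_pinfty_ge; rewrite num_real.
  by rewrite mulr_suml; apply: ler_sum => i _; rewrite normrM mulrC ler_wpM2l.
have E : f \o shift z = cst (f z) + LL +o_ 0 id.
  apply/eqaddoP => eps eps0; have [d d0 H] := partials_increment (enum I) eps0.
  apply/nbhs_ballP; exists d => //= v; rewrite -ball_normE /= sub0r normrN => vd.
  have := H _ vd; rewrite !big_enum /= -c_sum.
  by rewrite !fctE opprD addrA.
have dL := diff_unique cL E.
split; last by move=> v; rewrite dL.
by apply/diff_locallyP; rewrite dL.
Unshelve. all: by end_near. Qed.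

End PartialsDifferentiable.

(** * Functions of class C1 on open subsets of C^n *)

Section CnCalculus.
Context {R : realType} {n : nat}.
Local Notation V := (Cn R n).
Implicit Types (D : set V) (f g h : V -> R) (z v : V) (d : 'I_n + 'I_n).

(** One sum type indexes the 2n real directions, so that statements about partial derivatives are
    made once instead of separately for the x and the y directions. *)
Definition edir d : V := match d with inl j => e_x j | inr j => e_y j end.
Definition cdir d (v : V) : R := match d with inl j => v.1 0 j | inr j => v.2 0 j end.

Lemma cdir_linear d : linear (cdir d : V -> R).
Proof. by case: d => j k u v; rewrite /= !mxE. Qed.
HB.instance Definition _ d :=
  GRing.isLinear.Build R V R _ (cdir d) (cdir_linear d).

Lemma cdir_le d v : `|cdir d v| <= `|v|.
Proof.
rewrite [leRHS]/Num.norm /= le_max.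
have le_mx m (M : 'rV[R]_m) k : `|M 0 k| <= `|M|.
  by rewrite [leRHS]/Num.norm /= mx_normrE; apply/bigmax_geP; right => /=; exists (0, k).
by case: d => j /=; rewrite le_mx ?orbT.
Qed.

Lemma cdir_sum v : v = \sum_d cdir d v *: edir d.
Proof.
rewrite big_sumType /=.
have E1 : \sum_(j < n) v.1 0 j *: e_x j = (v.1, 0) :> V.
  rewrite [v.1 in RHS]row_sum_delta.
  apply: (big_ind2 (fun (a : V) (b : 'rV_n) => a = (b, 0))) => // [a b c d -> ->|j _].
    by rewrite -[LHS]/(b + d, 0 + 0) addr0.
  by rewrite -[LHS]/(v.1 0 j *: delta_mx 0 j, v.1 0 j *: 0) scaler0.
have E2 : \sum_(j < n) v.2 0 j *: e_y j = (0, v.2) :> V.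
  rewrite [v.2 in RHS]row_sum_delta.
  apply: (big_ind2 (fun (a : V) (b : 'rV_n) => a = (0, b))) => // [a b c d -> ->|j _].
    by rewrite -[LHS]/(0 + 0, b + d) addr0.
  by rewrite -[LHS]/(v.2 0 j *: 0, v.2 0 j *: delta_mx 0 j) scaler0.
by rewrite E1 E2 -[RHS]/(v.1 + 0, 0 + v.2) addr0 add0r; case: v {E1 E2}.
Qed.

Lemma cdir_edir d d' : cdir d (edir d') = (d == d')%:R.
Proof.
by case: d d' => [j|j] [k|k] /=; rewrite !mxE ?eqxx //=.
Qed.

Lemma cdir_inj u v : (forall d, cdir d u = cdir d v) -> u = v.
Proof. by move=> uv; rewrite [u]cdir_sum [v]cdir_sum; apply: eq_bigr => d _; rewrite uv. Qed.

Definition C1 D h := forall z, D z -> forall d,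
  derivable h z (edir d) /\ {for z, continuous ('D_(edir d) h)}.

Lemma C1_onP D h : C1_on D h <-> C1 D h.
Proof.
split=> H z Dz => [[j|j]|j].
- by have [a _ b _] := H z Dz j; exact: (conj a b).
- by have [_ a _ b] := H z Dz j; exact: (conj a b).
have [a b] := H z Dz (inl j); have [c d] := H z Dz (inr j).
exact: (And4 a c b d).
Qed.

Lemma C1_diff D h z : open D -> C1 D h -> D z ->
  differentiable h z /\ forall v, 'd h z v = \sum_d cdir d v * 'D_(edir d) h z.
Proof.
move=> oD Ch Dz.
apply: (@partials_differentiable _ V _ edir cdir cdir_le cdir_sum D) => //.
  by move=> d w Dw; have [] := Ch _ Dw d.
by move=> d; have [] := Ch _ Dz d.
Qed.

Lemma C1_differentiable D h z : open D -> C1 D h -> D z -> differentiable h z.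
Proof. by move=> oD Ch Dz; have [] := C1_diff oD Ch Dz. Qed.

Lemma C1_derivable D h z v : open D -> C1 D h -> D z -> derivable h z v.
Proof. by move=> oD Ch Dz; apply/diff_derivable/C1_differentiable/Dz. Qed.

Lemma C1_continuous D h z : open D -> C1 D h -> D z -> {for z, continuous h}.
Proof. by move=> oD Ch Dz; apply/differentiable_continuous/C1_differentiable/Dz. Qed.

Lemma C1_deriveE D h z v : open D -> C1 D h -> D z ->
  'D_v h z = \sum_d cdir d v * 'D_(edir d) h z.
Proof. by move=> oD Ch Dz; have [dh E] := C1_diff oD Ch Dz; rewrite deriveE. Qed.

Lemma open_near D z (P : V -> Prop) : open D -> D z -> (forall w, D w -> P w) ->
  \forall w \near z, P w.
Proof.
move=> oD Dz DP; have : \forall w \near z, D w by exact: open_nbhs_nbhs.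
exact: filterS.
Qed.

Lemma eq_on_derive D f g z v : open D -> D z -> (forall w, D w -> f w = g w) ->
  'D_v f z = 'D_v g z.
Proof. by move=> oD Dz fg; apply: near_eq_derive; exact: open_near fg. Qed.

Lemma eq_on_continuous D f g z : open D -> D z -> (forall w, D w -> f w = g w) ->
  {for z, continuous f} -> {for z, continuous g}.
Proof.
move=> oD Dz fg cf; rewrite /prop_for /continuous_at -(fg _ Dz).
apply: cvg_trans cf; apply: near_eq_cvg.
by apply: open_near oD Dz _ => w /fg ->.
Qed.

(* [C1] is established by exhibiting the partial derivatives. *)
Lemma C1_intro D f (df : 'I_n + 'I_n -> V -> R) : open D ->
  (forall z, D z -> forall d, is_derive z (edir d) f (df d z)) ->
  (forall z, D z -> forall d, {for z, continuous (df d)}) -> C1 D f.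
Proof.
move=> oD H cdf z Dz d; split; first by have [] := H z Dz d.
apply: eq_on_continuous oD Dz _ (cdf z Dz d) => w Dw.
by have [_ ->] := H w Dw d.
Qed.

Lemma eq_on_C1 D f g : open D -> (forall w, D w -> f w = g w) -> C1 D f -> C1 D g.
Proof.
move=> oD fg Cf z Dz d; have [df cf] := Cf z Dz d; split.
  by apply: near_eq_derivable df; exact: open_near fg.
by apply: (eq_on_continuous oD Dz) cf => w Dw; exact: (eq_on_derive (edir d) oD Dw fg).
Qed.

Lemma C1_cst D (c : R) : C1 D (cst c).
Proof.
move=> z _ d; split=> //.
have -> : 'D_(edir d) (cst c : V -> R) = cst 0 by apply/funext => w; rewrite derive_cst.
exact: cst_continuous.
Qed.

Lemma C1_is_derive D f z v : open D -> C1 D f -> D z -> is_derive z v f ('D_v f z).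
Proof. by move=> oD Cf Dz; apply: derivableP; exact: C1_derivable Cf Dz. Qed.

Lemma C1_D D f g : open D -> C1 D f -> C1 D g -> C1 D (f \+ g).
Proof.
move=> oD Cf Cg; apply: (C1_intro oD
   (df := fun d z => 'D_(edir d) f z + 'D_(edir d) g z)) => z Dz d.
  exact: is_deriveD (derivableP (Cf z Dz d).1) (derivableP (Cg z Dz d).1).
exact: continuousD (Cf z Dz d).2 (Cg z Dz d).2.
Qed.

Lemma C1_N D f : open D -> C1 D f -> C1 D (\- f).
Proof.
move=> oD Cf; apply: (C1_intro oD (df := fun d z => - 'D_(edir d) f z)) => z Dz d.
  exact: is_deriveN (derivableP (Cf z Dz d).1).
exact: continuousN (Cf z Dz d).2.
Qed.

Lemma C1_B D f g : open D -> C1 D f -> C1 D g -> C1 D (f \- g).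
Proof. move=> oD Cf Cg; exact: C1_D oD Cf (C1_N oD Cg). Qed.

Lemma C1_M D f g : open D -> C1 D f -> C1 D g -> C1 D (f \* g).
Proof.
move=> oD Cf Cg; apply: (C1_intro oD
  (df := fun d z => f z * 'D_(edir d) g z + g z * 'D_(edir d) f z)) => z Dz d.
  exact: is_deriveM (derivableP (Cf z Dz d).1) (derivableP (Cg z Dz d).1).
apply: continuousD; apply: continuousM.
- exact: C1_continuous oD Cf Dz.
- exact: (Cg z Dz d).2.
- exact: C1_continuous oD Cg Dz.
- exact: (Cf z Dz d).2.
Qed.

Lemma C1_V D f : open D -> C1 D f -> (forall z, D z -> f z != 0) ->
  C1 D (fun z => (f z)^-1).
Proof.
move=> oD Cf f0; apply: (C1_intro oD
  (df := fun d z => - (f z) ^- 2 *: 'D_(edir d) f z)) => z Dz d.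
  split; first exact: derivableV (f0 z Dz) (Cf z Dz d).1.
  exact: deriveV (f0 z Dz) (Cf z Dz d).1.
have cf := C1_continuous oD Cf Dz.
apply: continuousM; last exact: (Cf z Dz d).2.
apply: continuousN; apply: continuousV; first by rewrite sqrf_eq0 f0.
exact: (continuousM cf cf).
Qed.

Lemma C1_sum D (I : Type) (r : seq I) (P : pred I) (F : I -> V -> R) : open D ->
  (forall i, C1 D (F i)) -> C1 D (fun z => \sum_(i <- r | P i) F i z).
Proof.
move=> oD CF; elim: r => [|i r IH].
  by apply: (eq_on_C1 oD) (@C1_cst D 0) => w _; rewrite big_nil.
case: (boolP (P i)) => Pi.
  by apply: (eq_on_C1 oD) (C1_D oD (CF i) IH) => w _ /=; rewrite big_cons Pi.
by apply: (eq_on_C1 oD) IH => w _ /=; rewrite big_cons (negbTE Pi).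
Qed.

Lemma is_derive_cdir z v d : is_derive z v (cdir d) (cdir d v).
Proof.
have lc : continuous (cdir d).
  apply/(linear_bounded_continuous (cdir d))/linear_boundedP.
  exists 1; split=> [|k k1 w]; first exact: num_real.
  by apply: le_trans (cdir_le d w) _; rewrite -[leLHS]mul1r ler_wpM2r // ltW.
have dc : differentiable (cdir d) z by exact: linear_differentiable.
split; first exact: diff_derivable.
by rewrite deriveE // diff_lin.
Qed.

Lemma C1_cdir D d : open D -> C1 D (cdir d).
Proof.
move=> oD; apply: (C1_intro oD (df := fun d' _ => cdir d (edir d'))) => z Dz d'.
  exact: is_derive_cdir.
exact: cst_continuous.
Qed.

End CnCalculus.

(** * Chain rule for maps between complex coordinate spaces *)

Section CnChainRule.
Context {R : realType} {n m : nat}.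
Variables (D : set (Cn R n)) (E : set (Cn R m)) (phi : Cn R n -> Cn R m).
Hypotheses (oD : open D) (oE : open E).
Hypothesis phiDE : forall z, D z -> E (phi z).
Hypothesis Cphi : forall d, C1 D (fun z => cdir d (phi z)).

Lemma C1_map_differentiable z : D z -> differentiable phi z.
Proof.
move=> Dz.
have -> : phi = \sum_d (fun w => cdir d (phi w) *: edir d).
  apply/funext => w; rewrite fct_sumE [LHS]cdir_sum //.
elim/big_rec : _ => [|d f _ IH]; first exact: differentiable_cst.
apply: differentiableD => //; apply: differentiableZl.
exact: C1_differentiable oD (Cphi d) Dz.
Qed.

Lemma is_derive_comp_Cn (h : Cn R m -> R) z v : C1 E h -> D z ->
  is_derive z v (h \o phi)
   (\sum_d 'D_v (fun w => cdir d (phi w)) z * 'D_(edir d) h (phi z)).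
Proof.
move=> Ch Dz; have dphi := C1_map_differentiable Dz.
have [dh hE] := C1_diff oE Ch (phiDE Dz).
have dhp : differentiable (h \o phi) z by exact: differentiable_comp.
split; first exact: diff_derivable.
rewrite deriveE // diff_comp //= hE; apply: eq_bigr => d _; congr (_ * _).
have dc := C1_differentiable oD (Cphi d) Dz.
have dcl : differentiable (cdir d) (phi z).
  exact: C1_differentiable openT (C1_cdir d openT) (I : setT (phi z)).
rewrite deriveE // (_ : (fun w => cdir d (phi w)) = cdir d \o phi) //.
rewrite (diff_comp dphi dcl) /=.
by have [_] := is_derive_cdir (phi z) ('d phi z v) d; rewrite (deriveE _ dcl).
Qed.

Lemma C1_comp (h : Cn R m -> R) : C1 E h -> C1 D (h \o phi).
Proof.
move=> Ch.
apply: C1_intro oD (fun z Dz d => is_derive_comp_Cn (edir d) Ch Dz) _ => z Dz d.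
have cphi : {for z, continuous phi} by exact/differentiable_continuous/C1_map_differentiable.
rewrite (_ : (fun _ => _) = \sum_d' (fun z => 'D_(edir d) (fun w => cdir d' (phi w)) z *
   'D_(edir d') h (phi z))); last by apply/funext => w; rewrite fct_sumE.
elim/big_rec : _ => [|d' f _ IH]; first exact: cst_continuous.
apply: continuousD => //; apply: continuousM.
  by have [] := Cphi d' Dz d.
apply: (@continuous_comp _ _ _ phi ('D_(edir d') h)) => //.
by have [] := Ch _ (phiDE Dz) d'.
Qed.

End CnChainRule.

(** * Derivatives of complex-valued functions *)

Section ComplexDerivative.
Context {R : realType} {V : normedModType R}.
Implicit Types (f g : V -> R[i]) (z v : V) (a b : R[i]).

Lemma complex_ext a b : complex.Re a = complex.Re b -> complex.Im a = complex.Im b -> a = b.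
Proof. by case: a => ? ?; case: b => ? ? /= -> ->. Qed.

(* One fixed conjugation: the library has [conjc] and [Num.conj], which are
   only convertible on [R[i]]. *)
Definition cj a : R[i] := conjc a.

Lemma ReD a b : complex.Re (a + b) = complex.Re a + complex.Re b.
Proof. by case: a; case: b. Qed.
Lemma ImD a b : complex.Im (a + b) = complex.Im a + complex.Im b.
Proof. by case: a; case: b. Qed.
Lemma ReN a : complex.Re (- a) = - complex.Re a. Proof. by case: a. Qed.
Lemma ImN a : complex.Im (- a) = - complex.Im a. Proof. by case: a. Qed.
Lemma ReM a b : complex.Re (a * b) =
  complex.Re a * complex.Re b - complex.Im a * complex.Im b.
Proof. by case: a; case: b. Qed.
Lemma ImM a b : complex.Im (a * b) =
  complex.Re a * complex.Im b + complex.Im a * complex.Re b.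
Proof. by case: a; case: b. Qed.
Lemma ReV a : complex.Re a^-1 =
  complex.Re a / (complex.Re a ^+ 2 + complex.Im a ^+ 2).
Proof. by case: a. Qed.
Lemma ImV a : complex.Im a^-1 =
  - (complex.Im a / (complex.Re a ^+ 2 + complex.Im a ^+ 2)).
Proof. by case: a. Qed.
Lemma ReJ a : complex.Re (cj a) = complex.Re a. Proof. by case: a. Qed.
Lemma ImJ a : complex.Im (cj a) = - complex.Im a. Proof. by case: a. Qed.
Definition ReImE := (ReD, ImD, ReN, ImN, ReM, ImM, ReJ, ImJ).

Lemma cjD a b : cj (a + b) = cj a + cj b. Proof. by rewrite /cj rmorphD. Qed.
Lemma cjM a b : cj (a * b) = cj a * cj b. Proof. by rewrite /cj rmorphM. Qed.
Lemma cjN a : cj (- a) = - cj a. Proof. by rewrite /cj rmorphN. Qed.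
Lemma cjB a b : cj (a - b) = cj a - cj b. Proof. by rewrite cjD cjN. Qed.
Lemma cjV a : cj a^-1 = (cj a)^-1. Proof. by rewrite /cj conjc_inv. Qed.
Lemma cjX a k : cj (a ^+ k) = cj a ^+ k. Proof. by rewrite /cj rmorphXn. Qed.
Lemma cjK a : cj (cj a) = a. Proof. by rewrite /cj conjcK. Qed.
Lemma cj0 : cj 0 = 0. Proof. by rewrite /cj conjc0. Qed.
Lemma cj1 : cj 1 = 1. Proof. by rewrite /cj conjc1. Qed.
Lemma cj_real (x : R) : cj x%:C = x%:C. Proof. exact: conjc_real. Qed.
Lemma cj_nat k : cj k%:R = k%:R. Proof. by rewrite /cj conjc_nat. Qed.
Lemma cj_sum (I : Type) (r : seq I) (P : pred I) (F : I -> R[i]) :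
  cj (\sum_(i <- r | P i) F i) = \sum_(i <- r | P i) cj (F i).
Proof. exact: (big_morph _ cjD cj0). Qed.
Lemma cj_eq0 a : (cj a == 0) = (a == 0). Proof. exact: conjc_eq0. Qed.
Definition cjE := (cjD, cjM, cjN, cjV, cjX, cjK, cj0, cj1, cj_real, cj_nat).

Lemma sqrC_neq0 a : a != 0 -> complex.Re a ^+ 2 + complex.Im a ^+ 2 != 0.
Proof.
apply: contraNneq => /eqP; rewrite paddr_eq0 ?sqr_ge0 // !sqrf_eq0.
by case: a => x y /= /andP[/eqP -> /eqP ->].
Qed.

Definition is_cder (z v : V) f (df : R[i]) :=
  is_derive z v (fun w => complex.Re (f w)) (complex.Re df) /\
  is_derive z v (fun w => complex.Im (f w)) (complex.Im df).

Lemma is_cder_eq z v f a b : is_cder z v f a -> a = b -> is_cder z v f b.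
Proof. by move=> ? <-. Qed.

Lemma is_cder_cst z v a : is_cder z v (cst a) 0.
Proof. by split; exact: is_derive_cst. Qed.

Lemma is_cderD z v f g df dg : is_cder z v f df -> is_cder z v g dg ->
  is_cder z v (fun w => f w + g w) (df + dg).
Proof.
move=> [f1 f2] [g1 g2]; split; rewrite ?ReD ?ImD.
  by under eq_fun do rewrite ReD; exact: is_deriveD.
by under eq_fun do rewrite ImD; exact: is_deriveD.
Qed.

Lemma is_cderN z v f df : is_cder z v f df -> is_cder z v (fun w => - f w) (- df).
Proof.
move=> [f1 f2]; split; rewrite ?ReN ?ImN.
  by under eq_fun do rewrite ReN; exact: is_deriveN.
by under eq_fun do rewrite ImN; exact: is_deriveN.
Qed.

Lemma is_cderJ z v f df : is_cder z v f df -> is_cder z v (fun w => cj (f w)) (cj df).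
Proof.
move=> [f1 f2]; split; rewrite ?ReJ ?ImJ.
  by under eq_fun do rewrite ReJ.
by under eq_fun do rewrite ImJ; exact: is_deriveN.
Qed.

Lemma is_cderM z v f g df dg : is_cder z v f df -> is_cder z v g dg ->
  is_cder z v (fun w => f w * g w) (f z * dg + g z * df).
Proof.
move=> [f1 f2] [g1 g2]; split.
  under eq_fun do rewrite ReM.
  apply: (is_derive_eq (is_deriveB (is_deriveM f1 g1) (is_deriveM f2 g2))).
  by rewrite !ReImE /GRing.scale /=; ring.
under eq_fun do rewrite ImM.
apply: (is_derive_eq (is_deriveD (is_deriveM f1 g2) (is_deriveM f2 g1))).
by rewrite !ReImE /GRing.scale /=; ring.
Qed.

Lemma is_cderV z v f df : f z != 0 -> is_cder z v f df ->
  is_cder z v (fun w => (f w)^-1) (- df / f z ^+ 2).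
Proof.
move=> fz [f1 f2]; have n0 := sqrC_neq0 fz.
have N : is_derive z v
  (fun w => complex.Re (f w) ^+ 2 + complex.Im (f w) ^+ 2)
  (2 * (complex.Re (f z) * complex.Re df + complex.Im (f z) * complex.Im df)).
  under eq_fun do rewrite !expr2.
  apply: (is_derive_eq (is_deriveD (is_deriveM f1 f1) (is_deriveM f2 f2))).
  by rewrite /GRing.scale /=; ring.
have NV : is_derive z v
  (fun w => (complex.Re (f w) ^+ 2 + complex.Im (f w) ^+ 2)^-1)
  (- (complex.Re (f z) ^+ 2 + complex.Im (f z) ^+ 2) ^- 2 *:
     (2 * (complex.Re (f z) * complex.Re df + complex.Im (f z) * complex.Im df))).
  have [N1 N2] := N; pose q w := complex.Re (f w) ^+ 2 + complex.Im (f w) ^+ 2.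
  split; first exact: (@derivableV _ _ q z v n0 N1).
  by rewrite (@deriveV _ _ q z v n0 N1) N2.
split.
  under eq_fun do rewrite ReV.
  apply: (is_derive_eq (is_deriveM f1 NV)).
  rewrite expr2 !(ReImE, ReV, ImV) /GRing.scale /=.
  move: (complex.Re (f z)) (complex.Im (f z)) n0 => p q n0; field.
  rewrite (_ : (p * p - q * q) ^+ 2 + _ = (p ^+ 2 + q ^+ 2) ^+ 2); last by ring.
  by rewrite sqrf_eq0 n0.
under eq_fun do rewrite ImV.
apply: (is_derive_eq (is_deriveN (is_deriveM f2 NV))).
rewrite expr2 !(ReImE, ReV, ImV) /GRing.scale /=.
move: (complex.Re (f z)) (complex.Im (f z)) n0 => p q n0; field.
rewrite (_ : (p * p - q * q) ^+ 2 + _ = (p ^+ 2 + q ^+ 2) ^+ 2); last by ring.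
by rewrite sqrf_eq0 n0.
Qed.

Lemma is_cderX z v f df k : is_cder z v f df ->
  is_cder z v (fun w => f w ^+ k) (k%:R * f z ^+ k.-1 * df).
Proof.
move=> hf; elim: k => [|k IH].
  by rewrite !mul0r; under eq_fun do rewrite expr0; exact: is_cder_cst.
under eq_fun do rewrite exprS.
apply: (is_cder_eq (is_cderM hf IH)).
case: k {IH} => [|k]; first by rewrite /= !expr0 mul0r mul0r mulr0 add0r mulr1.
have -> : k.+2%:R = k.+1%:R + 1 :> R[i] by rewrite natr1.
by rewrite !succnK exprS; ring.
Qed.

Lemma is_cder_real z v (f : V -> R) df : is_derive z v f df ->
  is_cder z v (fun w => (f w)%:C) df%:C.
Proof. by move=> ?; split=> //; exact: is_derive_cst. Qed.

Lemma is_cderZ z v f df a : is_cder z v f df ->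
  is_cder z v (fun w => a * f w) (a * df).
Proof.
by move=> hf; apply: is_cder_eq (is_cderM (is_cder_cst z v a) hf) _; rewrite mulr0 addr0.
Qed.

Lemma is_cder_sum z v (I : Type) (r : seq I) (P : pred I) (f : I -> V -> R[i]) df :
  (forall i, is_cder z v (f i) (df i)) ->
  is_cder z v (fun w => \sum_(i <- r | P i) f i w) (\sum_(i <- r | P i) df i).
Proof.
move=> H; elim: r => [|i r IH].
  by under eq_fun do rewrite big_nil; rewrite big_nil; exact: is_cder_cst.
under eq_fun do rewrite big_cons; rewrite big_cons; case: (P i) => //.
exact: is_cderD.
Qed.

End ComplexDerivative.

Arguments cj : simpl never.

(** * Wirtinger derivatives and the complex chain rule *)

Section Wirtinger.
Context {R : realType} {n : nat}.
Local Notation V := (Cn R n).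
Implicit Types (D : set V) (f g : V -> R[i]) (z v : V).

Lemma is_cder_Cderive z v f df : is_cder z v f df -> Cderive v f z = df.
Proof. by case=> -[_ a] [_ b]; rewrite /Cderive a b; case: df {a b}. Qed.

Definition CC1 D f :=
  C1 D (fun w => complex.Re (f w)) /\ C1 D (fun w => complex.Im (f w)).

Lemma CC1_is_cder D f z v : open D -> CC1 D f -> D z -> is_cder z v f (Cderive v f z).
Proof. by move=> oD [f1 f2] Dz; split; [exact: C1_is_derive f1 Dz|exact: C1_is_derive f2 Dz]. Qed.

Lemma eq_on_CC1 D f g : open D -> (forall w, D w -> f w = g w) -> CC1 D f -> CC1 D g.
Proof.
move=> oD fg [f1 f2]; split.
  by apply: (eq_on_C1 oD) f1 => w Dw; rewrite fg.
by apply: (eq_on_C1 oD) f2 => w Dw; rewrite fg.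
Qed.

Lemma eq_on_Cderive D f g z v : open D -> D z -> (forall w, D w -> f w = g w) ->
  Cderive v f z = Cderive v g z.
Proof.
by move=> oD Dz fg; congr (_ +i* _); apply: (eq_on_derive v oD Dz) => w Dw; rewrite fg.
Qed.

Lemma CC1_cst D a : CC1 D (cst a).
Proof. by split; exact: C1_cst. Qed.

Lemma CC1_D D f g : open D -> CC1 D f -> CC1 D g -> CC1 D (fun w => f w + g w).
Proof.
move=> oD [f1 f2] [g1 g2]; split.
  by apply: (eq_on_C1 oD) (C1_D oD f1 g1) => w _; rewrite ReD.
by apply: (eq_on_C1 oD) (C1_D oD f2 g2) => w _; rewrite ImD.
Qed.

Lemma CC1_N D f : open D -> CC1 D f -> CC1 D (fun w => - f w).
Proof.
move=> oD [f1 f2]; split.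
  by apply: (eq_on_C1 oD) (C1_N oD f1) => w _; rewrite ReN.
by apply: (eq_on_C1 oD) (C1_N oD f2) => w _; rewrite ImN.
Qed.

Lemma CC1_J D f : open D -> CC1 D f -> CC1 D (fun w => cj (f w)).
Proof.
move=> oD [f1 f2]; split.
  by apply: (eq_on_C1 oD) f1 => w _; rewrite ReJ.
by apply: (eq_on_C1 oD) (C1_N oD f2) => w _; rewrite ImJ.
Qed.

Lemma CC1_M D f g : open D -> CC1 D f -> CC1 D g -> CC1 D (fun w => f w * g w).
Proof.
move=> oD [f1 f2] [g1 g2]; split.
  by apply: (eq_on_C1 oD) (C1_B oD (C1_M oD f1 g1) (C1_M oD f2 g2)) => w _; rewrite ReM.
by apply: (eq_on_C1 oD) (C1_D oD (C1_M oD f1 g2) (C1_M oD f2 g1)) => w _; rewrite ImM.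
Qed.

Lemma CC1_V D f : open D -> CC1 D f -> (forall z, D z -> f z != 0) ->
  CC1 D (fun w => (f w)^-1).
Proof.
move=> oD [f1 f2] f0.
have Q : C1 D (fun z => (complex.Re (f z) ^+ 2 + complex.Im (f z) ^+ 2)^-1).
  apply: (C1_V oD) => [|z Dz]; last exact/sqrC_neq0/f0.
  exact: C1_D oD (C1_M oD f1 f1) (C1_M oD f2 f2).
split.
  by apply: (eq_on_C1 oD) (C1_M oD f1 Q) => w _; rewrite ReV.
by apply: (eq_on_C1 oD) (C1_N oD (C1_M oD f2 Q)) => w _; rewrite ImV.
Qed.

Lemma CC1_sum D (I : Type) (r : seq I) (P : pred I) (F : I -> V -> R[i]) : open D ->
  (forall i, CC1 D (F i)) -> CC1 D (fun z => \sum_(i <- r | P i) F i z).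
Proof.
move=> oD CF; elim: r => [|i r IH].
  by apply: (eq_on_CC1 oD) (@CC1_cst D 0) => w _; rewrite big_nil.
case: (boolP (P i)) => Pi.
  by apply: (eq_on_CC1 oD) (CC1_D oD (CF i) IH) => w _ /=; rewrite big_cons Pi.
by apply: (eq_on_CC1 oD) IH => w _ /=; rewrite big_cons (negbTE Pi).
Qed.

Lemma CC1_real D (h : V -> R) : C1 D h -> CC1 D (fun w => (h w)%:C).
Proof. by move=> Ch; split; [exact: Ch|exact: (@C1_cst R n D 0)]. Qed.

Lemma CC1_coord D j : open D -> CC1 D (fun w => zcoord w j).
Proof.
move=> oD; split.
  exact: (eq_on_C1 oD (fun w _ => erefl (w.1 0 j)) (C1_cdir (inl j) oD)).
exact: (eq_on_C1 oD (fun w _ => erefl (w.2 0 j)) (C1_cdir (inr j) oD)).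
Qed.

Lemma CC1_Cderive D f d :
  C1 D ('D_(edir d) (fun w => complex.Re (f w))) ->
  C1 D ('D_(edir d) (fun w => complex.Im (f w))) -> CC1 D (Cderive (edir d) f).
Proof. by move=> a b; split; [exact: a|exact: b]. Qed.

(** The algebraic half of a Wirtinger derivative, as a function of the two real partial derivatives.
    Product, quotient and conjugation rules thereby become ring identities applied to the rules for
    real directions. *)
Definition Wdz (x y : R[i]) : R[i] := (x - 'i * y) / 2.
Definition Wdzbar (x y : R[i]) : R[i] := (x + 'i * y) / 2.

Implicit Types x y a b c d : R[i].
Lemma Wdz_M a b x y x' y' : Wdz (a * x + b * x') (a * y + b * y') =
  a * Wdz x y + b * Wdz x' y'.
Proof. by rewrite /Wdz; ring. Qed.
Lemma Wdzbar_M a b x y x' y' : Wdzbar (a * x + b * x') (a * y + b * y') =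
  a * Wdzbar x y + b * Wdzbar x' y'.
Proof. by rewrite /Wdzbar; ring. Qed.
Lemma Wdz_D x y x' y' : Wdz (x + x') (y + y') = Wdz x y + Wdz x' y'.
Proof. by rewrite /Wdz; ring. Qed.
Lemma Wdzbar_D x y x' y' : Wdzbar (x + x') (y + y') = Wdzbar x y + Wdzbar x' y'.
Proof. by rewrite /Wdzbar; ring. Qed.
Lemma Wdz_N x y : Wdz (- x) (- y) = - Wdz x y.
Proof. by rewrite /Wdz; ring. Qed.
Lemma Wdz_V x y a : Wdz (- x / a) (- y / a) = - Wdz x y / a.
Proof. by rewrite /Wdz; ring. Qed.
Lemma Wdzbar_V x y a : Wdzbar (- x / a) (- y / a) = - Wdzbar x y / a.
Proof. by rewrite /Wdzbar; ring. Qed.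
Lemma Wdz_J x y : Wdz (cj x) (cj y) = cj (Wdzbar x y).
Proof.
have h2 : (2^-1 : R[i]) = (2^-1 : R)%:C by rewrite fmorphV rmorph_nat.
by rewrite /Wdz /Wdzbar h2; apply: complex_ext; rewrite !ReImE /=; ring.
Qed.
Lemma Wdzbar_J x y : Wdzbar (cj x) (cj y) = cj (Wdz x y).
Proof. by rewrite -[x in RHS]cjK -[y in RHS]cjK Wdz_J cjK. Qed.

Lemma dzE j f z : dz j f z = Wdz (Cderive (e_x j) f z) (Cderive (e_y j) f z).
Proof. by []. Qed.
Lemma dzbarE j f z : dzbar j f z = Wdzbar (Cderive (e_x j) f z) (Cderive (e_y j) f z).
Proof. by []. Qed.

Section Rules.
Variables (D : set V) (z : V).
Hypotheses (oD : open D) (Dz : D z).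
Implicit Types j : 'I_n.

Lemma eq_on_dz j f g : (forall w, D w -> f w = g w) -> dz j f z = dz j g z.
Proof. by move=> fg; rewrite !dzE !(eq_on_Cderive _ oD Dz fg). Qed.

Lemma eq_on_dzbar j f g : (forall w, D w -> f w = g w) -> dzbar j f z = dzbar j g z.
Proof. by move=> fg; rewrite !dzbarE !(eq_on_Cderive _ oD Dz fg). Qed.

Lemma dzM j f g : CC1 D f -> CC1 D g ->
  dz j (fun w => f w * g w) z = f z * dz j g z + g z * dz j f z.
Proof.
move=> hf hg; have H v := is_cderM (CC1_is_cder v oD hf Dz) (CC1_is_cder v oD hg Dz).
by rewrite !dzE !(is_cder_Cderive (H _)) Wdz_M.
Qed.

Lemma dzbarM j f g : CC1 D f -> CC1 D g ->
  dzbar j (fun w => f w * g w) z = f z * dzbar j g z + g z * dzbar j f z.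
Proof.
move=> hf hg; have H v := is_cderM (CC1_is_cder v oD hf Dz) (CC1_is_cder v oD hg Dz).
by rewrite !dzbarE !(is_cder_Cderive (H _)) Wdzbar_M.
Qed.

Lemma dzD j f g : CC1 D f -> CC1 D g ->
  dz j (fun w => f w + g w) z = dz j f z + dz j g z.
Proof.
move=> hf hg; have H v := is_cderD (CC1_is_cder v oD hf Dz) (CC1_is_cder v oD hg Dz).
by rewrite !dzE !(is_cder_Cderive (H _)) Wdz_D.
Qed.

Lemma dzbarD j f g : CC1 D f -> CC1 D g ->
  dzbar j (fun w => f w + g w) z = dzbar j f z + dzbar j g z.
Proof.
move=> hf hg; have H v := is_cderD (CC1_is_cder v oD hf Dz) (CC1_is_cder v oD hg Dz).
by rewrite !dzbarE !(is_cder_Cderive (H _)) Wdzbar_D.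
Qed.

Lemma dzN j f : CC1 D f -> dz j (fun w => - f w) z = - dz j f z.
Proof.
move=> hf; have H v := is_cderN (CC1_is_cder v oD hf Dz).
by rewrite !dzE !(is_cder_Cderive (H _)) Wdz_N.
Qed.

Lemma dzV j f : CC1 D f -> f z != 0 ->
  dz j (fun w => (f w)^-1) z = - dz j f z / f z ^+ 2.
Proof.
move=> hf f0; have H v := is_cderV f0 (CC1_is_cder v oD hf Dz).
by rewrite !dzE !(is_cder_Cderive (H _)) Wdz_V.
Qed.

Lemma dzbarV j f : CC1 D f -> f z != 0 ->
  dzbar j (fun w => (f w)^-1) z = - dzbar j f z / f z ^+ 2.
Proof.
move=> hf f0; have H v := is_cderV f0 (CC1_is_cder v oD hf Dz).
by rewrite !dzbarE !(is_cder_Cderive (H _)) Wdzbar_V.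
Qed.

Lemma dz_sum j (I : Type) (r : seq I) (P : pred I) (F : I -> V -> R[i]) :
  (forall i, CC1 D (F i)) ->
  dz j (fun z => \sum_(i <- r | P i) F i z) z = \sum_(i <- r | P i) dz j (F i) z.
Proof.
move=> CF; have H v := is_cder_sum r P (fun i => CC1_is_cder v oD (CF i) Dz).
rewrite !dzE !(is_cder_Cderive (H _)) /Wdz mulr_sumr -sumrB mulr_suml.
by apply: eq_bigr.
Qed.

Lemma dzbar_sum j (I : Type) (r : seq I) (P : pred I) (F : I -> V -> R[i]) :
  (forall i, CC1 D (F i)) ->
  dzbar j (fun z => \sum_(i <- r | P i) F i z) z = \sum_(i <- r | P i) dzbar j (F i) z.
Proof.
move=> CF; have H v := is_cder_sum r P (fun i => CC1_is_cder v oD (CF i) Dz).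
rewrite !dzbarE !(is_cder_Cderive (H _)) /Wdzbar mulr_sumr -big_split mulr_suml.
by apply: eq_bigr.
Qed.

Lemma dzJ j f : CC1 D f -> dz j (fun w => cj (f w)) z = cj (dzbar j f z).
Proof.
move=> hf; have H v := is_cderJ (CC1_is_cder v oD hf Dz).
by rewrite !dzE dzbarE !(is_cder_Cderive (H _)) Wdz_J.
Qed.

Lemma dzbarJ j f : CC1 D f -> dzbar j (fun w => cj (f w)) z = cj (dz j f z).
Proof.
move=> hf; have H v := is_cderJ (CC1_is_cder v oD hf Dz).
by rewrite !dzE dzbarE !(is_cder_Cderive (H _)) Wdzbar_J.
Qed.

End Rules.

Lemma is_cder_coord z v j : is_cder z v (fun w => zcoord w j) (zcoord v j).
Proof. by split; [exact (is_derive_cdir z v (inl j))|exact (is_derive_cdir z v (inr j))]. Qed.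

Lemma dz_coord z i j : dz i (fun w => zcoord w j) z = (i == j)%:R.
Proof.
rewrite dzE !(is_cder_Cderive (is_cder_coord _ _ _)) /Wdz.
apply: (@mulIf _ 2); rewrite ?pnatr_eq0 // divfK ?pnatr_eq0 //.
rewrite /zcoord /e_x /e_y /= !mxE eqxx /= eq_sym.
by case: eqP => _; apply: complex_ext; rewrite !ReImE /=; ring.
Qed.

Lemma dzbar_coord z i j : dzbar i (fun w => zcoord w j) z = 0.
Proof.
rewrite dzbarE !(is_cder_Cderive (is_cder_coord _ _ _)) /Wdzbar.
rewrite /zcoord /e_x /e_y /= !mxE eqxx /=.
suff -> : ((j == i)%:R +i* 0 + 'i * (0 +i* (j == i)%:R) : R[i]) = 0 by rewrite mul0r.
by apply: complex_ext; rewrite !ReImE /=; ring.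
Qed.

Lemma dz_cst z i a : dz i (cst a) z = 0.
Proof.
by rewrite dzE !(is_cder_Cderive (is_cder_cst _ _ _)) /Wdz mulr0 subr0 mul0r.
Qed.

Lemma dzbar_cst z i a : dzbar i (cst a) z = 0.
Proof.
by rewrite dzbarE !(is_cder_Cderive (is_cder_cst _ _ _)) /Wdzbar mulr0 addr0 mul0r.
Qed.

End Wirtinger.

Section WirtingerSum.
Context {R : realType}.

Lemma Wdz_sum (I : finType) (F G : I -> R[i]) :
  Wdz (\sum_i F i) (\sum_i G i) = \sum_i Wdz (F i) (G i).
Proof. by rewrite /Wdz mulr_sumr -sumrB mulr_suml. Qed.

Lemma Wdzbar_sum (I : finType) (F G : I -> R[i]) :
  Wdzbar (\sum_i F i) (\sum_i G i) = \sum_i Wdzbar (F i) (G i).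
Proof. by rewrite /Wdzbar mulr_sumr -big_split mulr_suml. Qed.

End WirtingerSum.

Section WirtingerChain.
Context {R : realType} {n m : nat}.
Variables (D : set (Cn R n)) (E : set (Cn R m)) (phi : Cn R n -> Cn R m).
Hypotheses (oD : open D) (oE : open E).
Hypothesis phiDE : forall z, D z -> E (phi z).
Local Notation phic k := (fun w => zcoord (phi w) k).
Hypothesis Cphi : forall k, CC1 D (phic k).

Lemma C1_map_cdir d : C1 D (fun z => cdir d (phi z)).
Proof.
case: d => k; have [H1 H2] := Cphi k.
  exact: (eq_on_C1 oD (fun w _ => erefl ((phi w).1 0 k)) H1).
exact: (eq_on_C1 oD (fun w _ => erefl ((phi w).2 0 k)) H2).
Qed.

Lemma CC1_comp f : CC1 E f -> CC1 D (fun w => f (phi w)).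
Proof.
move=> [f1 f2]; split.
  exact: (C1_comp oD oE phiDE C1_map_cdir f1).
exact: (C1_comp oD oE phiDE C1_map_cdir f2).
Qed.

(** Pairs the x and y terms of the real chain rule, turning a sum over 2m real directions of the
    target into one over its m complex coordinates. *)
Lemma Wdz_split (x y : R[i]) (a b : R) :
  x * a%:C + y * b%:C = Wdz x y * (a +i* b) + Wdzbar x y * cj (a +i* b).
Proof.
have h2 : (2^-1 : R[i]) = (2^-1 : R)%:C by rewrite fmorphV rmorph_nat.
by rewrite /Wdz /Wdzbar h2; apply: complex_ext; rewrite !ReImE /=; field.
Qed.

Lemma Cderive_comp f z v : CC1 E f -> D z ->
  Cderive v (fun w => f (phi w)) z =
  \sum_k (dz k f (phi z) * Cderive v (phic k) z +
          dzbar k f (phi z) * cj (Cderive v (phic k) z)).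
Proof.
move=> [f1 f2] Dz; rewrite /Cderive.
have [_ E1] := is_derive_comp_Cn oD oE phiDE C1_map_cdir v f1 Dz.
have [_ E2] := is_derive_comp_Cn oD oE phiDE C1_map_cdir v f2 Dz.
rewrite /comp /= in E1 E2; rewrite {}E1 {}E2.
under [RHS]eq_bigr => k _ do rewrite dzE dzbarE -Wdz_split.
rewrite !big_sumType /= -!big_split /=.
apply: complex_ext => /=.
  rewrite (big_morph _ (@ReD R) (erefl _)); apply: eq_bigr => k _.
  rewrite !ReImE /Cderive /=.
  by move: ('D_(e_x k) _ _) ('D_(e_y k) _ _) ('D_v _ _) ('D_v _ _)
    ('D_(e_x k) _ _) ('D_(e_y k) _ _) => a b c d a' b'; ring.
rewrite (big_morph _ (@ImD R) (erefl _)); apply: eq_bigr => k _.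
rewrite !ReImE /Cderive /=.
by move: ('D_(e_x k) _ _) ('D_(e_y k) _ _) ('D_v _ _) ('D_v _ _)
  ('D_(e_x k) _ _) ('D_(e_y k) _ _) => a b c d a' b'; ring.
Qed.

Lemma dz_comp j f z : CC1 E f -> D z ->
  dz j (fun w => f (phi w)) z =
  \sum_k (dz k f (phi z) * dz j (phic k) z +
          dzbar k f (phi z) * cj (dzbar j (phic k) z)).
Proof.
move=> Cf Dz; rewrite dzE !(Cderive_comp _ Cf Dz).
rewrite Wdz_sum; apply: eq_bigr => k _; rewrite Wdz_M Wdz_J; exact: erefl.
Qed.

Lemma dzbar_comp j f z : CC1 E f -> D z ->
  dzbar j (fun w => f (phi w)) z =
  \sum_k (dz k f (phi z) * dzbar j (phic k) z +
          dzbar k f (phi z) * cj (dz j (phic k) z)).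
Proof.
move=> Cf Dz; rewrite dzbarE !(Cderive_comp _ Cf Dz).
rewrite Wdzbar_sum; apply: eq_bigr => k _; rewrite Wdzbar_M Wdzbar_J; exact: erefl.
Qed.

End WirtingerChain.

(** * Class C2 and pullback of mixed second derivatives by holomorphic maps *)

Section C2.
Context {R : realType} {n : nat}.
Local Notation V := (Cn R n).
Implicit Types (D : set V) (h : V -> R).

Definition C2 D h := C1 D h /\ forall d, C1 D ('D_(edir d) h).

Lemma C2_onP D h : C2_on D h <-> C2 D h.
Proof.
split=> -[H1 H2]; split; try exact/C1_onP.
  by case=> j; [exact/C1_onP/(H2 j).1|exact/C1_onP/(H2 j).2].
by move=> j; split; apply/C1_onP; [exact: (H2 (inl j))|exact: (H2 (inr j))].
Qed.

Lemma C2_cst D (c : R) : open D -> C2 D (cst c).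
Proof.
move=> oD; split=> [|d]; first exact: C1_cst.
by apply: (eq_on_C1 oD _ (@C1_cst R n D 0)) => w _; rewrite derive_cst.
Qed.

Definition creal h : V -> R[i] := fun w => (h w)%:C.

Lemma Cderive_creal h v z : Cderive v (creal h) z = ('D_v h z)%:C.
Proof. by rewrite /Cderive /creal /= derive_cst. Qed.

Lemma CC1_dzbar_creal D h j : open D -> C2 D h -> CC1 D (dzbar j (creal h)).
Proof.
move=> oD [_ H].
apply: (@eq_on_CC1 _ _ D (fun w => Wdzbar ('D_(edir (inl j)) h w)%:C
  ('D_(edir (inr j)) h w)%:C) _ oD).
  by move=> w _; rewrite dzbarE !Cderive_creal.
rewrite /Wdzbar; apply: (CC1_M oD); last exact: CC1_cst.
apply: (CC1_D oD); first exact: (CC1_real (H (inl j))).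
by apply: (CC1_M oD); [exact: CC1_cst|exact: (CC1_real (H (inr j)))].
Qed.

End C2.

Lemma C2_comp_gen {R : realType} {n m : nat} (D : set (Cn R n)) (E : set (Cn R m))
    (phi : Cn R n -> Cn R m) (h : Cn R m -> R) : open D -> open E ->
  (forall z, D z -> E (phi z)) -> (forall d, C2 D (fun w => cdir d (phi w))) ->
  C2 E h -> C2 D (h \o phi).
Proof.
move=> oD oE phiDE Cphi [h1 h2]; have Cd d := (Cphi d).1.
split=> [|d]; first exact: (C1_comp oD oE phiDE Cd h1).
apply: (@eq_on_C1 _ _ D (fun z => \sum_d' 'D_(edir d) (fun w => cdir d' (phi w)) z *
   'D_(edir d') h (phi z)) _ oD).
  by move=> w Dw; have [_ ->] := is_derive_comp_Cn oD oE phiDE Cd (edir d) h1 Dw.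
apply: (C1_sum _ _ oD) => d'; apply: (C1_M oD); first exact: ((Cphi d').2 d).
exact: (C1_comp oD oE phiDE Cd (h2 d')).
Qed.

Section HolomorphicPullback.
Context {R : realType} {n m : nat}.
Variables (D : set (Cn R n)) (E : set (Cn R m)) (phi : Cn R n -> Cn R m).
Hypotheses (oD : open D) (oE : open E).
Hypothesis phiDE : forall z, D z -> E (phi z).
Local Notation phic k := (fun w => zcoord (phi w) k).

(** Holomorphy in the form required by a second order chain rule: the Cauchy-Riemann equations for
    the function and for its first derivatives, with both of class C1. *)
Definition holo2 (f : Cn R n -> R[i]) :=
  [/\ CC1 D f, forall j z, D z -> dzbar j f z = 0,
      forall j, CC1 D (dz j f) & forall i j z, D z -> dzbar i (dz j f) z = 0].

Hypothesis Hphi : forall k, holo2 (phic k).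

Lemma holo2_Cderive f z j : holo2 f -> D z ->
  Cderive (e_x j) f z = dz j f z /\ Cderive (e_y j) f z = 'i * dz j f z.
Proof.
move=> [_ H _ _] Dz; have := H j z Dz; rewrite dzbarE dzE.
move: (Cderive (e_x j) f z) (Cderive (e_y j) f z) => x y.
rewrite /Wdz /Wdzbar => /eqP; rewrite mulf_eq0 invr_eq0 pnatr_eq0 orbF addr_eq0 => /eqP xE.
have yE : y = 'i * x.
  by rewrite xE mulrN mulrA -expr2 sqr_i mulN1r opprK.
suff -> : (x - 'i * y) / 2 = x by split=> //; exact: yE.
by rewrite -[- ('i * y)]opprK opprK -xE; field.
Qed.

Lemma holo2_cdir_C2 d' : (forall k, CC1 D (phic k)) -> C2 D (fun w => cdir d' (phi w)).
Proof.
move=> Cphi; split=> [|d]; first exact: (C1_map_cdir oD Cphi d').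
have key k : CC1 D (Cderive (edir d) (phic k)).
  have [_ _ c1 _] := Hphi k.
  case: d => j.
    apply: (eq_on_CC1 oD _ (c1 j)) => w Dw.
    by have [] := holo2_Cderive j (Hphi k) Dw.
  apply: (eq_on_CC1 oD _ (CC1_M oD (@CC1_cst _ _ D 'i) (c1 j))) => w Dw.
  by have [_ ->] := holo2_Cderive j (Hphi k) Dw.
case: d' => k; have [k1 k2] := key k.
  exact: k1.
exact: k2.
Qed.

Lemma C2_comp h : C2 E h -> C2 D (h \o phi).
Proof.
have Cphi k : CC1 D (phic k) by have [] := Hphi k.
by apply: (C2_comp_gen oD oE phiDE) => d; exact: holo2_cdir_C2.
Qed.

(** Holomorphy leaves a single term: the antiholomorphic derivative of the composite only sees the
    conjugate of the Jacobian, and differentiating that conjugate holomorphically gives 0. Hence no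
    second derivative of the map appears. *)
Lemma hess_comp h i j z : C2 E h -> D z ->
  dz i (dzbar j (creal (h \o phi))) z =
  \sum_l \sum_k dz k (dzbar l (creal h)) (phi z) *
     (dz i (phic k) z * cj (dz j (phic l) z)).
Proof.
move=> Ch Dz; have Cphi k : CC1 D (phic k) by have [] := Hphi k.
have Cr : CC1 E (creal h) by apply: CC1_real; case: Ch.
have Cb l : CC1 E (dzbar l (creal h)) by exact: (CC1_dzbar_creal l oE Ch).
have Cdz l : CC1 D (dz j (phic l)) by have [] := Hphi l.
rewrite (@eq_on_dz _ _ D z oD Dz i (dzbar j (creal (h \o phi)))
  (fun w => \sum_l dzbar l (creal h) (phi w) * cj (dz j (phic l) w))); last first.
  move=> w Dw; rewrite (dzbar_comp oD oE phiDE Cphi j Cr Dw); apply: eq_bigr => l _.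
  by have [_ hl _ _] := Hphi l; rewrite hl // mulr0 add0r.
rewrite (dz_sum oD Dz) => [|l]; last first.
  by apply: (CC1_M oD); [exact: (CC1_comp oD oE phiDE Cphi (Cb l))|exact: (CC1_J oD (Cdz l))].
apply: eq_bigr => l _.
rewrite (dzM oD Dz); [|exact: (CC1_comp oD oE phiDE Cphi (Cb l))|exact: (CC1_J oD (Cdz l))].
have [_ _ _ hz] := Hphi l; rewrite (dzJ oD Dz i (Cdz l)) hz // cj0 mulr0 add0r.
rewrite (dz_comp oD oE phiDE Cphi i (Cb l) Dz) mulr_sumr; apply: eq_bigr => k _.
have [_ hk _ _] := Hphi k; rewrite hk // cj0 mulr0 addr0.
by rewrite [RHS]mulrA [RHS]mulrC.
Qed.

End HolomorphicPullback.

Section HoloClosure.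
Context {R : realType} {n : nat}.
Variable D : set (Cn R n).
Hypothesis oD : open D.
Implicit Types (f g : Cn R n -> R[i]).

Lemma holo2_cst a : holo2 D (cst a : Cn R n -> R[i]).
Proof.
have E j : dz j (cst a : Cn R n -> R[i]) = cst 0 by apply/funext => z; rewrite dz_cst.
split=> [|j z _|j|i j z _]; rewrite ?E ?dzbar_cst //; exact: CC1_cst.
Qed.

Lemma holo2_coord k : holo2 D (fun w => zcoord w k).
Proof.
have E j : dz j (fun w : Cn R n => zcoord w k) = cst (j == k)%:R.
  by apply/funext => z; rewrite dz_coord.
split=> [|j z _|j|i j z _]; rewrite ?E ?dzbar_cst ?dzbar_coord //.
  exact: CC1_coord.
exact: CC1_cst.
Qed.

Lemma holo2_D f g : holo2 D f -> holo2 D g -> holo2 D (fun w => f w + g w).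
Proof.
move=> [f1 f2 f3 f4] [g1 g2 g3 g4].
have E j w : D w -> dz j f w + dz j g w = dz j (fun w => f w + g w) w.
  by move=> Dw; rewrite (dzD oD Dw).
split.
- exact: (CC1_D oD).
- by move=> j z Dz; rewrite (dzbarD oD Dz j f1 g1) f2 // g2 // addr0.
- by move=> j; exact: (eq_on_CC1 oD (E j) (CC1_D oD (f3 j) (g3 j))).
- move=> i j z Dz; rewrite -(eq_on_dzbar oD Dz i (E j)).
  by rewrite (dzbarD oD Dz i (f3 j) (g3 j)) f4 // g4 // addr0.
Qed.

Lemma holo2_M f g : holo2 D f -> holo2 D g -> holo2 D (fun w => f w * g w).
Proof.
move=> [f1 f2 f3 f4] [g1 g2 g3 g4].
have E j w : D w -> f w * dz j g w + g w * dz j f w = dz j (fun w => f w * g w) w.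
  by move=> Dw; rewrite (dzM oD Dw).
split.
- exact: (CC1_M oD).
- by move=> j z Dz; rewrite (dzbarM oD Dz j f1 g1) f2 // g2 // !mulr0 addr0.
- move=> j; apply: (eq_on_CC1 oD (E j)).
  exact: (CC1_D oD (CC1_M oD f1 (g3 j)) (CC1_M oD g1 (f3 j))).
- move=> i j z Dz; rewrite -(eq_on_dzbar oD Dz i (E j)).
  rewrite (dzbarD oD Dz i (CC1_M oD f1 (g3 j)) (CC1_M oD g1 (f3 j))).
  rewrite (dzbarM oD Dz i f1 (g3 j)) (dzbarM oD Dz i g1 (f3 j)).
  by rewrite f4 // g4 // f2 // g2 // !mulr0 !addr0.
Qed.

Lemma holo2_V f : holo2 D f -> (forall w, D w -> f w != 0) ->
  holo2 D (fun w => (f w)^-1).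
Proof.
move=> [f1 f2 f3 f4] f0.
have E j w : D w -> - dz j f w * ((f w)^-1 * (f w)^-1) = dz j (fun w => (f w)^-1) w.
  by move=> Dw; rewrite (dzV oD Dw j f1 (f0 w Dw)) -invfM -expr2.
have c1 := CC1_V oD f1 f0.
have b1 i w : D w -> dzbar i (fun w => (f w)^-1) w = 0.
  by move=> Dw; rewrite (dzbarV oD Dw i f1 (f0 w Dw)) f2 // oppr0 mul0r.
have c2 := CC1_M oD c1 c1.
have c3 j := CC1_N oD (f3 j).
split.
- exact: c1.
- by move=> j w Dw; exact: b1.
- by move=> j; exact: (eq_on_CC1 oD (E j) (CC1_M oD (c3 j) c2)).
- move=> i j z Dz; rewrite -(eq_on_dzbar oD Dz i (E j)).
  rewrite (dzbarM oD Dz i (c3 j) c2) (dzbarM oD Dz i c1 c1) b1 // !mulr0 addr0 mulr0 add0r.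
  have -> : dzbar i (fun w => - dz j f w) z = 0; last by rewrite mulr0.
  have N := is_cderN (CC1_is_cder _ oD (f3 j) Dz).
  rewrite dzbarE !(is_cder_Cderive (N _)) /Wdzbar mulrN -opprD mulNr.
  by have := f4 i j z Dz; rewrite dzbarE /Wdzbar => ->; rewrite oppr0.
Qed.

Lemma holo2_sum (I : Type) (r : seq I) (P : pred I) (F : I -> Cn R n -> R[i]) :
  (forall i, holo2 D (F i)) -> holo2 D (fun z => \sum_(i <- r | P i) F i z).
Proof.
move=> HF; elim: r => [|i r IH].
  by under eq_fun do rewrite big_nil; exact: holo2_cst.
under eq_fun do rewrite big_cons; case: (P i); last exact: IH.
exact: (holo2_D (HF i) IH).
Qed.

End HoloClosure.

(** * The ball and the invariant Laplacian *)

Section Ball.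
Context {R : realType} {n : nat}.
Implicit Types (z w : Cn R n) (h : Cn R n -> R).

Definition sqnorm z : R := \sum_d cdir d z ^+ 2.

Lemma sqnormE z : sqnorm z = \sum_(j < n) (z.1 0 j ^+ 2 + z.2 0 j ^+ 2).
Proof. by rewrite /sqnorm big_sumType /= -big_split. Qed.

Lemma sqnorm_ge0 z : 0 <= sqnorm z.
Proof. by apply: sumr_ge0 => d _; exact: sqr_ge0. Qed.

Lemma enorm_sqr z : enorm z ^+ 2 = sqnorm z.
Proof. by rewrite /enorm -sqnormE sqr_sqrtr // sqnorm_ge0. Qed.

Lemma BnP z : Bn R n z <-> sqnorm z < 1.
Proof.
rewrite /Bn /= /enorm -sqnormE -[X in _ < X]sqrtr1.
by rewrite ltr_sqrt.
Qed.

Lemma C1_sqnorm (D : set (Cn R n)) : open D -> C1 D (sqnorm : Cn R n -> R).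
Proof.
move=> oD; apply: (C1_sum _ _ oD) => d.
by apply: (eq_on_C1 oD _ (C1_M oD (C1_cdir d oD) (C1_cdir d oD))) => w _; rewrite expr2.
Qed.

Lemma continuous_sqnorm : continuous (sqnorm : Cn R n -> R).
Proof. by move=> z; exact: (C1_continuous openT (C1_sqnorm openT) (I : setT z)). Qed.

Lemma open_Bn : open (Bn R n).
Proof.
have -> : Bn R n = sqnorm @^-1` [set x | x < 1].
  by apply/seteqP; split=> z /=; rewrite -BnP.
by apply: open_comp => [z _|]; [exact: continuous_sqnorm|exact: open_lt].
Qed.

Lemma sqnormC z : (sqnorm z)%:C = \sum_j zcoord z j * cj (zcoord z j).
Proof.
rewrite sqnormE rmorph_sum; apply: eq_bigr => j _.
by apply: complex_ext; rewrite !ReImE /=; ring.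
Qed.

(** The operator stripped of the factor 4(1 - |z|^2), which does not vanish on the ball and so does
    not affect the equation. *)
Definition LB h z : R[i] := \sum_i \sum_j
  ((i == j)%:R - zcoord z i * cj (zcoord z j)) * dz i (dzbar j (creal h)) z.

Lemma harmonicP h : real_invariant_harmonic h <->
  C2 (Bn R n) h /\ (forall z, Bn R n z -> LB h z = 0).
Proof.
have E z : LaplaceBeltrami (creal h) z = 4 * (1 - enorm z ^+ 2)%:C * LB h z by [].
split=> [[/C2_onP c _ H]|[c H]]; split=> //.
- move=> z Bz; have /eqP := H z Bz; rewrite E mulf_eq0 => /orP[|/eqP //].
  rewrite mulf_eq0 pnatr_eq0 /= fmorph_eq0 enorm_sqr subr_eq0 eq_sym => /eqP E1.
  by move/BnP: Bz; rewrite E1 ltxx.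
- exact/C2_onP.
- by apply/C2_onP; exact: (@C2_cst R n (Bn R n) 0 open_Bn).
- by move=> z Bz; rewrite E H // mulr0.
Qed.

End Ball.

Definition ofC {R : realType} {n : nat} (f : 'I_n -> R[i]) : Cn R n :=
  (\row_k complex.Re (f k), \row_k complex.Im (f k)).

Lemma zcoord_ofC {R : realType} {n : nat} (f : 'I_n -> R[i]) k : zcoord (ofC f) k = f k.
Proof. by rewrite /zcoord /ofC /= !mxE; case: (f k). Qed.

Lemma zcoord_inj {R : realType} {n : nat} (z w : Cn R n) :
  (forall k, zcoord z k = zcoord w k) -> z = w.
Proof.
move=> E; case: z w E => [a b] [c d] E; congr pair; apply/rowP => k.
  by have [] := E k.
by have [] := E k.
Qed.

Definition nrm2 {R : realType} (a : R[i]) : R := complex.Re a ^+ 2 + complex.Im a ^+ 2.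

Section Nrm2.
Context {R : realType}.
Implicit Types x y a : R[i].

Lemma nrm2C a : a * cj a = (nrm2 a)%:C.
Proof. by apply: complex_ext; rewrite !ReImE /nrm2 /=; ring. Qed.

Lemma nrm2_ge0 a : 0 <= nrm2 a. Proof. by rewrite addr_ge0 ?sqr_ge0. Qed.

Lemma nrm2_eq0 a : (nrm2 a == 0) = (a == 0).
Proof.
apply/idP/eqP => [|->]; last by rewrite /nrm2 /= expr0n addr0.
by move=> E; apply/eqP; apply: contraLR E; exact: sqrC_neq0.
Qed.

Lemma nrm2_gt0 a : (0 < nrm2 a) = (a != 0).
Proof. by rewrite lt_neqAle nrm2_ge0 andbT eq_sym nrm2_eq0. Qed.

Lemma nrm2M x y : nrm2 (x * y) = nrm2 x * nrm2 y.
Proof. by rewrite /nrm2 ReM ImM; ring. Qed.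

Lemma nrm2V x : nrm2 x^-1 = (nrm2 x)^-1.
Proof.
have [->|x0] := eqVneq x 0; first by rewrite invr0 /nrm2 /= expr0n addr0 invr0.
have n0 : nrm2 x != 0 by rewrite nrm2_eq0.
apply: (mulIf n0); rewrite mulVf // -nrm2M mulVf //.
by rewrite /nrm2 /= expr0n expr1n addr0.
Qed.

Lemma nrm2J a : nrm2 (cj a) = nrm2 a.
Proof. by rewrite /nrm2 ReJ ImJ sqrrN. Qed.

End Nrm2.

(** * Automorphisms of the ball given by U(n,1) and invariance of the equation *)

Lemma contract_hess {R : realType} {n : nat} (a H : 'I_n -> 'I_n -> R[i])
    (u v : 'I_n -> 'I_n -> R[i]) :
  \sum_i \sum_j a i j * (\sum_l \sum_k H k l * (u k i * v l j)) =
  \sum_k \sum_l H k l * \sum_i \sum_j a i j * (u k i * v l j).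
Proof.
transitivity (\sum_i \sum_j \sum_l \sum_k a i j * (H k l * (u k i * v l j))).
  apply: eq_bigr => i _; apply: eq_bigr => j _; rewrite mulr_sumr.
  by apply: eq_bigr => l _; rewrite mulr_sumr.
transitivity (\sum_i \sum_l \sum_k \sum_j a i j * (H k l * (u k i * v l j))).
  apply: eq_bigr => i _; rewrite exchange_big; apply: eq_bigr => l _.
  by rewrite exchange_big.
rewrite exchange_big [RHS]exchange_big; apply: eq_bigr => l _.
rewrite exchange_big; apply: eq_bigr => k _.
rewrite mulr_sumr; apply: eq_bigr => i _; rewrite mulr_sumr.
by apply: eq_bigr => j _; rewrite mulrCA.
Qed.

(* The ball automorphism of the matrix [[A, b], [c, d]]; [rows] and [cols] hold
   when the matrix lies in U(n, 1). *)
Section Automorphism.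
Context {R : realType} {n : nat}.
Variables (A : 'I_n -> 'I_n -> R[i]) (b c : 'I_n -> R[i]) (d : R[i]).

Definition autN k (z : Cn R n) := \sum_i A k i * zcoord z i + b k.
Definition autD (z : Cn R n) := \sum_i c i * zcoord z i + d.
Definition aut (z : Cn R n) : Cn R n := ofC (fun k => autN k z * (autD z)^-1).

(** With J = diag(1, ..., 1, -1) and M^H the adjoint of M, the fields [rowsA], [rowsAc], [rowsc] are
    the blocks of M J M^H = J, and [cols] is M^H J M = J evaluated on the vector (z, 1). The rows
    serve the invariance of the metric; [cols] keeps the ball stable and the denominator away from
    0. *)
Record U_n1 : Prop := {
  rowsA : forall k l, \sum_i A k i * cj (A l i) - b k * cj (b l) = (k == l)%:R;
  rowsAc : forall k, \sum_i A k i * cj (c i) = b k * cj d;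
  rowsc : \sum_i c i * cj (c i) - d * cj d = -1;
  cols : forall z, \sum_k autN k z * cj (autN k z) - autD z * cj (autD z) =
    (sqnorm z)%:C - 1 }.

Hypothesis HU : U_n1.

Lemma aut_coord k z : zcoord (aut z) k = autN k z * (autD z)^-1.
Proof. exact: zcoord_ofC. Qed.

Lemma autD_norm z : nrm2 (autD z) = 1 - sqnorm z + \sum_k nrm2 (autN k z).
Proof.
have := congr1 (@complex.Re R) (cols HU z).
under eq_bigr do rewrite nrm2C; rewrite nrm2C.
rewrite !ReD !ReN (big_morph _ (@ReD R) (erefl (complex.Re 0))) /= => E.
by move: E; move: (\sum_k _) (nrm2 _) => x y E; lra.
Qed.

Lemma autD_neq0 z : Bn R n z -> autD z != 0.
Proof.
move=> /BnP z1; apply/eqP => D0.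
have := autD_norm z; rewrite D0 /nrm2 /= !expr0n /= addr0 => E.
have : 0 < 1 - sqnorm z + \sum_k nrm2 (autN k z).
  rewrite ltr_wpDr ?subr_gt0 //; by apply: sumr_ge0 => k _; exact: nrm2_ge0.
by rewrite -E ltxx.
Qed.

Lemma sqnorm_nrm2 (z : Cn R n) : sqnorm z = \sum_k nrm2 (zcoord z k).
Proof. by rewrite sqnormE. Qed.

Lemma aut_Bn z : Bn R n z -> Bn R n (aut z).
Proof.
move=> Bz; apply/BnP; have np : 0 < nrm2 (autD z) by rewrite nrm2_gt0 autD_neq0.
rewrite sqnorm_nrm2; under eq_bigr do rewrite aut_coord nrm2M nrm2V.
rewrite -mulr_suml ltr_pdivrMr // mul1r autD_norm ltrDr subr_gt0.
exact/BnP.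
Qed.

Let B := Bn R n.
Let oB : open B := open_Bn.

Lemma autN_holo k : holo2 B (autN k).
Proof.
apply: (holo2_D oB); last exact: holo2_cst.
apply: (holo2_sum oB) => i; apply: (holo2_M oB); first exact: holo2_cst.
exact: (holo2_coord oB).
Qed.

Lemma autD_holo : holo2 B autD.
Proof.
apply: (holo2_D oB); last exact: holo2_cst.
apply: (holo2_sum oB) => i; apply: (holo2_M oB); first exact: holo2_cst.
exact: (holo2_coord oB).
Qed.

Lemma aut_holo k : holo2 B (fun z => zcoord (aut z) k).
Proof.
under eq_fun do rewrite aut_coord.
apply: (holo2_M oB); first exact: autN_holo.
exact: (holo2_V oB autD_holo autD_neq0).
Qed.

Lemma dz_affine (a : 'I_n -> R[i]) (e : R[i]) i z : B z ->
  dz i (fun w => \sum_j a j * zcoord w j + e) z = a i.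
Proof.
move=> Bz; have C j : CC1 B (fun w => a j * zcoord w j).
  by apply: (CC1_M oB); [exact: CC1_cst|exact: (CC1_coord j oB)].
rewrite (dzD oB Bz i (CC1_sum _ _ oB C) (@CC1_cst _ _ B e)) dz_cst addr0.
rewrite (dz_sum oB Bz i _ _ C) (bigD1 i) //= big1 => [|j ji].
  rewrite (dzM oB Bz i (@CC1_cst _ _ B (a i)) (CC1_coord i oB)).
  by rewrite dz_cst dz_coord eqxx mulr1 mulr0 !addr0.
rewrite (dzM oB Bz i (@CC1_cst _ _ B (a j)) (CC1_coord j oB)).
by rewrite dz_cst dz_coord eq_sym (negbTE ji) !mulr0 addr0.
Qed.

Lemma dz_aut i k z : B z -> dz i (fun w => zcoord (aut w) k) z =
  (A k i * autD z - autN k z * c i) / autD z ^+ 2.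
Proof.
move=> Bz; have D0 := autD_neq0 Bz.
have -> : (fun w => zcoord (aut w) k) = (fun w => autN k w * (autD w)^-1).
  by apply/funext => w; rewrite aut_coord.
have [N1 _ _ _] := autN_holo k; have [D1 _ _ _] := autD_holo.
rewrite (dzM oB Bz i N1 (CC1_V oB D1 autD_neq0)) (dzV oB Bz i D1 D0).
rewrite (dz_affine (A k) (b k) i Bz) (dz_affine c d i Bz).
by move: (autN k z) (autD z) (A k i) (c i) D0 => x y x' y' y0; field.
Qed.

(** Invariance of the Bergman metric: the tensor delta - z conj(z) is carried to itself up to
    1/|D|^2, the factor by which the automorphism scales 1 - |z|^2. The left side splits into the
    Gram matrix of the rows of the Jacobian minus a rank one term, and each part is evaluated
    separately. *)
Lemma aut_metric k l z : B z ->
  \sum_i \sum_j ((i == j)%:R - zcoord z i * cj (zcoord z j)) *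
     (dz i (fun w => zcoord (aut w) k) z * cj (dz j (fun w => zcoord (aut w) l) z)) =
  ((k == l)%:R - zcoord (aut z) k * cj (zcoord (aut z) l)) / (autD z * cj (autD z)).
Proof.
move=> Bz; have D0 := autD_neq0 Bz.
have E1 m : \sum_i dz i (fun w => zcoord (aut w) m) z * zcoord z i =
    (autN m z * d - b m * autD z) / autD z ^+ 2.
  under eq_bigr do rewrite dz_aut // mulrAC mulrBl [_ * autD z]mulrC -!mulrA.
  rewrite -mulr_suml sumrB -!mulr_sumr; congr (_ / _).
  have -> : \sum_i A m i * zcoord z i = autN m z - b m by rewrite /autN addrK.
  have -> : \sum_i c i * zcoord z i = autD z - d by rewrite /autD addrK.
  by move: (autN m z) (autD z) (b m) d => *; ring.
have cD0 : cj (autD z) != 0 by rewrite cj_eq0.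
(* The Gram matrix of the Jacobian expands into sums over the rows of the matrix, which the
   relations of [U_n1] replace by entries of [b] and [d]. *)
have E2 : \sum_i dz i (fun w => zcoord (aut w) k) z * cj (dz i (fun w => zcoord (aut w) l) z)
   = (autD z * cj (autD z) * ((k == l)%:R + b k * cj (b l))
      - autD z * cj (autN l z) * (b k * cj d) - autN k z * cj (autD z) * (d * cj (b l))
      + autN k z * cj (autN l z) * (d * cj d - 1)) / (autD z ^+ 2 * cj (autD z) ^+ 2).
  have F1 := rowsA HU k l; have F2 := rowsAc HU k; have F3 := rowsAc HU l.
  have F4 := rowsc HU.
  have -> : (k == l)%:R + b k * cj (b l) = \sum_i A k i * cj (A l i) by rewrite -F1 subrK.
  have -> : d * cj (b l) = \sum_i c i * cj (A l i).
    rewrite -[d]cjK -cjM mulrC -F3 cj_sum; apply: eq_bigr => i _.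
    by rewrite cjM cjK mulrC.
  have -> : d * cj d - 1 = \sum_i c i * cj (c i) by rewrite -F4 addrC subrK.
  rewrite -F2 !mulr_sumr -!sumrB -big_split mulr_suml; apply: eq_bigr => i _.
  rewrite !dz_aut //; cbv beta.
  move: (autD z) D0 cD0 (autN k z) (autN l z) (A k i) (A l i) (c i).
  move=> x x0 cx0 N N' a a' e; rewrite !cjE.
  move: (cj x) cx0 (cj N') (cj a') (cj e) => x' x'0 M b1 e' /=; field.
  by do ?[apply/andP; split].
transitivity (\sum_i dz i (fun w => zcoord (aut w) k) z * cj (dz i (fun w => zcoord (aut w) l) z)
  - (\sum_i dz i (fun w => zcoord (aut w) k) z * zcoord z i) *
    cj (\sum_i dz i (fun w => zcoord (aut w) l) z * zcoord z i)).
  rewrite cj_sum mulr_suml -sumrB; apply: eq_bigr => i _.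
  rewrite mulr_sumr.
  under eq_bigr do rewrite mulrBl.
  rewrite sumrB; congr (_ - _).
    rewrite (bigD1 i) //= eqxx mul1r big1 ?addr0 // => j ji.
    by rewrite eq_sym (negbTE ji) mul0r.
  apply: eq_bigr => j _; rewrite cjM.
  by move: (zcoord z i) (cj (zcoord z j)) (dz i _ z) (cj (dz j _ z)) => *; ring.
rewrite E1 E1 E2 !aut_coord.
move: (autD z) D0 cD0 (autN k z) (autN l z) (b k) (b l) ((k == l)%:R).
move=> x x0 cx0 N N' e e' g; rewrite !cjE.
move: (cj x) cx0 (cj N') (cj e') (cj d) => x' x'0 M f d'; field.
by do ?[apply/andP; split].
Qed.

Lemma LB_aut h z : C2 B h -> B z ->
  LB (h \o aut) z = LB h (aut z) / (autD z * cj (autD z)).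
Proof.
move=> Ch Bz; rewrite /LB.
transitivity (\sum_i \sum_j ((i == j)%:R - zcoord z i * cj (zcoord z j)) *
  (\sum_l \sum_k dz k (dzbar l (creal h)) (aut z) *
    (dz i (fun w => zcoord (aut w) k) z * cj (dz j (fun w => zcoord (aut w) l) z)))).
  apply: eq_bigr => i _; apply: eq_bigr => j _; congr (_ * _).
  exact: (hess_comp oB oB aut_Bn aut_holo i j Ch Bz).
rewrite contract_hess mulr_suml; apply: eq_bigr => k _.
rewrite mulr_suml; apply: eq_bigr => l _.
by rewrite (aut_metric k l Bz) mulrCA mulrA.
Qed.

Lemma C2_aut h : C2 B h -> C2 B (h \o aut).
Proof. exact: (C2_comp oB oB aut_Bn aut_holo). Qed.

Lemma harmonic_aut h : real_invariant_harmonic h -> real_invariant_harmonic (h \o aut).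
Proof.
move=> /harmonicP[Ch H]; apply/harmonicP; split; first exact: C2_aut.
by move=> z Bz; rewrite (LB_aut Ch Bz) H ?mul0r //; exact: aut_Bn.
Qed.

End Automorphism.

(** * Derivative tests at a local maximum *)

Section SecondDerivativeTest.
Context {R : realType} {V : normedModType R}.

Lemma derive_local_max (f : V -> R) z e : (\forall w \near z, derivable f w e) ->
  (\forall w \near z, f w <= f z) -> 'D_e f z = 0.
Proof.
move=> df mf.
have cl : {for (0 : R), continuous (fun t : R => t *: e + z)}.
  by apply: continuousD; [exact: scalel_continuous|exact: cst_continuous].
have near0 (P : V -> Prop) : (\forall w \near z, P w) -> \forall t \near (0 : R), P (t *: e + z).
  by move=> zP; apply: (cl P); rewrite scale0r add0r.
have [r /= r0 H] : exists2 r : R, 0 < r & forall t, `|t| < r ->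
    derivable f (t *: e + z) e /\ f (t *: e + z) <= f z.
  have : \forall t \near (0 : R), derivable f (t *: e + z) e /\ f (t *: e + z) <= f z.
    by apply: filterI; [exact: (near0 _ df)|exact: (near0 _ mf)].
  move=> /nbhs_ballP[r /= r0 H]; exists r => // t tr; apply: H.
  by rewrite -ball_normE /= sub0r normrN.
have inr t : t \in `]-r, r[ -> `|t| < r by rewrite in_itv /= ltr_norml.
have := @derive1_at_max R (fun t => f (t *: e + z)) (- r) r 0.
case=> [||||_ <-].
- by rewrite (le_trans _ (ltW r0)) // oppr_le0 ltW.
- move=> t /inr /H[dt _].
  by case: (is_derive_line dt).
- by rewrite in_itv /= oppr_lt0 r0.
- by move=> t /inr /H[_]; rewrite scale0r add0r.
have d0 : derivable f (0 *: e + z) e by have [] := H 0 _; rewrite ?normr0.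
by have [_ ->] := is_derive_line d0; rewrite scale0r add0r.
Qed.

(** If the second derivative were positive, the first one, zero at [z], would be positive just
    beyond [z], and the mean value theorem would give a value exceeding the maximum. *)
Lemma second_derivative_max (f : V -> R) z e : (\forall w \near z, derivable f w e) ->
  derivable ('D_e f) z e -> (\forall w \near z, f w <= f z) -> 'D_e ('D_e f) z <= 0.
Proof.
move=> df ddf mf; rewrite leNgt; apply/negP => pos.
have f0 := derive_local_max df mf.
have cl : {for (0 : R), continuous (fun t : R => t *: e + z)}.
  by apply: continuousD; [exact: scalel_continuous|exact: cst_continuous].
have near0 (P : V -> Prop) : (\forall w \near z, P w) -> \forall t \near (0 : R), P (t *: e + z).
  by move=> zP; apply: (cl P); rewrite scale0r add0r.
have [r /= r0 H] : exists2 r : R, 0 < r & forall t, `|t| < r ->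
    derivable f (t *: e + z) e /\ f (t *: e + z) <= f z.
  have : \forall t \near (0 : R), derivable f (t *: e + z) e /\ f (t *: e + z) <= f z.
    by apply: filterI; [exact: (near0 _ df)|exact: (near0 _ mf)].
  move=> /nbhs_ballP[r /= r0 H]; exists r => // t tr; apply: H.
  by rewrite -ball_normE /= sub0r normrN.
have [s /= s0 Hs] : exists2 s : R, 0 < s & forall t, 0 < t -> t < s ->
    0 < 'D_e f (t *: e + z).
  have : \forall h \near (0 : R)^', 0 < h^-1 *: (('D_e f \o shift z) (h *: e) - 'D_e f z).
    by have := @cvgr_gt _ _ _ _ _ _ ddf 0 pos; apply.
  rewrite near_withinE => /nbhs_ballP[s /= s0 Hs]; exists s => // t t0 ts.
  have := Hs t; rewrite -ball_normE /= sub0r normrN gtr0_norm // => /(_ ts (lt0r_neq0 t0)).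
  by rewrite f0 subr0 [_ *: _]mulrC pmulr_lgt0 ?invr_gt0 // => ->.
pose t := Num.min r s / 2.
have m0 : 0 < Num.min r s by rewrite lt_min r0.
have t0 : 0 < t by rewrite divr_gt0.
have tm : t < Num.min r s by rewrite ltr_pdivrMr // ltr_pMr // ltr1n.
have [tr ts] : t < r /\ t < s by move: tm; rewrite lt_min => /andP.
have D1 u : u \in `]0, t[ ->
    is_derive u 1 (fun t => f (t *: e + z)) ('D_e f (u *: e + z)).
  rewrite in_itv /= => /andP[u0 ut]; apply: is_derive_line.
  by have [] := H u; rewrite ?gtr0_norm // (lt_trans ut).
have K1 : {within `[0, t], continuous (fun t => f (t *: e + z))}.
  apply: derivable_within_continuous => u; rewrite in_itv /= => /andP[u0 ut].
  have [|du _] := H u; first by rewrite ger0_norm // (le_lt_trans ut).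
  by case: (is_derive_line du).
have [c] := MVT t0 D1 K1.
rewrite in_itv /= => /andP[c0 ct]; rewrite scale0r add0r subr0 => E.
have [|_] := H t; first by rewrite gtr0_norm.
rewrite -subr_le0 E leNgt mulr_gt0 // Hs //; exact: lt_trans ts.
Qed.

End SecondDerivativeTest.

(** * Linear combinations of invariant harmonic functions; the real Hessian *)

Section LinearHarmonic.
Context {R : realType} {n : nat}.
Implicit Types (f g h : Cn R n -> R) (D : set (Cn R n)).

Lemma C2_D D f g : open D -> C2 D f -> C2 D g -> C2 D (fun w => f w + g w).
Proof.
move=> oD [f1 f2] [g1 g2]; split=> [|d]; first exact: (C1_D oD f1 g1).
apply: (eq_on_C1 oD _ (C1_D oD (f2 d) (g2 d))) => w Dw.
by have [_ ->] := is_deriveD (C1_is_derive (edir d) oD f1 Dw) (C1_is_derive (edir d) oD g1 Dw).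
Qed.

Lemma C2_M D f g : open D -> C2 D f -> C2 D g -> C2 D (fun w => f w * g w).
Proof.
move=> oD [f1 f2] [g1 g2]; split=> [|d]; first exact: (C1_M oD f1 g1).
apply: (eq_on_C1 oD _ (C1_D oD (C1_M oD f1 (g2 d)) (C1_M oD g1 (f2 d)))) => w Dw.
by have [_ ->] := is_deriveM (C1_is_derive (edir d) oD f1 Dw) (C1_is_derive (edir d) oD g1 Dw).
Qed.

Lemma C2_Z D (a : R) f : open D -> C2 D f -> C2 D (fun w => a * f w).
Proof. by move=> oD Cf; exact: (C2_M oD (C2_cst a oD) Cf). Qed.

Lemma C2_cdir D d : open D -> C2 D (cdir d : Cn R n -> R).
Proof.
move=> oD; split=> [|d']; first exact: C1_cdir.
apply: (eq_on_C1 oD _ (@C1_cst R n D (cdir d (edir d')))) => w Dw.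
by have [_ ->] := is_derive_cdir w (edir d') d.
Qed.

Lemma hess_D D f g i j z : open D -> D z -> C2 D f -> C2 D g ->
  dz i (dzbar j (creal (fun w => f w + g w))) z =
  dz i (dzbar j (creal f)) z + dz i (dzbar j (creal g)) z.
Proof.
move=> oD Dz Cf Cg.
have E w : D w -> dzbar j (creal f) w + dzbar j (creal g) w =
    dzbar j (creal (fun w => f w + g w)) w.
  move=> Dw; rewrite -(dzbarD oD Dw j (CC1_real Cf.1) (CC1_real Cg.1)).
  by apply: (eq_on_dzbar oD Dw) => u _; rewrite /creal rmorphD.
rewrite -(eq_on_dz oD Dz i E).
by rewrite (dzD oD Dz i (CC1_dzbar_creal j oD Cf) (CC1_dzbar_creal j oD Cg)).
Qed.

Lemma hess_Z D a f i j z : open D -> D z -> C2 D f ->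
  dz i (dzbar j (creal (fun w => a * f w))) z = a%:C * dz i (dzbar j (creal f)) z.
Proof.
move=> oD Dz Cf.
have E w : D w -> a%:C * dzbar j (creal f) w = dzbar j (creal (fun w => a * f w)) w.
  move=> Dw; transitivity (dzbar j (fun w => a%:C * creal f w) w); last first.
    by apply: (eq_on_dzbar oD Dw) => u _; rewrite /creal rmorphM.
  rewrite (dzbarM oD Dw j (@CC1_cst _ _ D a%:C) (CC1_real Cf.1)).
  by rewrite dzbar_cst mulr0 addr0.
rewrite -(eq_on_dz oD Dz i E).
rewrite (dzM oD Dz i (@CC1_cst _ _ D a%:C) (CC1_dzbar_creal j oD Cf)).
by rewrite dz_cst mulr0 addr0.
Qed.

Let B := Bn R n.
Let oB : open B := open_Bn.

Lemma LB_D f g z : B z -> C2 B f -> C2 B g -> LB (fun w => f w + g w) z = LB f z + LB g z.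
Proof.
move=> Bz Cf Cg; rewrite /LB -big_split; apply: eq_bigr => i _; rewrite -big_split.
by apply: eq_bigr => j _; rewrite (hess_D i j oB Bz Cf Cg) mulrDr.
Qed.

Lemma LB_Z a f z : B z -> C2 B f -> LB (fun w => a * f w) z = a%:C * LB f z.
Proof.
move=> Bz Cf; rewrite /LB mulr_sumr; apply: eq_bigr => i _; rewrite mulr_sumr.
by apply: eq_bigr => j _; rewrite (hess_Z a i j oB Bz Cf) mulrCA.
Qed.

Lemma harmonic_D f g : real_invariant_harmonic f -> real_invariant_harmonic g ->
  real_invariant_harmonic (fun w => f w + g w).
Proof.
move=> /harmonicP[Cf Hf] /harmonicP[Cg Hg]; apply/harmonicP; split.
  exact: (C2_D oB Cf Cg).
by move=> z Bz; rewrite (LB_D Bz Cf Cg) (Hf z Bz) (Hg z Bz) addr0.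
Qed.

Lemma harmonic_Z a f : real_invariant_harmonic f ->
  real_invariant_harmonic (fun w => a * f w).
Proof.
move=> /harmonicP[Cf Hf]; apply/harmonicP; split; first exact: (C2_Z a oB Cf).
by move=> z Bz; rewrite (LB_Z a Bz Cf) (Hf z Bz) mulr0.
Qed.

Lemma harmonic0 : real_invariant_harmonic (cst 0 : Cn R n -> R).
Proof.
apply/harmonicP; split; first exact: (C2_cst 0 oB).
move=> z Bz; have C : C2 B (cst 0 : Cn R n -> R) by exact: (C2_cst 0 oB).
have := LB_Z 0 Bz C; rewrite mul0r => <-; congr (LB _ z).
by apply/funext => w; rewrite mul0r.
Qed.

Lemma harmonic_sum (I : Type) (r : seq I) (F : I -> Cn R n -> R) :
  (forall i, real_invariant_harmonic (F i)) ->
  real_invariant_harmonic (fun w => \sum_(i <- r) F i w).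
Proof.
move=> H; elim: r => [|i r IH].
  by under eq_fun do rewrite big_nil; exact: harmonic0.
by under eq_fun do rewrite big_cons; exact: (harmonic_D (H i) IH).
Qed.

Lemma Cderive_dzbar D h j v z : open D -> C2 D h -> D z ->
  Cderive v (dzbar j (creal h)) z =
  Wdzbar ('D_v ('D_(edir (inl j)) h) z)%:C ('D_v ('D_(edir (inr j)) h) z)%:C.
Proof.
move=> oD [_ h2] Dz.
have X := is_cder_real (C1_is_derive v oD (h2 (inl j)) Dz).
have Y := is_cder_real (C1_is_derive v oD (h2 (inr j)) Dz).
have XY := is_cderM (is_cderD X (is_cderZ 'i Y)) (is_cder_cst z v 2^-1).
rewrite -[RHS](is_cder_Cderive (is_cder_eq XY _)).
  apply: (eq_on_Cderive v oD Dz) => w Dw.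
  by rewrite dzbarE !Cderive_creal.
by rewrite mulr0 add0r /Wdzbar mulrC.
Qed.

Lemma Re_Wdz_Wdzbar (x y x' y' : R) :
  complex.Re (Wdz (Wdzbar x%:C y%:C) (Wdzbar x'%:C y'%:C)) = 4^-1 * (x + y').
Proof.
have h2 : (2^-1 : R[i]) = (2^-1 : R)%:C by rewrite fmorphV rmorph_nat.
by rewrite /Wdz /Wdzbar h2 !ReImE /=; field.
Qed.

Lemma Re_hess_diag D h i z : open D -> C2 D h -> D z ->
  complex.Re (dz i (dzbar i (creal h)) z) =
  4^-1 * ('D_(edir (inl i)) ('D_(edir (inl i)) h) z +
          'D_(edir (inr i)) ('D_(edir (inr i)) h) z).
Proof.
move=> oD Ch Dz; rewrite dzE !(Cderive_dzbar _ _ oD Ch Dz).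
exact: Re_Wdz_Wdzbar.
Qed.

End LinearHarmonic.

(** * Unitary maps and translations as automorphisms *)

Section AutomorphismInstances.
Context {R : realType} {n : nat}.
Local Notation C0 := (fun _ => 0 : R[i]).

(** A one-sided inverse of a square matrix is two-sided. *)
Lemma unitary_cols (U : 'I_n -> 'I_n -> R[i]) :
  (forall k l, \sum_i U k i * cj (U l i) = (k == l)%:R) ->
  forall i j, \sum_k cj (U k i) * U k j = (i == j)%:R.
Proof.
move=> H.
pose M : 'M[R[i]]_n := \matrix_(k, i) U k i.
pose N : 'M[R[i]]_n := \matrix_(i, k) cj (U k i).
have MN : M *m N = 1%:M.
  by apply/matrixP => k l; rewrite !mxE -H; apply: eq_bigr => i _; rewrite !mxE.
move: (mulmx1C MN) => /matrixP NM i j; have := NM i j; rewrite !mxE => <-.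
by apply: eq_bigr => k _; rewrite !mxE.
Qed.

Lemma U_n1_unitary (U : 'I_n -> 'I_n -> R[i]) :
  (forall k l, \sum_i U k i * cj (U l i) = (k == l)%:R) -> U_n1 U C0 C0 1.
Proof.
move=> H; split.
- by move=> k l; rewrite H mul0r subr0.
- by move=> k; rewrite mul0r big1 // => i _; rewrite cj0 mulr0.
- by rewrite big1 => [|i _]; rewrite ?mul0r // cj1 mulr1 add0r.
move=> z.
have -> : autD C0 1 z = 1 by rewrite /autD big1 ?add0r // => i _; rewrite mul0r.
rewrite cj1 mulr1 sqnormC; congr (_ - _).
transitivity (\sum_k \sum_i \sum_j (zcoord z i * cj (zcoord z j)) * (cj (U k j) * U k i)).
  apply: eq_bigr => k _; rewrite /autN addr0 cj_sum mulr_suml; apply: eq_bigr => i _.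
  rewrite mulr_sumr; apply: eq_bigr => j _; rewrite cjM.
  by move: (cj (U k j)) (cj (zcoord z j)) (U k i) (zcoord z i) => *; ring.
rewrite exchange_big; apply: eq_bigr => i _; rewrite exchange_big.
under eq_bigr do rewrite -mulr_sumr (unitary_cols H).
rewrite (bigD1 i) //= eqxx mulr1 big1 ?addr0 // => j /negbTE ->.
by rewrite mulr0.
Qed.

Lemma aut_unitary (U : 'I_n -> 'I_n -> R[i]) k z :
  zcoord (aut U C0 C0 1 z) k = \sum_i U k i * zcoord z i.
Proof.
rewrite aut_coord /autN /autD addr0.
by rewrite [X in (X + 1)^-1]big1 ?add0r ?invr1 ?mulr1 // => i _; rewrite mul0r.
Qed.

Section Translation.
Variable a : Cn R n.
Hypothesis Ba : Bn R n a.
Let s : R := Num.sqrt (1 - sqnorm a).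
Let q : R := (s * (1 + s))^-1.

Let s2 : s ^+ 2 = 1 - sqnorm a.
Proof. by rewrite sqr_sqrtr // subr_ge0 ltW //; exact/BnP. Qed.

Let s_gt0 : 0 < s.
Proof. by rewrite sqrtr_gt0 subr_gt0; exact/BnP. Qed.

Let s0 : s != 0. Proof. exact: lt0r_neq0. Qed.
Let s1 : 1 + s != 0. Proof. by rewrite lt0r_neq0 // addr_gt0. Qed.

(** The hermitian boost moving 0 to [a]. The value of [q] makes the block [trA] equal to 1/s on the
    complex line of [a] and to the identity on its orthogonal complement, where s^2 = 1 - |a|^2. *)
Definition trA (k i : 'I_n) : R[i] :=
  (k == i)%:R + q%:C * (zcoord a k * cj (zcoord a i)).
Definition trb (k : 'I_n) : R[i] := (s^-1)%:C * zcoord a k.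
Definition trc (i : 'I_n) : R[i] := (s^-1)%:C * cj (zcoord a i).
Definition trd : R[i] := (s^-1)%:C.

Let na : R[i] := (sqnorm a)%:C.
Let sum_na : \sum_i cj (zcoord a i) * zcoord a i = na.
Proof. by rewrite /na sqnormC; apply: eq_bigr => i _; rewrite mulrC. Qed.

Let rel1 : q%:C * 2 + q%:C ^+ 2 * na = (s^-1)%:C ^+ 2.
Proof.
rewrite /na -[2](rmorph_nat (real_complex R)) -!rmorphXn -!rmorphM -rmorphD.
congr (_%:C); have -> : sqnorm a = 1 - s ^+ 2 by rewrite s2 opprB addrC subrK.
by rewrite /q; field; rewrite s1 s0.
Qed.

Let rel2 : (s^-1)%:C * q%:C * na + (s^-1)%:C = (s^-1)%:C ^+ 2.
Proof.
rewrite /na -!rmorphXn -!rmorphM -rmorphD.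
congr (_%:C); have -> : sqnorm a = 1 - s ^+ 2 by rewrite s2 opprB addrC subrK.
by rewrite /q; field; rewrite s1 s0.
Qed.

Let rel3 : (s^-1)%:C ^+ 2 * na = (s^-1)%:C ^+ 2 - 1.
Proof.
rewrite /na -[X in _ = _ - X](rmorph1 (real_complex R)) -!rmorphXn -!rmorphM -rmorphB.
congr (_%:C); have -> : sqnorm a = 1 - s ^+ 2 by rewrite s2 opprB addrC subrK.
by field.
Qed.

Let sum_delta k (F : 'I_n -> R[i]) : \sum_i (k == i)%:R * F i = F k.
Proof.
rewrite (bigD1 k) //= eqxx mul1r big1 ?addr0 // => i; rewrite eq_sym => /negbTE ->.
by rewrite mul0r.
Qed.

Let N_tr k z : autN trA trb k z = zcoord z k +
  zcoord a k * (q%:C * (\sum_i cj (zcoord a i) * zcoord z i) + (s^-1)%:C).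
Proof.
rewrite /autN /trA; under eq_bigr do rewrite mulrDl.
rewrite big_split /= sum_delta -addrA; congr (_ + _).
rewrite mulrDr !mulr_sumr [X in _ = _ + X]mulrC; congr (_ + _).
apply: eq_bigr => i _.
by move: (zcoord a k) (cj (zcoord a i)) (zcoord z i) => x y u; ring.
Qed.

Let D_tr z : autD trc trd z =
  (s^-1)%:C * ((\sum_i cj (zcoord a i) * zcoord z i) + 1).
Proof.
rewrite /autD /trd mulrDr mulr1; congr (_ + _); rewrite mulr_sumr.
by apply: eq_bigr => i _; rewrite mulrA.
Qed.

Lemma U_n1_translation : U_n1 trA trb trc trd.
Proof.
split.
- move=> k l.
  have -> : \sum_i trA k i * cj (trA l i) = (k == l)%:R +
     (q%:C * 2 + q%:C ^+ 2 * na) * (zcoord a k * cj (zcoord a l)).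
    transitivity (\sum_i ((k == i)%:R * cj (trA l i) +
       (l == i)%:R * (q%:C * (zcoord a k * cj (zcoord a i))) +
        q%:C ^+ 2 * (zcoord a k * cj (zcoord a l)) * (cj (zcoord a i) * zcoord a i))).
      apply: eq_bigr => i _; rewrite /trA !cjE.
      move: (cj (zcoord a i)) (cj (zcoord a l)) (zcoord a i) (zcoord a k) => *; ring.
    rewrite !big_split /= !sum_delta -mulr_sumr sum_na /trA !cjE eq_sym.
    by move: (cj (zcoord a l)) (zcoord a k) => *; ring.
  by rewrite rel1 /trb !cjE; move: (cj (zcoord a l)) => *; ring.
- move=> k; transitivity ((s^-1)%:C * (zcoord a k) + q%:C * (s^-1)%:C * zcoord a k * na).
    transitivity (\sum_i ((k == i)%:R * ((s^-1)%:C * zcoord a i) +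
       q%:C * (s^-1)%:C * zcoord a k * (cj (zcoord a i) * zcoord a i))).
      apply: eq_bigr => i _; rewrite /trA /trc !cjE.
      by move: (cj (zcoord a i)) (zcoord a i) (zcoord a k) => *; ring.
    by rewrite big_split /= sum_delta -mulr_sumr sum_na.
  rewrite /trb /trd cj_real.
  transitivity (zcoord a k * ((s^-1)%:C * q%:C * na + (s^-1)%:C)); first by ring.
  by rewrite rel2; ring.
- have -> : \sum_i trc i * cj (trc i) = (s^-1)%:C ^+ 2 * na.
    rewrite -sum_na mulr_sumr; apply: eq_bigr => i _; rewrite /trc !cjE.
    by move: (cj (zcoord a i)) => *; ring.
  by rewrite rel3 /trd cj_real; ring.
- move=> z; set t := \sum_i cj (zcoord a i) * zcoord z i.
  rewrite D_tr -/t; under eq_bigr do rewrite N_tr -/t.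
  set e := q%:C * t + (s^-1)%:C.
  have ct : cj t = \sum_i zcoord a i * cj (zcoord z i).
    by rewrite cj_sum; apply: eq_bigr => i _; rewrite cjM cjK.
  have -> : \sum_k (zcoord z k + zcoord a k * e) * cj (zcoord z k + zcoord a k * e) =
    (sqnorm z)%:C + e * cj t + cj e * t + e * cj e * na.
    rewrite sqnormC ct -sum_na !mulr_sumr -!big_split /=; apply: eq_bigr => k _.
    rewrite !cjE; move: (cj (zcoord z k)) (cj (zcoord a k)) (cj e) => *; ring.
  rewrite /e !cjE; move: (cj t) => t'.
  have E2 := rel2; have E3 := rel3; have E1 := rel1.
  apply/eqP; rewrite -subr_eq0; apply/eqP.
  transitivity (t * t' * (q%:C * 2 + q%:C ^+ 2 * na - (s^-1)%:C ^+ 2)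
    + (t + t') * ((s^-1)%:C * q%:C * na + (s^-1)%:C - (s^-1)%:C ^+ 2)
    + ((s^-1)%:C ^+ 2 * na - ((s^-1)%:C ^+ 2 - 1))); first by ring.
  by rewrite E1 E2 E3 !subrr !mulr0 !addr0.
Qed.

Definition trans := aut trA trb trc trd.

Let sum0 : \sum_i cj (zcoord a i) * zcoord (0 : Cn R n) i = 0.
Proof.
apply: big1 => i _; rewrite /zcoord /= !mxE.
by rewrite (_ : 0 +i* 0 = 0) ?mulr0.
Qed.

Lemma trans0 : trans 0 = a.
Proof.
apply: zcoord_inj => k; rewrite /trans aut_coord N_tr D_tr sum0 mulr0 !add0r mulr1.
rewrite (_ : zcoord 0 k = 0); last by rewrite /zcoord /= !mxE.
by rewrite add0r mulfK // fmorph_eq0 invr_eq0.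
Qed.

(** The differential at the origin is s on the orthogonal complement of [a] and s - s(1 - s) = s^2
    along [a]. This anisotropy is the reason why the gradient estimate is tight only in the
    direction of the point. *)
Lemma dz_trans0 j k : dz j (fun w => zcoord (trans w) k) 0 =
  s%:C * (k == j)%:R - (s / (1 + s))%:C * (zcoord a k * cj (zcoord a j)).
Proof.
have B0 : Bn R n (0 : Cn R n).
  by apply/BnP; rewrite /sqnorm big1 // => d _; rewrite linear0 expr0n.
rewrite (dz_aut U_n1_translation _ _ B0) N_tr D_tr sum0 mulr0 !add0r mulr1.
rewrite (_ : zcoord 0 k = 0); last by rewrite /zcoord /= !mxE.
have sC : s%:C != 0 by rewrite fmorph_eq0.
have s1C : 1 + s%:C != 0 by rewrite -(rmorph1 (real_complex R)) -rmorphD fmorph_eq0.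
rewrite add0r /trA /trc /q !(rmorphM, fmorphV, rmorphD, rmorph1) /=.
by move: (cj _) (_ %:R) => u v; field; rewrite sC s1C.
Qed.


End Translation.
End AutomorphismInstances.

Section TransInverse.
Context {R : realType} {n : nat}.
Variable a : Cn R n.
Hypothesis Ba : Bn R n a.
Local Notation s := (Num.sqrt (1 - sqnorm a)).

Lemma zcoordN (z : Cn R n) k : zcoord (- z) k = - zcoord z k.
Proof. by apply: complex_ext; rewrite /zcoord /= ?mxE. Qed.

Lemma sqnormN (z : Cn R n) : sqnorm (- z) = sqnorm z.
Proof. by apply: eq_bigr => d _; rewrite linearN sqrrN. Qed.

Lemma BnN : Bn R n (- a).
Proof. by apply/BnP; rewrite sqnormN; exact/BnP. Qed.

Let s2 : s ^+ 2 = 1 - sqnorm a.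
Proof. by rewrite sqr_sqrtr // subr_ge0 ltW //; exact/BnP. Qed.
Let s_gt0 : 0 < s. Proof. by rewrite sqrtr_gt0 subr_gt0; exact/BnP. Qed.
Let s0 : s != 0. Proof. exact: lt0r_neq0. Qed.
Let s1 : 1 + s != 0. Proof. by rewrite lt0r_neq0 // addr_gt0. Qed.

Let sumE : \sum_i cj (zcoord (- a) i) * zcoord a i = - (1 - s ^+ 2)%:C.
Proof.
rewrite s2 opprB addrC subrK sqnormC -sumrN; apply: eq_bigr => i _.
by rewrite zcoordN cjN mulNr mulrC.
Qed.

Lemma trans_inv_autD : autD (trc (- a)) (trd (- a)) a = s%:C.
Proof.
rewrite /autD /trc /trd sqnormN; under eq_bigr do rewrite -mulrA.
rewrite -mulr_sumr sumE -rmorphN -rmorphM -rmorphD; congr (_%:C).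
by field.
Qed.

Lemma trans_inv_autN k : autN (trA (- a)) (trb (- a)) k a = 0.
Proof.
rewrite /autN /trA /trb sqnormN zcoordN.
move: (erefl ((s * (1 + s))^-1)%:C) (erefl (s^-1)%:C).
move: {1 3}((s * (1 + s))^-1)%:C {1 3}(s^-1)%:C => q u qE uE.
under eq_bigr do rewrite mulrDl.
rewrite big_split /= (bigD1 k) //= eqxx mul1r big1 ?addr0; last first.
  by move=> i; rewrite eq_sym => /negbTE ->; rewrite mul0r.
transitivity (zcoord a k * (1 - q * (\sum_i cj (zcoord (- a) i) * zcoord a i) - u)).
  rewrite (_ : \sum_i _ = - (zcoord a k * (q *
    (\sum_i cj (zcoord (- a) i) * zcoord a i)))); last first.
    rewrite !mulr_sumr -sumrN; apply: eq_bigr => i _; rewrite zcoordN.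
    by move: (cj (zcoord (- a) i)) (zcoord a i) => *; ring.
  by move: (\sum_i _) => *; ring.
rewrite qE uE sumE mulrN opprK -(rmorph1 (real_complex R)) -rmorphM -rmorphD -rmorphB.
rewrite (_ : 1 + _ - _ = 0) ?mulr0 //.
by field; rewrite s1 s0.
Qed.

Lemma trans_inv : trans (- a) a = 0.
Proof.
apply: zcoord_inj => k; rewrite /trans aut_coord trans_inv_autN mul0r.
by rewrite /zcoord /= !mxE.
Qed.

(** The map of [- a] sends [a] back to 0; its differential there is 1/s across [a] and 1/s^2 along
    [a], the inverse of the one in [dz_trans0]. *)
Lemma dz_trans_inv j k : dz j (fun w => zcoord (trans (- a) w) k) a =
  ((k == j)%:R + ((s * (1 + s))^-1)%:C * (zcoord a k * cj (zcoord a j))) / s%:C.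
Proof.
rewrite (dz_aut (U_n1_translation BnN) _ _ Ba) trans_inv_autN mul0r subr0.
rewrite trans_inv_autD /trA sqnormN !zcoordN cjN mulrNN.
have sC : s%:C != 0 by rewrite fmorph_eq0.
by move: (s%:C) sC ((k == j)%:R + _) => t t0 X; field.
Qed.

End TransInverse.

(** * Invariance under complex conjugation *)

Section ConjugationMap.
Context {R : realType} {n : nat}.
Let B := Bn R n.
Let oB : open B := open_Bn.

(** An antiholomorphic isometry, not covered by [U_n1]. It is the building block of the reflection
    in the hyperplane Re z_1 = 0. *)
Definition conjmap (z : Cn R n) : Cn R n := ofC (fun k => cj (zcoord z k)).

Lemma conjmap_coord z k : zcoord (conjmap z) k = cj (zcoord z k).
Proof. exact: zcoord_ofC. Qed.

Lemma conjmap_Bn z : B z -> B (conjmap z).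
Proof.
move=> /BnP z1; apply/BnP; rewrite sqnorm_nrm2.
by under eq_bigr do rewrite conjmap_coord nrm2J; rewrite -sqnorm_nrm2.
Qed.

Let Ck k : CC1 B (fun z => zcoord (conjmap z) k).
Proof.
by apply: (eq_on_CC1 oB _ (CC1_J oB (CC1_coord k oB))) => w _; rewrite conjmap_coord.
Qed.

Let dzk i k z : B z -> dz i (fun z => zcoord (conjmap z) k) z = 0.
Proof.
move=> Bz; transitivity (dz i (fun z => cj (zcoord z k)) z).
  by apply: (eq_on_dz oB Bz) => w _; rewrite conjmap_coord.
by rewrite (dzJ oB Bz i (CC1_coord k oB)) dzbar_coord cj0.
Qed.

Let dzbark i k z : B z -> dzbar i (fun z => zcoord (conjmap z) k) z = (i == k)%:R.
Proof.
move=> Bz; transitivity (dzbar i (fun z => cj (zcoord z k)) z).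
  by apply: (eq_on_dzbar oB Bz) => w _; rewrite conjmap_coord.
by rewrite (dzbarJ oB Bz i (CC1_coord k oB)) dz_coord cj_nat.
Qed.

Lemma dz_creal (h : Cn R n -> R) i z : B z -> C2 B h ->
  dz i (creal h) z = cj (dzbar i (creal h) z).
Proof.
move=> Bz Ch; rewrite -(dzJ oB Bz i (CC1_real Ch.1)).
by apply: (eq_on_dz oB Bz) => w _; rewrite /creal cj_real.
Qed.

Lemma hess_conjmap h i j z : C2 B h -> B z ->
  dz i (dzbar j (creal (h \o conjmap))) z =
  cj (dz i (dzbar j (creal h)) (conjmap z)).
Proof.
move=> Ch Bz; have Cr : CC1 B (creal h) := CC1_real Ch.1.
have Cb := CC1_dzbar_creal j oB Ch.
have Cd : CC1 B (dz j (creal h)).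
  by apply: (eq_on_CC1 oB _ (CC1_J oB Cb)) => w Bw; rewrite (dz_creal j Bw Ch).
transitivity (dz i (fun w => dz j (creal h) (conjmap w)) z).
  apply: (eq_on_dz oB Bz) => w Bw.
  rewrite (dzbar_comp oB oB conjmap_Bn Ck j Cr Bw) (bigD1 j) //= big1 ?addr0.
    by rewrite (dzbark j j Bw) (dzk j j Bw) eqxx mulr1 cj0 mulr0 addr0.
  move=> k kj; rewrite (dzbark j k Bw) (dzk j k Bw) eq_sym (negbTE kj).
  by rewrite cj0 !mulr0 addr0.
rewrite (dz_comp oB oB conjmap_Bn Ck i Cd Bz) (bigD1 i) //= big1 ?addr0; last first.
  move=> k ki; rewrite (dzbark i k Bz) (dzk i k Bz) eq_sym (negbTE ki).
  by rewrite cj0 !mulr0 addr0.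
rewrite (dzbark i i Bz) (dzk i i Bz) eqxx cj1 mulr1 mulr0 add0r.
have Bc := conjmap_Bn Bz.
rewrite -(dzbarJ oB Bc i Cb).
by apply: (eq_on_dzbar oB Bc) => w Bw; rewrite (dz_creal j Bw Ch).
Qed.

Lemma LB_conjmap h z : C2 B h -> B z -> LB (h \o conjmap) z = cj (LB h (conjmap z)).
Proof.
move=> Ch Bz; rewrite /LB cj_sum; apply: eq_bigr => i _; rewrite cj_sum.
apply: eq_bigr => j _; rewrite (hess_conjmap i j Ch Bz) [RHS]cjM; congr (_ * _).
by rewrite !conjmap_coord cjB cj_nat cjM !cjK.
Qed.

Lemma harmonic_conjmap h : real_invariant_harmonic h ->
  real_invariant_harmonic (h \o conjmap).
Proof.
move=> /harmonicP[Ch H]; apply/harmonicP; split; last first.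
  move=> z Bz; rewrite (LB_conjmap Ch Bz) H ?cj0 //; exact: conjmap_Bn.
apply: (C2_comp_gen oB oB conjmap_Bn _ Ch) => -[k|k].
  suff -> : (fun w => cdir (inl k) (conjmap w)) = cdir (inl k) by exact: C2_cdir.
  by apply/funext => w; rewrite /= mxE.
suff -> : (fun w => cdir (inr k) (conjmap w)) = (fun w => -1 * cdir (inr k) w).
  exact: (C2_Z (-1) oB (C2_cdir (inr k) oB)).
by apply/funext => w; rewrite /= mxE mulN1r.
Qed.

End ConjugationMap.

(** * Maximum principle *)

Section MaximumPrinciple.
Context {R : realType} {n : nat}.
Let B := Bn R n.
Let oB : open B := open_Bn.

Lemma C2_sqnorm : C2 B (sqnorm : Cn R n -> R).
Proof.
rewrite /sqnorm; elim: (index_enum _) => [|d r IH].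
  by under eq_fun do rewrite big_nil; exact: (C2_cst 0 oB).
under eq_fun do rewrite big_cons expr2.
exact: (C2_D oB (C2_M oB (C2_cdir d oB) (C2_cdir d oB)) IH).
Qed.

Lemma dzbar_sqnorm j w : B w -> dzbar j (creal sqnorm) w = zcoord w j.
Proof.
move=> Bw; have C k := CC1_coord k oB.
transitivity (dzbar j (fun w => \sum_k zcoord w k * cj (zcoord w k)) w).
  by apply: (eq_on_dzbar oB Bw) => u _; exact: sqnormC.
rewrite (dzbar_sum oB Bw j _ _ (fun k => CC1_M oB (C k) (CC1_J oB (C k)))).
rewrite (bigD1 j) //= big1 ?addr0.
  rewrite (dzbarM oB Bw j (C j) (CC1_J oB (C j))) (dzbarJ oB Bw j (C j)).
  by rewrite dz_coord dzbar_coord eqxx cj1 mulr1 mulr0 addr0.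
move=> k kj; rewrite (dzbarM oB Bw j (C k) (CC1_J oB (C k))) (dzbarJ oB Bw j (C k)).
by rewrite dz_coord dzbar_coord eq_sym (negbTE kj) cj0 !mulr0 addr0.
Qed.

Lemma LB_sqnorm z : B z -> LB sqnorm z = (n%:R - sqnorm z)%:C.
Proof.
move=> Bz.
have -> : (n%:R - sqnorm z)%:C = n%:R - \sum_j zcoord z j * cj (zcoord z j).
  by rewrite -sqnormC rmorphB rmorph_nat.
rewrite /LB.
transitivity (\sum_(i < n) (1 - zcoord z i * cj (zcoord z i))).
  apply: eq_bigr => i _.
  have E j : dz i (dzbar j (creal sqnorm)) z = (i == j)%:R.
    by rewrite -(dz_coord z); apply: (eq_on_dz oB Bz) => w Bw; rewrite dzbar_sqnorm.
  rewrite (bigD1 i) //= big1 ?addr0; last first.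
    by move=> j; rewrite E eq_sym => /negbTE ->; rewrite mulr0.
  by rewrite E eqxx mulr1.
by rewrite sumrB sumr_const card_ord.
Qed.

(** An automorphism moves the maximum to the origin and changes the operator only by a positive
    factor. At the origin the tensor is the identity, so the operator is a quarter of the Euclidean
    Laplacian, a sum of second derivatives each nonpositive at a maximum. *)
Lemma LB_max h z0 : C2 B h -> B z0 -> (\forall w \near z0, h w <= h z0) ->
  complex.Re (LB h z0) <= 0.
Proof.
move=> Ch Bz hmax; pose g := h \o trans z0.
have B0 : B (0 : Cn R n).
  by apply/BnP; rewrite /sqnorm big1 // => d _; rewrite linear0 expr0n.
have HU := U_n1_translation Bz.
have Cg : C2 B g by exact: (C2_aut HU Ch).
have E : LB g 0 = LB h z0 / (nrm2 (autD (trc z0) (trd z0) 0))%:C.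
  by rewrite /g /trans (LB_aut HU Ch B0) nrm2C -/(trans z0) trans0.
have D0 : 0 < nrm2 (autD (trc z0) (trd z0) 0) by rewrite nrm2_gt0 (autD_neq0 HU).
have -> : LB h z0 = LB g 0 * (nrm2 (autD (trc z0) (trd z0) 0))%:C.
  by rewrite E divfK // fmorph_eq0 lt0r_neq0.
rewrite ReM /= mulr0 subr0 pmulr_lle0 //.
have gmax : \forall w \near (0 : Cn R n), g w <= g 0.
  have ct : {for (0 : Cn R n), continuous (trans z0)}.
    apply/differentiable_continuous; apply: (C1_map_differentiable oB _ B0).
    by apply: (C1_map_cdir oB) => k; have [] := aut_holo HU k.
  move: ct; rewrite /g /= /prop_for /continuous_at (trans0 Bz) => ct.
  exact: (ct _ hmax).
rewrite /LB (big_morph _ (@ReD R) (erefl (complex.Re 0))) /=.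
apply: sumr_le0 => i _.
rewrite (bigD1 i) //= big1 ?addr0; last first.
  move=> j; rewrite eq_sym => /negbTE ->.
  rewrite (_ : zcoord 0 i = 0); last by rewrite /zcoord /= !mxE.
  by rewrite mul0r subr0 mul0r.
rewrite (_ : zcoord 0 i = 0); last by rewrite /zcoord /= !mxE.
rewrite eqxx mul0r subr0 mul1r (Re_hess_diag i oB Cg B0).
apply: mulr_ge0_le0; first by rewrite invr_ge0.
have H d : 'D_(edir d) ('D_(edir d) g) 0 <= 0.
  apply: (@second_derivative_max _ _ g 0 (edir d) _ _ gmax).
    by apply: (open_near oB B0) => w Bw; exact: (C1_derivable oB Cg.1 Bw).
  exact: (C1_derivable oB (Cg.2 d) B0).
by rewrite -[leRHS]addr0; apply: lerD.
Qed.

(** Adding e |z|^2 makes the function strictly subharmonic, since the operator maps |z|^2 to n -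
    |z|^2, which is positive for n >= 1. The maximum over [K] of the perturbed function is then not
    in the open set [U], so it is controlled by [c]; finally e tends to 0. The set [K] minus [U]
    plays the part of the boundary. *)
Lemma maximum_principle (n0 : (0 < n)%N) (K U : set (Cn R n)) G (c : R) :
  compact K -> K `<=` B -> open U -> U `<=` K -> C2 B G ->
  (forall z, U z -> 0 <= complex.Re (LB G z)) ->
  (forall z, K z -> ~ U z -> G z <= c) -> forall z, K z -> G z <= c.
Proof.
move=> cK KB oU UK CG HG bG z Kz.
apply/ler_addgt0Pr => e e0.
pose F w := G w + e * sqnorm w.
have CF : C2 B F by exact: (C2_D oB CG (C2_Z e oB C2_sqnorm)).
have cF : {within K, continuous F}.
  apply: continuous_in_subspaceT => w; rewrite inE => Kw.
  exact: (C1_continuous oB CF.1 (KB _ Kw)).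
have [z0 /[!inE] Kz0 zmax] := compact_EVT_max (ex_intro _ z Kz) cK cF.
have mF w : K w -> F w <= F z0 by move=> Kw; apply: zmax; rewrite inE.
have Bz0 := KB _ Kz0.
have [Uz0|Uz0] := pselect (U z0).
  have : complex.Re (LB F z0) <= 0.
    by apply: (LB_max CF Bz0); apply: (open_near oU Uz0) => w /UK; exact: mF.
  rewrite (LB_D Bz0 CG (C2_Z e oB C2_sqnorm)) (LB_Z e Bz0 C2_sqnorm) LB_sqnorm //.
  rewrite ReD -rmorphM /= => H; have := HG _ Uz0.
  have p : 0 < e * (n%:R - sqnorm z0).
    rewrite mulr_gt0 // subr_gt0; apply: (@lt_le_trans _ _ 1); first exact/BnP.
    by rewrite ler1n.
  by move=> H2; exfalso; lra.
have := mF z Kz; rewrite /F; have := bG _ Kz0 Uz0; have /BnP s1 := Bz0.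
have s0 := sqnorm_ge0 z => b1 b2.
have : e * sqnorm z0 <= e * 1 by rewrite ler_pM2l // ltW.
have : 0 <= e * sqnorm z by rewrite mulr_ge0 // ltW.
by rewrite mulr1; lra.
Qed.

Lemma compact_closed_sub (K : set (Cn R n)) : closed K -> K `<=` B -> compact K.
Proof.
move=> clK KB.
pose I : set R := `[-1, 1]%classic.
pose Q : set 'rV[R]_n := [set v | forall i, I (v ord0 i)].
have cQ : compact Q := @rV_compact R n (fun=> I) (fun i => @segment_compact R (-1) 1).
apply: (subclosed_compact clK (compact_setX cQ cQ)) => z /KB /BnP z1.
have H d : cdir d z \in `[-1, 1].
  rewrite in_itv /= -ler_norml -(@ler_pXn2r _ 2) ?nnegrE // expr1n real_normK ?num_real //.
  apply: le_trans (ltW z1); rewrite /sqnorm (bigD1 d) //= lerDl.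
  by apply: sumr_ge0 => i _; exact: sqr_ge0.
by split=> i; [exact: (H (inl i))|exact: (H (inr i))].
Qed.

End MaximumPrinciple.

(** * Integrals over the unit interval *)

Section UnitIntervalIntegral.
Context {R : realType}.
Implicit Types (f g F : R -> R).

Definition Int01 f : R := \int[@lebesgue_measure R]_(x in `[0%R, 1%R]) f x.
Definition cont01 f : Prop := {within `[0%R, 1%R], continuous f}.

Lemma derivable_cont01 f : (forall x : R, 0 <= x <= 1 -> derivable f x 1) -> cont01 f.
Proof.
by move=> df; apply: derivable_within_continuous => x; rewrite in_itv /=; exact: df.
Qed.

Lemma cont01_integrable f : cont01 f ->
  (@lebesgue_measure R).-integrable `[0%R, 1%R] (EFin \o f).
Proof. by move=> cf; apply: continuous_compact_integrable => //; exact: segment_compact. Qed.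

Lemma Int01_eq f g : (forall x : R, 0 <= x <= 1 -> f x = g x) -> Int01 f = Int01 g.
Proof.
by move=> fg; apply: eq_Rintegral => x; rewrite inE /= in_itv /=; exact: fg.
Qed.

Lemma Int01D f g : cont01 f -> cont01 g -> Int01 (fun x => f x + g x) = Int01 f + Int01 g.
Proof. by move=> cf cg; apply: RintegralD => //; exact: cont01_integrable. Qed.

Lemma Int01Z a f : cont01 f -> Int01 (fun x => a * f x) = a * Int01 f.
Proof. by move=> cf; apply: RintegralZl => //; exact: cont01_integrable. Qed.

Lemma Int01_cst a : Int01 (fun=> a) = a.
Proof.
rewrite /Int01 Rintegral_cst //= lebesgue_measure_itv /= lte_fin ltr01 oppr0.
by rewrite adde0 /= mulr1.
Qed.

Lemma Int01_ge0 f : (forall x : R, 0 <= x <= 1 -> 0 <= f x) -> 0 <= Int01 f.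
Proof. by move=> f0; apply: Rintegral_ge0 => x; rewrite /= in_itv /=; exact: f0. Qed.

Lemma Int01_le f g : cont01 f -> cont01 g -> (forall x : R, 0 <= x <= 1 -> f x <= g x) ->
  Int01 f <= Int01 g.
Proof.
move=> cf cg fg; apply: le_Rintegral => [//||| x].
- exact: cont01_integrable cf.
- exact: cont01_integrable cg.
- by rewrite /= in_itv /=; exact: fg.
Qed.

Lemma Int01_norm_le f c : cont01 f -> (forall x : R, 0 <= x <= 1 -> `|f x| <= c) ->
  `|Int01 f| <= c.
Proof.
move=> cf fc.
have cc (k : R) : cont01 (fun=> k) by apply: derivable_cont01 => x _.
rewrite ler_norml -[X in - X <= _](Int01_cst c) -[X in _ && (_ <= X)](Int01_cst c).
rewrite -mulN1r -Int01Z //; apply/andP; split; apply: Int01_le => // x x01.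
  by rewrite mulN1r; have := fc x x01; rewrite ler_norml => /andP[].
by have := fc x x01; rewrite ler_norml => /andP[].
Qed.

Lemma Int01_FTC f F : (forall x : R, 0 <= x <= 1 -> is_derive x 1 F (f x)) -> cont01 f ->
  Int01 f = F 1 - F 0.
Proof.
move=> dF cf.
have cF x : 0 <= x <= 1 -> {for x, continuous F}.
  move=> x01; apply: differentiable_continuous; apply/derivable1_diffP.
  by have [] := dF x x01.
have cF' : derivable_oo_LRcontinuous F 0 1.
  split.
  - by move=> x; rewrite in_itv /= => /andP[x0 x1]; have [] := dF x _; rewrite ?ltW.
  - by apply: cvg_at_right_filter; apply: cF; rewrite lexx ler01.
  - by apply: cvg_at_left_filter; apply: cF; rewrite lexx ler01.
have dF' : {in `]0, 1[, F^`()%classic =1 f}.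
  move=> x; rewrite in_itv /= => /andP[x0 x1]; rewrite derive1E.
  have x01 : 0 <= x <= 1 by rewrite !ltW.
  by have [_ ->] := dF x x01.
by rewrite /Int01 /Rintegral (@continuous_FTC2 R f F 0 1 ltr01 cf cF' dF').
Qed.

Lemma Int01_derive (f df : R -> R -> R) (u v a c : R) : u < a < v ->
  (forall t x : R, u < t < v -> 0 <= x <= 1 -> is_derive t 1 (f ^~ x) (df t x)) ->
  (forall t, u < t < v -> cont01 (f t)) ->
  (forall t x : R, u < t < v -> 0 <= x <= 1 -> `|df t x| <= c) ->
  is_derive a 1 (fun t => Int01 (f t)) (Int01 (df a)).
Proof.
move=> auv hd hc hb.
have Ia : `]u, v[%classic a by rewrite /= in_itv.
have c0 : 0 <= c by apply: le_trans (hb a 0 auv _); rewrite ?lexx ?ler01.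
have h1 x : `]u, v[%classic x ->
    (@lebesgue_measure R).-integrable `[0, 1]%classic (EFin \o f x).
  by rewrite /= in_itv /= => xuv; apply: cont01_integrable; exact: hc.
have h2 x y : `]u, v[%classic x -> `[0, 1]%classic y -> derivable (f^~ y) x 1.
  by rewrite /= !in_itv /= => xuv y01; have [] := hd x y xuv y01.
have h3 : (@lebesgue_measure R).-integrable `[0, 1]%classic (EFin \o (fun=> c)).
  by apply: cont01_integrable; apply: derivable_cont01 => x _.
have h4 x y : `]u, v[%classic x -> `[0, 1]%classic y -> `|partial1of2 f x y| <= c.
  rewrite /= !in_itv /= => xuv y01; rewrite partial1of2E.
  by have [_ ->] := hd x y xuv y01; exact: hb.
have m01 : measurable (`[0, 1]%classic : set (measurableTypeR R)) by [].
split.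
  exact: (derivable_under_integral m01 Ia h1 h2 (fun=> c0) h3 h4).
rewrite -derive1E (differentiation_under_integral m01 Ia h1 h2 (fun=> c0) h3 h4).
apply: eq_Rintegral => x; rewrite inE /= in_itv /= => x01.
by rewrite partial1of2E; have [_ ->] := hd a x auv x01.
Qed.

End UnitIntervalIntegral.

(** * Moduli of complex numbers and derivatives of inverse powers *)

Section ComplexHelpers.
Context {R : realType}.
Implicit Types (a b : R[i]).

Definition nrm a : R := Num.sqrt (nrm2 a).

Lemma ReZ (x : R) a : complex.Re (x%:C * a) = x * complex.Re a.
Proof. by rewrite ReM /= mul0r subr0. Qed.

Lemma nrm_ge0 a : 0 <= nrm a. Proof. exact: sqrtr_ge0. Qed.
Lemma nrmM a b : nrm (a * b) = nrm a * nrm b.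
Proof. by rewrite /nrm nrm2M sqrtrM // nrm2_ge0. Qed.
Lemma nrm1 : nrm (1 : R[i]) = 1.
Proof. by rewrite /nrm /nrm2 /= expr0n expr1n addr0 sqrtr1. Qed.
Lemma nrmX a k : nrm (a ^+ k) = nrm a ^+ k.
Proof. by elim: k => [|k IH]; rewrite ?expr0 ?nrm1 // !exprS nrmM IH. Qed.
Lemma Re_le_nrm a : `|complex.Re a| <= nrm a.
Proof.
rewrite -(@ler_pXn2r _ 2) ?nnegrE ?nrm_ge0 // real_normK ?num_real //.
by rewrite sqr_sqrtr ?nrm2_ge0 // /nrm2 lerDl sqr_ge0.
Qed.
Lemma nrmV a : nrm a^-1 = (nrm a)^-1.
Proof. by rewrite /nrm nrm2V sqrtrV // nrm2_ge0. Qed.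

Lemma is_cder_invX {V : normedModType R} (z v : V) (f : V -> R[i]) df m :
  f z != 0 -> is_cder z v f df ->
  is_cder z v (fun w => (f w)^-1 ^+ m) (- (m%:R * (f z)^-1 ^+ m.+1 * df)).
Proof.
move=> f0 hf; apply: (is_cder_eq (is_cderX m (is_cderV f0 hf))).
case: m => [|m]; first by rewrite !mul0r oppr0.
rewrite succnK -exprVn !exprS expr0 mulr1.
by move: (_%:R) ((f z)^-1) => k A; ring.
Qed.

Lemma is_derive_Re {V : normedModType R} (z v : V) (f : V -> R[i]) df :
  is_cder z v f df -> is_derive z v (fun w => complex.Re (f w)) (complex.Re df).
Proof. by case. Qed.

Lemma is_derive_scal {V : normedModType R} (z v : V) (f : V -> R) (a c : R) :
  is_derive z v f a -> is_derive z v (fun w => c * f w) (c * a).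
Proof.
move=> H; apply: (is_derive_eq (is_deriveM (is_derive_cst c z v) H)).
by rewrite /GRing.scale /=; ring.
Qed.

Lemma is_derive_affine (a b t : R) : is_derive t (1 : R) (fun t : R => a + b * t) b.
Proof.
have H1 : is_derive t (1 : R) (cst a : R -> R) 0 := is_derive_cst a t 1.
have H2 : is_derive t (1 : R) (cst b : R -> R) 0 := is_derive_cst b t 1.
have H3 : is_derive t (1 : R) (id : R -> R) 1 := is_derive_id t 1.
apply: (is_derive_eq (is_deriveD H1 (is_deriveM H2 H3))).
by rewrite /GRing.scale /=; ring.
Qed.

Lemma is_derive_quadratic (a b t : R) :
  is_derive t (1 : R) (fun t : R => a + t ^+ 2 * b) (2 * t * b).
Proof.
have H1 : is_derive t (1 : R) (cst a : R -> R) 0 := is_derive_cst a t 1.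
have H2 : is_derive t (1 : R) (cst b : R -> R) 0 := is_derive_cst b t 1.
have H3 : is_derive t (1 : R) (id : R -> R) 1 := is_derive_id t 1.
under eq_fun do rewrite expr2.
apply: (is_derive_eq (is_deriveD H1 (is_deriveM (is_deriveM H3 H3) H2))).
by rewrite /GRing.scale /=; ring.
Qed.

End ComplexHelpers.

(** * A family of parametric integrals closed under differentiation *)

Section ParametricFamily.
Context {R : realType}.
Variable N : nat.
Local Notation Half := (2^-1 : R).

(** The denominator 1 + x^2 (p - 1) - i x T of the extremal integral. On the ball p >= 1; working
    with p > 1/2 gives an open parameter domain on which Re Y >= 1/2, hence uniform bounds for its
    inverse [Ac]. *)
Definition Yc (T p x : R) : R[i] := (1 + x ^+ 2 * (p - 1)) +i* (- (x * T)).
Definition Ac T p x : R[i] := (Yc T p x)^-1.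

Lemma ReY_ge (T p x : R) : Half < p -> 0 <= x <= 1 -> Half <= complex.Re (Yc T p x).
Proof.
move=> hp /andP[x0 x1] /=.
have x2 : 0 <= x ^+ 2 <= 1 by rewrite exprn_ge0 //= exprn_ile1.
have [p1|p1] := leP 1 p.
  have : 0 <= x ^+ 2 * (p - 1) by rewrite mulr_ge0 ?subr_ge0 //; case/andP: x2.
  by move=> ?; lra.
have : x ^+ 2 * (1 - p) <= 1 * (1 - p).
  by apply: ler_wpM2r; [lra|case/andP: x2].
by move=> ?; lra.
Qed.

Lemma Y_neq0 (T p x : R) : Half < p -> 0 <= x <= 1 -> Yc T p x != 0.
Proof.
move=> hp hx; apply: contraTneq (ReY_ge T hp hx) => ->.
by rewrite -ltNge /= invr_gt0.
Qed.

Lemma nrm_A (T p x : R) : Half < p -> 0 <= x <= 1 -> nrm (Ac T p x) <= 2.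
Proof.
move=> hp hx; rewrite /Ac nrmV -[leRHS]invrK lef_pV2 ?posrE //.
- apply: le_trans (Re_le_nrm _); apply: le_trans (ler_norm _); exact: ReY_ge.
- by rewrite sqrtr_gt0 nrm2_gt0 Y_neq0.
Qed.

Lemma cder_Y_T (T p x : R) : is_cder T 1 (fun T : R => Yc T p x) (- ('i * x%:C)).
Proof.
split=> /=.
  by apply: (is_derive_eq (is_derive_cst (1 + x ^+ 2 * (p - 1)) T (1 : R))); ring.
rewrite (_ : (fun _ => _) = (fun T : R => 0 + (- x) * T)); last first.
  by apply/funext => u; ring.
by apply: (is_derive_eq (is_derive_affine _ _ _)); ring.
Qed.

Lemma cder_Y_p (T p x : R) : is_cder p 1 (fun p : R => Yc T p x) (x ^+ 2)%:C.
Proof.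
split=> /=; last exact: is_derive_cst.
rewrite (_ : (fun _ => _) = (fun p : R => (1 - x ^+ 2) + x ^+ 2 * p)); last first.
  by apply/funext => u; ring.
exact: is_derive_affine.
Qed.

Lemma cder_Y_x (T p x : R) :
  is_cder x 1 (fun x : R => Yc T p x) ((2 * x * (p - 1))%:C - 'i * T%:C).
Proof.
split=> /=.
  by apply: (is_derive_eq (is_derive_quadratic _ _ _)); ring.
rewrite (_ : (fun _ => _) = (fun x : R => 0 + (- T) * x)); last first.
  by apply/funext => u; ring.
by apply: (is_derive_eq (is_derive_affine _ _ _)); ring.
Qed.

Definition wt k (x : R) : R := x ^+ k * (1 - x ^+ 2) ^+ N.

Lemma wt_le1 k (x : R) : 0 <= x <= 1 -> `|wt k x| <= 1.
Proof.
move=> /andP[x0 x1]; rewrite /wt.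
have h : 0 <= 1 - x ^+ 2 <= 1.
  by rewrite subr_ge0 exprn_ile1 //= gerBl exprn_ge0.
case/andP: h => h0 h1.
rewrite ger0_norm; last by rewrite mulr_ge0 // exprn_ge0.
by rewrite mulr_ile1 ?exprn_ge0 ?exprn_ile1.
Qed.

Lemma derivable_wt k (x : R) : derivable (wt k) x 1.
Proof.
have dX m (f : R -> R) : derivable f x 1 -> derivable (fun x => f x ^+ m) x 1.
  move=> df; elim: m => [|m IH]; first by under eq_fun do rewrite expr0; exact: derivable_cst.
  by under eq_fun do rewrite exprS; exact: derivableM df IH.
apply: derivableM; first by apply: (dX k id); exact: derivable_id.
apply: (dX N (fun x => 1 - x ^+ 2)).
apply: derivableB; first exact: derivable_cst.
by apply: (dX 2 id); exact: derivable_id.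
Qed.

(** The family reproduces itself: a T-derivative raises the power of x and of [Ac] by one, a
    p-derivative raises that of x by two and that of [Ac] by one, and only the constant [c] changes.
    All derivatives of the extremal profile are members of it. *)
Definition Pint (c : R[i]) k m T p (x : R) : R := wt k x * complex.Re (c * Ac T p x ^+ m).
Definition Pfam c k m T p : R := Int01 (Pint c k m T p).

Lemma Pint_cont c k m (T p : R) : Half < p -> cont01 (Pint c k m T p).
Proof.
move=> hp; apply: derivable_cont01 => x x01; apply: derivableM; first exact: derivable_wt.
have H := is_cderZ c (is_cder_invX m (Y_neq0 T hp x01) (cder_Y_x T p x)).
by have [] := is_derive_Re H.
Qed.

Lemma Pint_le c k m (T p x : R) : Half < p -> 0 <= x <= 1 ->
  `|Pint c k m T p x| <= nrm c * 2 ^+ m.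
Proof.
move=> hp x01; rewrite /Pint normrM -[leRHS]mul1r ler_pM //; first exact: wt_le1.
apply: le_trans (Re_le_nrm _) _; rewrite nrmM nrmX ler_wpM2l ?nrm_ge0 //.
by apply: lerXn2r; rewrite ?nnegrE ?nrm_ge0 // nrm_A.
Qed.

Lemma Pfam_le c k m (T p : R) : Half < p -> `|Pfam c k m T p| <= nrm c * 2 ^+ m.
Proof.
by move=> hp; apply: Int01_norm_le => [|x x01]; [exact: Pint_cont|exact: Pint_le].
Qed.

Lemma Pint_derive_T c k m (T p x : R) : Half < p -> 0 <= x <= 1 ->
  is_derive T 1 (fun T : R => Pint c k m T p x) (Pint (c * (m%:R * 'i)) k.+1 m.+1 T p x).
Proof.
move=> hp x01.
have H := is_derive_Re (is_cderZ c (@is_cder_invX _ _ T 1 (fun T => Yc T p x) _ m (Y_neq0 T hp x01) (cder_Y_T T p x))).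
apply: (is_derive_eq (is_deriveM (is_derive_cst (wt k x) T 1) H)).
rewrite /Pint /GRing.scale /= mulr0 addr0 /wt -/(Ac T p x).
rewrite (_ : c * _ = x%:C * (c * (m%:R * 'i) * Ac T p x ^+ m.+1)); last by ring.
rewrite ReZ [x ^+ k.+1]exprS.
by move: (complex.Re (c * _ * _)) => *; ring.
Qed.

Lemma Pint_derive_p c k m (T p x : R) : Half < p -> 0 <= x <= 1 ->
  is_derive p 1 (fun p : R => Pint c k m T p x) (Pint (c * - m%:R) k.+2 m.+1 T p x).
Proof.
move=> hp x01.
have H := is_derive_Re (is_cderZ c (@is_cder_invX _ _ p 1 (fun p => Yc T p x) _ m (Y_neq0 T hp x01) (cder_Y_p T p x))).
apply: (is_derive_eq (is_deriveM (is_derive_cst (wt k x) p 1) H)).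
rewrite /Pint /GRing.scale /= mulr0 addr0 /wt -/(Ac T p x).
rewrite (_ : c * _ = (x ^+ 2)%:C * (c * - m%:R * Ac T p x ^+ m.+1)); last by ring.
rewrite ReZ -[k.+2]addn2 exprD.
by move: (complex.Re (c * _ * _)) => *; ring.
Qed.

Lemma Pfam_derive_T c k m (T p : R) : Half < p ->
  is_derive T 1 (fun T : R => Pfam c k m T p) (Pfam (c * (m%:R * 'i)) k.+1 m.+1 T p).
Proof.
move=> hp; apply: (@Int01_derive _ (fun T : R => Pint c k m T p)
  (fun T : R => Pint (c * (m%:R * 'i)) k.+1 m.+1 T p) (T - 1) (T + 1) T
  (nrm (c * (m%:R * 'i)) * 2 ^+ m.+1)).
- by apply/andP; split; lra.
- by move=> t x _ x01; exact: Pint_derive_T.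
- by move=> t _; exact: Pint_cont.
- by move=> t x _ x01; exact: Pint_le.
Qed.

Lemma Pfam_derive_p c k m (T p : R) : Half < p ->
  is_derive p 1 (fun p : R => Pfam c k m T p) (Pfam (c * - m%:R) k.+2 m.+1 T p).
Proof.
move=> hp; apply: (@Int01_derive _ (fun p : R => Pint c k m T p)
  (fun p : R => Pint (c * - m%:R) k.+2 m.+1 T p) Half (p + 1) p
  (nrm (c * - m%:R) * 2 ^+ m.+1)).
- by apply/andP; split; lra.
- by move=> t x /andP[ht _] x01; exact: Pint_derive_p.
- by move=> t /andP[ht _]; exact: Pint_cont.
- by move=> t x /andP[ht _] x01; exact: Pint_le.
Qed.

End ParametricFamily.

(** * Functions of two real variables *)

Section LiftTwoVariables.
Context {R : realType}.
Implicit Types (G GT Gp : R -> R -> R).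

(** A pair of real parameters (T, p) is stored as the two real coordinates of a point of C^1, so
    that the calculus and the chain rule of C^n apply to profiles. *)
Definition liftR G (u : Cn R 1) : R := G (u.1 0 0) (u.2 0 0).
Definition Dp : set (Cn R 1) := [set u : Cn R 1 | 2^-1 < u.2 0 0].

Lemma open_Dp : open Dp.
Proof.
have -> : Dp = cdir (inr ord0) @^-1` [set x | 2^-1 < x] by [].
apply: open_comp; last exact: open_gt.
by move=> u _; exact: (C1_continuous openT (C1_cdir (inr ord0) openT) (I : setT u)).
Qed.

Lemma is_derive_liftR G a b (u : Cn R 1) (d : 'I_1 + 'I_1) :
  is_derive (u.1 0 0) 1 (G ^~ (u.2 0 0)) a -> is_derive (u.2 0 0) 1 (G (u.1 0 0)) b ->
  is_derive u (edir d) (liftR G) (if d is inl _ then a else b).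
Proof.
move=> Ha Hb; case: d => j; rewrite [j]ord1.
  have E : (fun h : R => h^-1 *: ((liftR G \o shift u) (h *: edir (inl ord0)) - liftR G u)) =
   (fun h => h^-1 *: (((G ^~ (u.2 0 0)) \o shift (u.1 0 0)) (h *: 1) - G (u.1 0 0) (u.2 0 0))).
    apply/funext => h; rewrite /liftR /= !mxE eqxx mulr1 mulr0 add0r.
    by rewrite [h *: 1]mulr1.
  by case: Ha => [a1 a2]; split; rewrite /derivable /derive E.
have E : (fun h : R => h^-1 *: ((liftR G \o shift u) (h *: edir (inr ord0)) - liftR G u)) =
   (fun h => h^-1 *: ((G (u.1 0 0) \o shift (u.2 0 0)) (h *: 1) - G (u.1 0 0) (u.2 0 0))).
  apply/funext => h; rewrite /liftR /= !mxE eqxx mulr1 mulr0 add0r.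
  by rewrite [h *: 1]mulr1.
by case: Hb => [b1 b2]; split; rewrite /derivable /derive E.
Qed.

Variables (G GT Gp : R -> R -> R).
Hypothesis HT : forall T p : R, 2^-1 < p -> is_derive T 1 (G ^~ p) (GT T p).
Hypothesis Hp : forall T p : R, 2^-1 < p -> is_derive p 1 (G T) (Gp T p).

Lemma MVT_bound (f df : R -> R) (a b c : R) :
  (forall x : R, Num.min a b <= x <= Num.max a b -> is_derive x 1 f (df x)) ->
  (forall x : R, Num.min a b <= x <= Num.max a b -> `|df x| <= c) ->
  `|f b - f a| <= c * `|b - a|.
Proof.
wlog ab : a b / a <= b => [W|].
  have /orP[ab|ba] := le_total a b; first exact: (W a b ab).
  by rewrite minC maxC distrC [`|b - a|]distrC => h1 h2; apply: W.
rewrite (min_idPl ab) (max_idPr ab) => h1 h2.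
have [x||x xab ->] := @MVT_segment R f df a b ab.
- by rewrite in_itv /= => /andP[xa xb]; apply: h1; rewrite !ltW.
- by apply: derivable_within_continuous => x; rewrite in_itv /= => /h1[].
by rewrite normrM ler_wpM2r //; apply: h2; move: xab; rewrite in_itv.
Qed.

(** Bounded partial derivatives give a Lipschitz estimate by moving one variable at a time; p stays
    above 1/2 on the second move because both end values do. *)
Lemma liftR_continuous (c : R) :
  (forall T p, 2^-1 < p -> `|GT T p| <= c) -> (forall T p, 2^-1 < p -> `|Gp T p| <= c) ->
  forall u, Dp u -> {for u, continuous (liftR G)}.
Proof.
move=> bT bp u Du; apply/cvgrPdist_le => e e0.
have cd d : {for u, continuous (cdir d)}.
  exact: (C1_continuous openT (C1_cdir d openT) (I : setT u)).
have c0 : 0 <= c by apply: le_trans (bT 0 1 _); rewrite ?invf_lt1 ?ltr1n.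
pose k := e / (2 * (c + 1)).
have k0 : 0 < k by rewrite divr_gt0 // mulr_gt0 // ltr_wpDl.
near=> w.
have Dw : 2^-1 < w.2 0 0.
  by near: w; exact: (open_nbhs_nbhs (conj open_Dp Du)).
have w1 : `|u.1 0 0 - w.1 0 0| <= k.
  by near: w; move: (cd (inl ord0)) => /cvgrPdist_le; apply.
have w2 : `|u.2 0 0 - w.2 0 0| <= k.
  by near: w; move: (cd (inr ord0)) => /cvgrPdist_le; apply.
rewrite /liftR.
have -> : G (u.1 0 0) (u.2 0 0) - G (w.1 0 0) (w.2 0 0) =
  (G (u.1 0 0) (u.2 0 0) - G (w.1 0 0) (u.2 0 0)) +
  (G (w.1 0 0) (u.2 0 0) - G (w.1 0 0) (w.2 0 0)) by rewrite addrA subrK.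
apply: le_trans (ler_normD _ _) _.
have m : 2^-1 < Num.min (w.2 0 0) (u.2 0 0) by rewrite lt_min Dw.
have I1 : `|G (u.1 0 0) (u.2 0 0) - G (w.1 0 0) (u.2 0 0)| <= c * `|u.1 0 0 - w.1 0 0|.
  apply: (@MVT_bound (G ^~ (u.2 0 0)) (GT ^~ (u.2 0 0))) => x _; first exact: HT.
  exact: bT.
have I2 : `|G (w.1 0 0) (u.2 0 0) - G (w.1 0 0) (w.2 0 0)| <= c * `|u.2 0 0 - w.2 0 0|.
  apply: (@MVT_bound (G (w.1 0 0)) (Gp (w.1 0 0))) => x /andP[x1 _].
    by apply: Hp; exact: lt_le_trans x1.
  by apply: bp; exact: lt_le_trans x1.
have E : e = (c + 1) * k + (c + 1) * k.
  by rewrite /k; field; rewrite gt_eqF // ltr_wpDl.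
rewrite E; apply: lerD.
  apply: le_trans I1 _; apply: ler_pM => //; lra.
apply: le_trans I2 _; apply: ler_pM => //; lra.
Unshelve. all: by end_near. Qed.

Lemma liftR_C1 : (forall u, Dp u -> {for u, continuous (liftR GT)}) ->
  (forall u, Dp u -> {for u, continuous (liftR Gp)}) -> C1 Dp (liftR G).
Proof.
move=> cT cp.
apply: (@C1_intro _ _ Dp (liftR G) (fun d => if d is inl _ then liftR GT else liftR Gp)).
- exact: open_Dp.
- by move=> u Du d; have := is_derive_liftR d (HT (u.1 0 0) Du) (Hp (u.1 0 0) Du); case: d.
- by move=> u Du [j|j]; [exact: cT|exact: cp].
Qed.

Lemma liftR_C2 : C1 Dp (liftR GT) -> C1 Dp (liftR Gp) -> C2 Dp (liftR G).
Proof.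
move=> cT cp; split.
  by apply: liftR_C1 => u Du; [exact: (C1_continuous open_Dp cT Du)|
    exact: (C1_continuous open_Dp cp Du)].
move=> [j|j].
  apply: (eq_on_C1 open_Dp _ cT) => u Du.
  by have [_ ->] := is_derive_liftR (inl j) (HT (u.1 0 0) Du) (Hp (u.1 0 0) Du).
apply: (eq_on_C1 open_Dp _ cp) => u Du.
by have [_ ->] := is_derive_liftR (inr j) (HT (u.1 0 0) Du) (Hp (u.1 0 0) Du).
Qed.

End LiftTwoVariables.

(** * The extremal profile and its differential equation *)

Section ExtremalTwoVariables.
Context {R : realType}.
Variable N : nat.
Local Notation n := N.+1.
Local Notation Half := (2^-1 : R).

Lemma Pfam_C1 c k m : C1 Dp (liftR (Pfam N c k m) : Cn R 1 -> R).
Proof.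
have cont c' k' m' : forall u : Cn R 1, Dp u -> {for u, continuous (liftR (Pfam N c' k' m'))}.
  apply: (@liftR_continuous R _ (Pfam N (c' * (m'%:R * 'i)) k'.+1 m'.+1)
    (Pfam N (c' * - m'%:R) k'.+2 m'.+1) _ _
    (nrm (c' * (m'%:R * 'i)) * 2 ^+ m'.+1 + nrm (c' * - m'%:R) * 2 ^+ m'.+1)).
  - by move=> T p hp; exact: Pfam_derive_T.
  - by move=> T p hp; exact: Pfam_derive_p.
  - move=> T p hp; apply: le_trans (Pfam_le _ _ _ _ _ hp) _.
    by rewrite lerDl mulr_ge0 ?nrm_ge0 ?exprn_ge0.
  - move=> T p hp; apply: le_trans (Pfam_le _ _ _ _ _ hp) _.
    by rewrite lerDr mulr_ge0 ?nrm_ge0 ?exprn_ge0.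
apply: (@liftR_C1 R _ (Pfam N (c * (m%:R * 'i)) k.+1 m.+1) (Pfam N (c * - m%:R) k.+2 m.+1)).
- by move=> T p hp; exact: Pfam_derive_T.
- by move=> T p hp; exact: Pfam_derive_p.
- exact: cont.
- exact: cont.
Qed.

(* [Sc] is the value of [Im (A ^+ n) / (x * T)], written so as to make sense at
   [x = 0]. *)
Definition Bc (p x : R) : R[i] := ((1 + x ^+ 2 * (p - 1))^-1)%:C.
Definition Sc (T p x : R) : R[i] := Ac T p x * Bc p x *
  \sum_(i < n) Ac T p x ^+ (n.-1 - i) * Bc p x ^+ i.
Definition Fint (T p x : R) : R := (1 - x ^+ 2) ^+ N * (T * complex.Re (Sc T p x)).

(** [Bc] is the real value of [Ac] at T = 0 and A - B = i x T A B, so the factorization of A^n - B^n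
    extracts the factor x T from Im(A^n). The integrand is thus regular at x = 0. *)
Lemma Fint_mul (T p x : R) : Half < p -> 0 <= x <= 1 ->
  x * Fint T p x = (1 - x ^+ 2) ^+ N * complex.Im (Ac T p x ^+ n).
Proof.
move=> hp x01; have Y0 := Y_neq0 T hp x01; have hR := ReY_ge T hp x01.
set r : R := 1 + x ^+ 2 * (p - 1).
have r0 : r != 0 by rewrite gt_eqF // (lt_le_trans _ hR) // invr_gt0.
have rC : r%:C != 0 :> R[i] by rewrite fmorph_eq0.
have AB : Ac T p x - Bc p x = 'i * (x * T)%:C * (Ac T p x * Bc p x).
  have YE : Yc T p x = r%:C - 'i * (x * T)%:C.
    by apply: complex_ext; rewrite !ReImE /r /=; ring.
  rewrite /Ac /Bc fmorphV /= -/r; move: Y0; rewrite YE => Y0.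
  by move: (r%:C) rC ((x * T)%:C) Y0 => a a0 b ab0; field; rewrite a0.
have E : Ac T p x ^+ n = Bc p x ^+ n + 'i * (x * T)%:C * Sc T p x.
  by rewrite -[LHS](subrK (Bc p x ^+ n)) addrC subrXX AB /Sc !mulrA.
rewrite E ImD /Fint.
have -> : complex.Im (Bc p x ^+ n) = 0 by rewrite /Bc -rmorphXn.
have -> : complex.Im ('i * (x * T)%:C * Sc T p x) = x * T * complex.Re (Sc T p x).
  by rewrite !ReImE /=; ring.
by rewrite add0r; move: (complex.Re _) => *; ring.
Qed.

Lemma Fint_neq0 (T p x : R) : Half < p -> 0 <= x <= 1 -> x != 0 ->
  Fint T p x = (1 - x ^+ 2) ^+ N * (x^-1 * complex.Im (Ac T p x ^+ n)).
Proof.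
by move=> hp x01 x0; apply: (mulfI x0); rewrite Fint_mul // [RHS]mulrCA mulVKf.
Qed.

Lemma Ac0 (T p : R) : Ac T p 0 = 1.
Proof.
rewrite /Ac (_ : Yc T p 0 = 1) ?invr1 //.
by apply: complex_ext => /=; rewrite ?expr0n /=; ring.
Qed.

Lemma Fint0 (T p : R) : Fint T p 0 = n%:R * T.
Proof.
rewrite /Fint /Sc Ac0 /Bc expr0n /= mul0r addr0 invr1 subr0 expr1n !mul1r.
under eq_bigr do rewrite !expr1n mulr1.
rewrite sumr_const card_ord mulrC; congr (_ * _).
by rewrite -[n%:R]/(complex.Re (n%:R)%:C) rmorph_nat.
Qed.

Lemma Fint_cont (T p : R) : Half < p -> cont01 (Fint T p).
Proof.
move=> hp; apply: derivable_cont01 => x x01.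
have Y0 := Y_neq0 T hp x01; have hR := ReY_ge T hp x01.
have A1 := is_cder_invX 1 Y0 (cder_Y_x T p x).
have r0 : 1 + x ^+ 2 * (p - 1) != 0 by rewrite gt_eqF // (lt_le_trans _ hR) // invr_gt0.
have b1 : is_derive x 1 (fun x : R => (1 + x ^+ 2 * (p - 1))^-1)
    (- (1 + x ^+ 2 * (p - 1)) ^- 2 *: (2 * x * (p - 1))).
  have [q1 q2] := is_derive_quadratic 1 (p - 1) x.
  pose q (x : R) := 1 + x ^+ 2 * (p - 1).
  by split; [exact: (@derivableV _ _ q x 1 r0 q1)|rewrite (@deriveV _ _ q x 1 r0 q1) q2].
have B1 := is_cder_real b1.
have A1' : is_cder x 1 (Ac T p) _ := A1.
have S1 := is_cder_sum (index_enum (ordinal n)) xpredT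
  (fun i : 'I_n => is_cderM (is_cderX (n.-1 - i) A1') (is_cderX i B1)).
have H := is_derive_Re (is_cderM (is_cderM A1' B1) S1).
apply: derivableM.
  rewrite (_ : (fun _ => _) = wt N 0); first exact: derivable_wt.
  by apply/funext => u; rewrite /wt expr0 mul1r.
apply: derivableM; first exact: derivable_cst.
by case: H.
Qed.

(** The profile of the extremal function before normalization; for [N] = 0 and p = 1 it is the
    arctangent of T. *)
Definition Fext0 (T p : R) : R := Int01 (Fint T p).

(** For x nonzero the integrand is 1/x times a member of the family, and differentiation returns the
    missing factor x; the point x = 0 is treated by the explicit value n T. *)
Lemma Fint_derive_T (T p x : R) : Half < p -> 0 <= x <= 1 ->
  is_derive T 1 (fun T : R => Fint T p x) (Pint N n%:R 0 n.+1 T p x).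
Proof.
move=> hp x01; have [->|x0] := eqVneq x 0.
  have -> : (fun T : R => Fint T p 0) = (fun T => 0 + n%:R * T).
    by apply/funext => u; rewrite Fint0 add0r.
  apply: (is_derive_eq (is_derive_affine _ _ _)).
  rewrite /Pint /wt Ac0 expr0 expr0n subr0 !expr1n !mul1r mulr1.
  by rewrite -[LHS]/(complex.Re (n%:R)%:C) rmorph_nat.
have -> : (fun T : R => Fint T p x) =
  (fun T : R => x^-1 * ((1 - x ^+ 2) ^+ N * complex.Re (- 'i * Ac T p x ^+ n))).
  apply/funext => u; rewrite Fint_neq0 // mulrCA; congr (_ * (_ * _)).
  by rewrite !ReImE /=; ring.
have H := Pint_derive_T N (- 'i) 0 n T hp x01.
have H2 := is_derive_scal x^-1 H.
rewrite (_ : (fun _ => _) = (fun T : R => x^-1 * Pint N (- 'i) 0 n T p x)); last first.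
  by apply/funext => u; rewrite /Pint /wt expr0 mul1r.
apply: (is_derive_eq H2); rewrite /Pint /wt expr1 expr0 mul1r.
have -> : - 'i * (n%:R * 'i) = n%:R :> R[i].
  by rewrite mulrCA mulNr -expr2 sqr_i opprK mulr1.
by move: (complex.Re _) => y; rewrite -!mulrA mulKf.
Qed.

Lemma Fint_derive_p (T p x : R) : Half < p -> 0 <= x <= 1 ->
  is_derive p 1 (fun p : R => Fint T p x) (Pint N ('i * n%:R) 1 n.+1 T p x).
Proof.
move=> hp x01.
have Dh : \forall q \near p, Half < q.
  by apply: open_nbhs_nbhs; split => //; exact: open_gt.
have [->|x0] := eqVneq x 0.
  have -> : (fun p : R => Fint T p 0) = cst (n%:R * T).
    by apply/funext => u; rewrite Fint0.
  apply: (is_derive_eq (is_derive_cst _ _ _)).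
  by rewrite /Pint /wt expr1 !mul0r.
have H := Pint_derive_p N (- 'i) 0 n T hp x01.
have H2 := is_derive_scal x^-1 H.
apply: (@near_eq_is_derive _ _ _ (fun p : R => x^-1 * Pint N (- 'i) 0 n T p x)).
  apply: filterS Dh => u hu; rewrite Fint_neq0 // /Pint /wt expr0 mul1r mulrCA.
  by congr (_ * (_ * _)); rewrite !ReImE /=; ring.
apply: (is_derive_eq H2); rewrite /Pint /wt expr1 mulrNN.
by move: (complex.Re _) => y; rewrite expr2 -!mulrA mulKf.
Qed.

Lemma Fext0_derive_T (T p : R) : Half < p ->
  is_derive T 1 (fun T : R => Fext0 T p) (Pfam N n%:R 0 n.+1 T p).
Proof.
move=> hp; apply: (@Int01_derive _ (fun T => Fint T p)
  (fun T => Pint N n%:R 0 n.+1 T p) (T - 1) (T + 1) T (nrm n%:R * 2 ^+ n.+1)).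
- by apply/andP; split; lra.
- by move=> t x _ x01; exact: Fint_derive_T.
- by move=> t _; exact: Fint_cont.
- by move=> t x _ x01; exact: Pint_le.
Qed.

Lemma Fext0_derive_p (T p : R) : Half < p ->
  is_derive p 1 (Fext0 T) (Pfam N ('i * n%:R) 1 n.+1 T p).
Proof.
move=> hp; apply: (@Int01_derive _ (Fint T)
  (fun p => Pint N ('i * n%:R) 1 n.+1 T p) Half (p + 1) p (nrm ('i * n%:R) * 2 ^+ n.+1)).
- by apply/andP; split; lra.
- by move=> t x /andP[ht _] x01; exact: Fint_derive_p.
- by move=> t /andP[ht _]; exact: Fint_cont.
- by move=> t x /andP[ht _] x01; exact: Pint_le.
Qed.

Lemma Fext0_C2 : C2 Dp (liftR Fext0).
Proof.
apply: (liftR_C2 Fext0_derive_T Fext0_derive_p); exact: Pfam_C1.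
Qed.

Definition FTT (T p : R) := Pfam N (n%:R * (n.+1%:R * 'i)) 1 n.+2 T p.
Definition FTp (T p : R) := Pfam N (n%:R * - n.+1%:R) 2 n.+2 T p.
Definition Fpp (T p : R) := Pfam N ('i * n%:R * - n.+1%:R) 3 n.+2 T p.

(** With k = n, k1 = n + 1, g = (1 - x^2)^[N] and e = A^(n+2), the right side is the x-derivative of
    n Im((1 - x^2)^n A^(n+1)): the differential operator in T and p acts on the integrand as an
    exact derivative in x. *)
Lemma pde_integrand (x T p g k k1 : R) (e : R[i]) :
  let Y : R[i] := (1 + x ^+ 2 * (p - 1)) +i* (- (x * T)) in
  (p + T ^+ 2) * (x ^+ 1 * g * complex.Re (k%:C * (k1%:C * 'i) * e)) +
  2 * T * (p - 1) * (x ^+ 2 * g * complex.Re (k%:C * - k1%:C * e)) +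
  (p ^+ 2 - p) * (x ^+ 3 * g * complex.Re ('i * k%:C * - k1%:C * e)) +
  k1 * T * (x ^+ 0 * g * complex.Re (k%:C * (Y * e))) +
  (k1 * p - 2) * (x ^+ 1 * g * complex.Re ('i * k%:C * (Y * e))) =
  k * complex.Im (((1 + x ^+ 2 * -1) * g)%:C *
     - (k1%:C * e * ((2 * x * (p - 1))%:C - 'i * T%:C)) +
     (Y * e) * ((k1 - 1)%:C * g%:C * (2 * x * -1)%:C)).
Proof. by move=> Y; rewrite !ReImE /=; ring. Qed.

(** The integral of the exact derivative is a difference of boundary values: at x = 1 the weight
    vanishes, and at x = 0 one has A = 1, whose imaginary part is 0. *)
Lemma Fext0_pde (T p : R) : Half < p ->
  (p + T ^+ 2) * FTT T p + 2 * T * (p - 1) * FTp T p + (p ^+ 2 - p) * Fpp T p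
  + n.+1%:R * T * Pfam N n%:R 0 n.+1 T p
  + (n.+1%:R * p - 2) * Pfam N ('i * n%:R) 1 n.+1 T p = 0.
Proof.
move=> hp.
have cP c k m : cont01 (Pint N c k m T p) by exact: Pint_cont.
have cZ a f : cont01 f -> cont01 (fun x : R => a * f x).
  by move=> cf x; apply: continuousM; [exact: cst_continuous|exact: cf].
have cD f g : cont01 f -> cont01 g -> cont01 (fun x : R => f x + g x).
  by move=> cf cg x; apply: continuousD; [exact: cf|exact: cg].
pose f (x : R) := (p + T ^+ 2) * Pint N (n%:R * (n.+1%:R * 'i)) 1 n.+2 T p x +
  2 * T * (p - 1) * Pint N (n%:R * - n.+1%:R) 2 n.+2 T p x +
  (p ^+ 2 - p) * Pint N ('i * n%:R * - n.+1%:R) 3 n.+2 T p x +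
  n.+1%:R * T * Pint N n%:R 0 n.+1 T p x +
  (n.+1%:R * p - 2) * Pint N ('i * n%:R) 1 n.+1 T p x.
have C1' := cZ (p + T ^+ 2) _ (cP (n%:R * (n.+1%:R * 'i)) 1%N n.+2).
have C2' := cZ (2 * T * (p - 1)) _ (cP (n%:R * - n.+1%:R) 2%N n.+2).
have C3' := cZ (p ^+ 2 - p) _ (cP ('i * n%:R * - n.+1%:R) 3%N n.+2).
have C4' := cZ (n.+1%:R * T) _ (cP n%:R 0%N n.+1).
have C5' := cZ (n.+1%:R * p - 2) _ (cP ('i * n%:R) 1%N n.+1).
have C12 := cD _ _ C1' C2'; have C13 := cD _ _ C12 C3'; have C14 := cD _ _ C13 C4'.
have Cf : cont01 f := cD _ _ C14 C5'.
transitivity (Int01 f).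
  rewrite /f (Int01D C14 C5') (Int01D C13 C4') (Int01D C12 C3') (Int01D C1' C2').
  by rewrite !Int01Z //; exact: cP.
pose G (x : R) := (1 + x ^+ 2 * -1)%:C ^+ n * Ac T p x ^+ n.+1.
pose F (x : R) := n%:R * complex.Im (G x).
have -> : Int01 f = F 1 - F 0.
  apply: Int01_FTC => [x x01|]; last exact: Cf.
  have Y0 := Y_neq0 T hp x01.
  have H1 := is_cderX n (is_cder_real (is_derive_quadratic 1 (-1) x)).
  have H2 := is_cder_invX n.+1 Y0 (cder_Y_x T p x).
  have [_ H] := is_cderM H1 H2.
  have H3 := is_derive_scal n%:R H.
  apply: (is_derive_eq H3); rewrite -/(Ac T p x).
  have AY : Ac T p x ^+ n.+1 = Yc T p x * Ac T p x ^+ n.+2.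
    by rewrite [in RHS]exprS mulrA /Ac mulfV // mul1r.
  have := pde_integrand x T p ((1 - x ^+ 2) ^+ N) n%:R n.+1%:R (Ac T p x ^+ n.+2).
  cbv zeta; rewrite -/(Yc T p x) -AY !rmorph_nat => E.
  rewrite /f /Pint /wt E; congr (_ * complex.Im (_ + _)).
    by rewrite -rmorphXn [in LHS]exprS /= mulrN1.
  rewrite succnK mulrN1 -rmorphXn -[X in (X - 1)%:C]natr1 addrK rmorph_nat.
  by congr (_ * _).
rewrite /F /G expr1n mul1r addrN rmorph0 expr0n /= mul0r /= mulr0 Ac0 expr0n mul0r addr0.
by rewrite rmorph1 !expr1n mul1r /= mulr0 subr0.
Qed.

End ExtremalTwoVariables.

(** * Monotonicity of the profile in T by a contour shift *)

Section NormTriangle.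
Context {R : realType}.

Lemma nrmD (a b : R[i]) : nrm (a + b) <= nrm a + nrm b.
Proof.
have nE (u : R[i]) : `|u| = (nrm u)%:C by case: u => u v; rewrite normc_def /nrm /nrm2.
by have := ler_normD a b; rewrite !nE -rmorphD lecR.
Qed.

Lemma nrm_real (x : R) : nrm x%:C = `|x|.
Proof. by rewrite /nrm /nrm2 /= expr0n addr0 sqrtr_sqr. Qed.

End NormTriangle.

Section ContourShift.
Context {R : realType}.
Variable N : nat.
Local Notation n := N.+1.
Variables (T p : R).
Hypotheses (T0 : 0 < T) (p1 : 1 <= p).

(* The path [y |-> (y + i k) / (1 + i k y)] joins [-1] to [1]; [Phi k] is the
   integrand of [\int (1 - x^2)^N Y^-(n+1) dx] pulled back along it, times [dx/dy],
   and [Xi k] the same integrand times [dx/dk]. *)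
Definition Uc (k y : R) : R[i] := 1 + 'i * (k * y)%:C.
Definition Vc (k y : R) : R[i] := y%:C + 'i * k%:C.
Definition Dc (k y : R) : R[i] :=
  Uc k y * Uc k y + (p - 1)%:C * (Vc k y * Vc k y) - 'i * T%:C * (Vc k y * Uc k y).

Definition Phi (k y : R) : R[i] :=
  (1 + k ^+ 2 * 1)%:C ^+ n * ((1 - y ^+ 2) ^+ N)%:C * (Uc k y * Uc k y) *
    (Dc k y)^-1 ^+ n.+1.
Definition Xi (k y : R) : R[i] :=
  ('i * ((1 + k ^+ 2) ^+ N)%:C) * (1 + y ^+ 2 * -1)%:C ^+ n * (Uc k y * Uc k y) *
    (Dc k y)^-1 ^+ n.+1.

Definition dUk (y : R) : R[i] := 'i * y%:C.
Definition dDk (k y : R) : R[i] := (Uc k y * dUk y + Uc k y * dUk y)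
  + (p - 1)%:C * (Vc k y * 'i + Vc k y * 'i)
  - 'i * T%:C * (Vc k y * dUk y + Uc k y * 'i).
Definition dUy (k : R) : R[i] := 'i * k%:C.
Definition dDy (k y : R) : R[i] := (Uc k y * dUy k + Uc k y * dUy k)
  + (p - 1)%:C * (Vc k y * 1 + Vc k y * 1)
  - 'i * T%:C * (Vc k y * dUy k + Uc k y * 1).

Lemma is_cder_lin (a b t : R) : is_cder t (1 : R) (fun t : R => (a * t + b)%:C) a%:C.
Proof.
apply: is_cder_real; rewrite (_ : (fun _ => _) = (fun t : R => b + a * t)).
  exact: is_derive_affine.
by apply/funext => u; rewrite addrC.
Qed.

Lemma cder_Uk (k y : R) : is_cder k (1 : R) (Uc ^~ y) (dUk y).
Proof.
apply: (is_cder_eq (is_cderD (is_cder_cst k 1 1) (is_cderZ 'i (_ : is_cder k (1 : R) _ y%:C)))).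
  rewrite (_ : (fun _ => _) = (fun t : R => (y * t + 0)%:C)); first exact: is_cder_lin.
  by apply/funext => u; rewrite addr0 mulrC.
by rewrite add0r.
Qed.

Lemma cder_Uy (k y : R) : is_cder y (1 : R) (Uc k) (dUy k).
Proof.
apply: (is_cder_eq (is_cderD (is_cder_cst y 1 1) (is_cderZ 'i (_ : is_cder y (1 : R) _ k%:C)))).
  rewrite (_ : (fun _ => _) = (fun t : R => (k * t + 0)%:C)); first exact: is_cder_lin.
  by apply/funext => u; rewrite addr0.
by rewrite add0r.
Qed.

Lemma is_cder_id (t : R) : is_cder t (1 : R) (fun t : R => t%:C) 1.
Proof.
have := is_cder_lin 1 0 t; rewrite (_ : (fun _ => _) = (fun t : R => t%:C)) //.
by apply/funext => u; rewrite mul1r addr0.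
Qed.

Lemma cder_Vk (k y : R) : is_cder k (1 : R) (Vc ^~ y) 'i.
Proof.
apply: (is_cder_eq (is_cderD (is_cder_cst k 1 y%:C) (is_cderZ 'i (is_cder_id k)))).
by rewrite add0r mulr1.
Qed.

Lemma cder_Vy (k y : R) : is_cder y (1 : R) (Vc k) 1.
Proof.
apply: (is_cder_eq (is_cderD (is_cder_id y) (is_cder_cst y 1 ('i * k%:C)))).
by rewrite addr0.
Qed.

Lemma cder_Dk (k y : R) : is_cder k (1 : R) (Dc ^~ y) (dDk k y).
Proof.
have U := cder_Uk k y; have V := cder_Vk k y.
exact: (is_cderD (is_cderD (is_cderM U U) (is_cderZ (p - 1)%:C (is_cderM V V)))
  (is_cderN (is_cderZ ('i * T%:C) (is_cderM V U)))).
Qed.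

Lemma cder_Dy (k y : R) : is_cder y (1 : R) (Dc k) (dDy k y).
Proof.
have U := cder_Uy k y; have V := cder_Vy k y.
exact: (is_cderD (is_cderD (is_cderM U U) (is_cderZ (p - 1)%:C (is_cderM V V)))
  (is_cderN (is_cderZ ('i * T%:C) (is_cderM V U)))).
Qed.

Let rD (k y : R) : R :=
  1 - k ^+ 2 * y ^+ 2 + (p - 1) * (y ^+ 2 - k ^+ 2) + T * k * (1 + y ^+ 2).
Let iD (k y : R) : R := y * (2 * p * k - T * (1 - k ^+ 2)).

Lemma UcE (k y : R) : Uc k y = 1 +i* (k * y).
Proof. by apply: complex_ext; rewrite /Uc !ReImE /=; ring. Qed.

Lemma VcE (k y : R) : Vc k y = y +i* k.
Proof. by apply: complex_ext; rewrite /Vc !ReImE /=; ring. Qed.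

Lemma DcE (k y : R) : Dc k y = rD k y +i* iD k y.
Proof.
by rewrite /Dc UcE VcE /rD /iD; apply: complex_ext; rewrite !ReImE /=; ring.
Qed.

Lemma dDkE (k y : R) : dDk k y =
  (- (2 * k * y ^+ 2) - 2 * (p - 1) * k + T * (1 + y ^+ 2)) +i* (2 * y * (p + T * k)).
Proof.
rewrite /dDk /dUk UcE VcE; apply: complex_ext; rewrite !ReImE /=; ring.
Qed.

Lemma dDyE (k y : R) : dDy k y =
  (- (2 * k ^+ 2 * y) + 2 * (p - 1) * y + 2 * T * k * y) +i* (2 * p * k - T * (1 - k ^+ 2)).
Proof.
by rewrite /dDy /dUy UcE VcE; apply: complex_ext; rewrite !ReImE /=; ring.
Qed.

Lemma ReDc (k y : R) : complex.Re (Dc k y) = rD k y.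
Proof. by rewrite DcE. Qed.

Lemma ImDc (k y : R) : complex.Im (Dc k y) = iD k y.
Proof. by rewrite DcE. Qed.

(** The field (1 + k^2) d/dk - i (1 - y^2) d/dy annihilates the path point V/U and multiplies U by k
    + i y. Since D is U^2 times the denominator Y taken at V/U, it is multiplied by twice that
    factor. *)
Lemma contour_ode (k y : R) :
  (1 + k ^+ 2)%:C * dDk k y - 'i * (1 - y ^+ 2)%:C * dDy k y =
  2 * ((k +i* y) * Dc k y).
Proof.
by rewrite dDkE dDyE DcE /rD /iD; apply: complex_ext; rewrite !ReImE /=; ring.
Qed.

(** The shift k ranges over an open interval from -[delta] to [k2], so that k = 0 is an interior
    point. Up to [k2] the inequality 2 p k <= T of [ReD_ge1] holds; [delta] is small enough to keep
    Re D >= 1/2 to the left of 0. *)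
Let delta : R := (2 * (p + 2 * T) + 2)^-1.
Let k2 : R := T / (2 * p).

Lemma ReD_ge1 (k y : R) : 0 <= k -> 2 * p * k <= T -> 0 <= y <= 1 ->
  1 <= complex.Re (Dc k y).
Proof.
move=> k0 kT /andP[y0 y1]; rewrite ReDc /rD -subr_ge0.
have -> : 1 - k ^+ 2 * y ^+ 2 + (p - 1) * (y ^+ 2 - k ^+ 2) + T * k * (1 + y ^+ 2) - 1 =
  (T - 2 * p * k) * k + p * k ^+ 2 + k ^+ 2 * (1 - y ^+ 2) + (p - 1) * y ^+ 2
  + T * k * y ^+ 2 by ring.
have y2 : y ^+ 2 <= 1 by rewrite exprn_ile1.
have p0 : 0 <= p by apply: le_trans p1.
have T0' := ltW T0.
by rewrite !addr_ge0 ?mulr_ge0 ?subr_ge0 ?sqr_ge0.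
Qed.

Lemma ReD_ge (k y : R) : - delta < k < k2 -> 0 <= y <= 1 -> 2^-1 <= complex.Re (Dc k y).
Proof.
move=> /andP[dk kk] y01; have [k0|k0] := leP 0 k.
  apply: (@le_trans _ _ 1); first by rewrite invf_le1 ?ler1n.
  have pp : 0 < 2 * p by rewrite mulr_gt0 // (lt_le_trans ltr01).
  by apply: ReD_ge1 => //; move: kk; rewrite /k2 (ltr_pdivlMr _ _ pp) => /ltW; rewrite mulrC.
have T0' := T0; have p1' := p1.
have s0 : 0 < 2 * (p + 2 * T) + 2 by lra.
have d0 : 0 < delta by rewrite invr_gt0.
have hs : delta * (2 * (p + 2 * T) + 2) = 1 by rewrite mulVf // gt_eqF.
have d1 : delta <= 1 by nra.
rewrite ReDc /rD; case/andP: y01 => y0 y1.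
have y2 : 0 <= y ^+ 2 <= 1 by rewrite sqr_ge0 exprn_ile1.
case/andP: y2 => y20 y21.
have kd : k ^+ 2 <= delta by nra.
have h1 : k ^+ 2 * y ^+ 2 <= k ^+ 2 by rewrite ler_piMr // sqr_ge0.
have h2 : (p - 1) * k ^+ 2 <= (p - 1) * delta by rewrite ler_wpM2l // subr_ge0.
have h3 : 0 <= (p - 1) * y ^+ 2 by rewrite mulr_ge0 // subr_ge0.
have h4 : - (T * delta * 2) <= T * k * (1 + y ^+ 2).
  have : - k * (1 + y ^+ 2) <= delta * 2 by nra.
  by nra.
by move: h1 h2 h3 h4 kd hs; rewrite !expr2 => *; lra.
Qed.

Lemma D_neq0 (k y : R) : - delta < k < k2 -> 0 <= y <= 1 -> Dc k y != 0.
Proof.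
move=> hk hy; apply: contraTneq (ReD_ge hk hy) => ->.
by rewrite -ltNge /= invr_gt0.
Qed.

Lemma nrm_Dinv (k y : R) : - delta < k < k2 -> 0 <= y <= 1 -> nrm (Dc k y)^-1 <= 2.
Proof.
move=> hk hy; rewrite nrmV -[leRHS]invrK lef_pV2 ?posrE //.
  apply: le_trans (Re_le_nrm _); apply: le_trans (ler_norm _); exact: ReD_ge.
by rewrite sqrtr_gt0 nrm2_gt0 D_neq0.
Qed.

Definition dPhi (k y : R) : R[i] :=
  (1 + k ^+ 2)%:C ^+ N * ((1 - y ^+ 2) ^+ N)%:C *
  (n%:R * (2 * k)%:C * (Uc k y * Uc k y) * (Dc k y)^-1 ^+ n.+1
   + (1 + k ^+ 2)%:C * (2 * (Uc k y * dUk y) * (Dc k y)^-1 ^+ n.+1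
      - (Uc k y * Uc k y) * (n.+1%:R * (Dc k y)^-1 ^+ n.+2 * dDk k y))).

Lemma cder_Phi (k y : R) : - delta < k < k2 -> 0 <= y <= 1 ->
  is_cder k (1 : R) (Phi ^~ y) (dPhi k y).
Proof.
move=> hk hy; have D0 := D_neq0 hk hy.
have H1 := is_cderX n (is_cder_real (is_derive_quadratic 1 1 k)).
have H2 := is_cderM H1 (is_cder_cst k 1 ((1 - y ^+ 2) ^+ N)%:C).
have U := cder_Uk k y.
have H3 := is_cderM H2 (is_cderM U U).
have H4 := @is_cder_invX _ _ k 1 (Dc ^~ y) _ n.+1 D0 (cder_Dk k y).
apply: (is_cder_eq (is_cderM H3 H4)).
rewrite /dPhi succnK !mulr1 mulr0 add0r [_ ^+ n]exprS /cst.
move: (Uc k y) (dUk y) (dDk k y) ((Dc k y)^-1) (((1 - y ^+ 2) ^+ N)%:C)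
  ((1 + k ^+ 2)%:C ^+ N) ((1 + k ^+ 2)%:C) ((2 * k)%:C) => *; ring.
Qed.

Lemma contour_identity (K : comPzRingType) (i k y D Dk Dy E a b m : K) :
  i * i = -1 ->
  (1 + k * k) * Dk - i * (1 - y * y) * Dy = 2 * ((k + i * y) * D) ->
  let u := 1 + i * (k * y) in
  i * a * ((1 - y * y) * b) * (u * u) * - ((m + 1) * E * Dy) +
    D * E * (i * a * ((1 - y * y) * b) * (u * (i * k) + u * (i * k)) +
      u * u * (i * a * (m * b * - (2 * y)))) =
  a * b * (m * (2 * k) * (u * u) * (D * E) +
    (1 + k * k) * (2 * (u * (i * y)) * (D * E) - u * u * ((m + 1) * E * Dk))).
Proof.
move=> i2 ode u; apply/eqP; rewrite -subr_eq0; apply/eqP.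
transitivity (a * b * E * u * ((m + 1) * u *
   ((1 + k * k) * Dk - i * (1 - y * y) * Dy - 2 * ((k + i * y) * D)) +
   2 * D * k * (i * i + 1))); first by rewrite /u; ring.
by rewrite ode i2; ring.
Qed.

Lemma cder_Xi (k y : R) : - delta < k < k2 -> 0 <= y <= 1 ->
  is_cder y (1 : R) (Xi k) (dPhi k y).
Proof.
move=> hk hy; have D0 := D_neq0 hk hy.
have H1 := is_cderX n (is_cder_real (is_derive_quadratic 1 (-1) y)).
have H2 := is_cderZ ('i * ((1 + k ^+ 2) ^+ N)%:C) H1.
have U := cder_Uy k y.
have H3 := is_cderM H2 (is_cderM U U).
have H4 := @is_cder_invX _ _ y 1 (Dc k) _ n.+1 D0 (cder_Dy k y).
apply: (is_cder_eq (is_cderM H3 H4)).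
have ode := contour_ode k y.
have E1 : (Dc k y)^-1 ^+ n.+1 = Dc k y * (Dc k y)^-1 ^+ n.+2.
  by rewrite [in RHS]exprS mulrA mulfV // mul1r.
rewrite /dPhi succnK E1 !mulrN1 [_ ^+ n]exprS.
have -> : (- (2 * y))%:C = - (2 * y%:C) :> R[i].
  by apply: complex_ext; rewrite !ReImE /=; ring.
have -> : (2 * k)%:C = 2 * k%:C :> R[i].
  by apply: complex_ext; rewrite !ReImE /=; ring.
rewrite !rmorphXn /=.
have UE : Uc k y = 1 + 'i * (k%:C * y%:C) by rewrite /Uc rmorphM.
have i2 : 'i * 'i = -1 :> R[i] by rewrite -expr2 sqr_i.
have cE : k +i* y = k%:C + 'i * y%:C :> R[i].
  by apply: complex_ext; rewrite !ReImE /=; ring.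
have aK : (1 + k ^+ 2)%:C = 1 + k%:C * k%:C :> R[i].
  by rewrite expr2 rmorphD rmorphM rmorph1.
have bY : (1 - y ^+ 2)%:C = 1 - y%:C * y%:C :> R[i].
  by rewrite expr2 rmorphB rmorphM rmorph1.
rewrite cE !aK !bY in ode *; rewrite -[n.+1%:R]natr1 /dUk /dUy.
have := contour_identity ((Dc k y)^-1 ^+ n.+2) ((1 + k%:C * k%:C) ^+ N)
  ((1 - y%:C * y%:C) ^+ N) n%:R i2 ode.
by rewrite -UE.
Qed.

(** Uniform bounds over the whole parameter range: the domination required to differentiate under
    the integral sign in k. *)
Definition bounded_fun (f : R -> R -> R[i]) : Prop :=
  exists c, forall k y : R, - delta < k < k2 -> 0 <= y <= 1 -> nrm (f k y) <= c.

Lemma bounded_funD f g : bounded_fun f -> bounded_fun g ->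
  bounded_fun (fun k y => f k y + g k y).
Proof.
move=> [c cf] [d dg]; exists (c + d) => k y hk hy.
by apply: le_trans (nrmD _ _) _; rewrite lerD ?cf ?dg.
Qed.

Lemma bounded_funM f g : bounded_fun f -> bounded_fun g ->
  bounded_fun (fun k y => f k y * g k y).
Proof.
move=> [c cf] [d dg]; exists (c * d) => k y hk hy.
by rewrite nrmM ler_pM ?nrm_ge0 ?cf ?dg.
Qed.

Lemma bounded_fun_cst a : bounded_fun (fun _ _ => a).
Proof. by exists (nrm a). Qed.

Lemma bounded_funX f m : bounded_fun f -> bounded_fun (fun k y => f k y ^+ m).
Proof.
move=> bf; elim: m => [|m IH]; first exact: (bounded_fun_cst 1).
have := bounded_funM bf IH; rewrite (_ : (fun _ _ => _ * _) = (fun k y => f k y ^+ m.+1)) //.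
by apply/funext => k; apply/funext => y; rewrite exprS.
Qed.

Lemma bounded_fun_k : bounded_fun (fun k _ => k%:C).
Proof.
exists (delta + k2) => k y /andP[h1 h2] _; rewrite nrm_real ler_norml.
have d0 : 0 < delta by rewrite invr_gt0 ltr_wpDl // mulr_ge0 // addr_ge0 ?mulr_ge0 // ?(ltW T0) // (le_trans ler01 p1).
have k0 : 0 <= k2 by rewrite divr_ge0 ?(ltW T0) // mulr_ge0 // (le_trans ler01 p1).
by apply/andP; split; move: d0 k0 h1 h2; move: delta k2 => d k'; lra.
Qed.

Lemma bounded_fun_y : bounded_fun (fun _ y => y%:C).
Proof. by exists 1 => k y _ /andP[h1 h2]; rewrite nrm_real ger0_norm. Qed.

Lemma bounded_fun_eq f g : (forall k y, f k y = g k y) -> bounded_fun g -> bounded_fun f.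
Proof. by move=> fg [c h]; exists c => k y hk hy; rewrite fg h. Qed.

Lemma bounded_fun_Uc : bounded_fun Uc.
Proof.
apply: bounded_funD; first exact: bounded_fun_cst.
apply: bounded_funM; first exact: bounded_fun_cst.
apply: (@bounded_fun_eq _ (fun k y => k%:C * y%:C)); first by move=> k y; rewrite rmorphM.
by apply: bounded_funM; [exact: bounded_fun_k|exact: bounded_fun_y].
Qed.

Lemma bounded_fun_Vc : bounded_fun Vc.
Proof.
apply: bounded_funD; first exact: bounded_fun_y.
by apply: bounded_funM; [exact: bounded_fun_cst|exact: bounded_fun_k].
Qed.

Lemma bounded_fun_dUk : bounded_fun (fun _ y => dUk y).
Proof. by apply: bounded_funM; [exact: bounded_fun_cst|exact: bounded_fun_y]. Qed.

Lemma bounded_fun_dDk : bounded_fun dDk.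
Proof.
have bU := bounded_fun_Uc; have bV := bounded_fun_Vc; have bd := bounded_fun_dUk.
have bc := bounded_fun_cst.
have bUd := bounded_funM bU bd; have bVd := bounded_funM bV bd.
have bVi := bounded_funM bV (bc 'i); have bUi := bounded_funM bU (bc 'i).
apply: (@bounded_fun_eq _ (fun k y => Uc k y * dUk y + Uc k y * dUk y +
  (p - 1)%:C * (Vc k y * 'i + Vc k y * 'i) +
  (- ('i * T%:C)) * (Vc k y * dUk y + Uc k y * 'i))).
  by move=> k y; rewrite /dDk mulNr.
exact: (bounded_funD (bounded_funD (bounded_funD bUd bUd)
  (bounded_funM (bc _) (bounded_funD bVi bVi))) (bounded_funM (bc _) (bounded_funD bVd bUi))).
Qed.

Lemma bounded_fun_dPhi : bounded_fun dPhi.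
Proof.
have bU := bounded_fun_Uc; have bc := bounded_fun_cst.
have bk := bounded_fun_k; have bY := bounded_fun_y.
have bK : bounded_fun (fun k _ => (1 + k ^+ 2)%:C).
  apply: (@bounded_fun_eq _ (fun k _ => 1 + k%:C ^+ 2)).
    by move=> k y; rewrite rmorphD rmorphXn rmorph1.
  exact: (bounded_funD (bc _) (bounded_funX 2 bk)).
have bY2 : bounded_fun (fun _ y => ((1 - y ^+ 2) ^+ N)%:C).
  apply: (@bounded_fun_eq _ (fun _ y => (1 + (-1) * y%:C ^+ 2) ^+ N)).
    by move=> k y; rewrite mulN1r -rmorphXn -rmorphB -rmorphXn.
  exact: (bounded_funX N (bounded_funD (bc _) (bounded_funM (bc _) (bounded_funX 2 bY)))).
have bI : bounded_fun (fun k y => (Dc k y)^-1).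
  by exists 2 => k y hk hy; exact: nrm_Dinv.
have b2k : bounded_fun (fun k _ => (2 * k)%:C).
  apply: (@bounded_fun_eq _ (fun k _ => 2%:C * k%:C)); first by move=> k y; rewrite rmorphM.
  exact: (bounded_funM (bc _) bk).
have bUU := bounded_funM bU bU.
have bN : bounded_fun (fun k y => - (Uc k y * Uc k y * (n.+1%:R * (Dc k y)^-1 ^+ n.+2 * dDk k y))).
  apply: (@bounded_fun_eq _ (fun k y => (-1) *
    (Uc k y * Uc k y * (n.+1%:R * (Dc k y)^-1 ^+ n.+2 * dDk k y)))).
    by move=> k y; rewrite mulN1r.
  exact: (bounded_funM (bc _) (bounded_funM bUU
    (bounded_funM (bounded_funM (bc _) (bounded_funX _ bI)) bounded_fun_dDk))).
exact: (bounded_funM (bounded_funM (bounded_funX N bK) bY2) (bounded_funD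
  (bounded_funM (bounded_funM (bounded_funM (bc _) b2k) bUU) (bounded_funX _ bI))
  (bounded_funM bK (bounded_funD (bounded_funM (bounded_funM (bc _)
     (bounded_funM bU bounded_fun_dUk)) (bounded_funX _ bI)) bN)))).
Qed.

End ContourShift.

Section ContourConclusion.
Context {R : realType}.
Variable N : nat.
Local Notation n := N.+1.
Implicit Types (f g : R -> R[i]).

Definition smooth01 f : Prop :=
  forall y : R, 0 <= y <= 1 -> exists d, is_cder y (1 : R) f d.

Lemma smooth01_cst a : smooth01 (fun=> a).
Proof. by move=> y _; exists 0; exact: is_cder_cst. Qed.

Lemma smooth01D f g : smooth01 f -> smooth01 g -> smooth01 (fun y => f y + g y).
Proof.
by move=> hf hg y hy; have [a fa] := hf y hy; have [b gb] := hg y hy;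
  exists (a + b); exact: is_cderD.
Qed.

Lemma smooth01N f : smooth01 f -> smooth01 (fun y => - f y).
Proof. by move=> hf y hy; have [a fa] := hf y hy; exists (- a); exact: is_cderN. Qed.

Lemma smooth01M f g : smooth01 f -> smooth01 g -> smooth01 (fun y => f y * g y).
Proof.
move=> hf hg y hy; have [a fa] := hf y hy; have [b gb] := hg y hy.
by eexists; exact: (is_cderM fa gb).
Qed.

Lemma smooth01X f m : smooth01 f -> smooth01 (fun y => f y ^+ m).
Proof. by move=> hf y hy; have [a fa] := hf y hy; eexists; exact: (is_cderX m fa). Qed.

Lemma smooth01_y : smooth01 (fun y => y%:C).
Proof. by move=> y _; exists 1; exact: is_cder_id. Qed.

Lemma smooth01_Re_cont f : smooth01 f -> cont01 (fun y => complex.Re (f y)).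
Proof.
move=> hf; apply: derivable_cont01 => y hy; have [d fd] := hf y hy.
by have [] := is_derive_Re fd.
Qed.

Variables (T p : R).
Hypotheses (T0 : 0 < T) (p1 : 1 <= p).
Let delta : R := (2 * (p + 2 * T) + 2)^-1.
Let k2 : R := T / (2 * p).
Local Notation Dc := (Dc T p).
Local Notation Phi := (Phi N T p).
Local Notation dPhi := (dPhi N T p).
Local Notation Xi := (Xi N T p).

Lemma smooth01_U k : smooth01 (Uc k).
Proof. by move=> y _; exists (dUy k); exact: cder_Uy. Qed.

Lemma smooth01_V k : smooth01 (Vc k).
Proof. by move=> y _; exists 1; exact: cder_Vy. Qed.

Lemma smooth01_I k m : - delta < k < k2 -> smooth01 (fun y => (Dc k y)^-1 ^+ m).
Proof.
move=> hk; apply: smooth01X => y hy.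
by eexists; exact: (is_cderV (D_neq0 T0 p1 hk hy) (cder_Dy T p k y)).
Qed.

Lemma smooth01_w : smooth01 (fun y => ((1 - y ^+ 2) ^+ N)%:C).
Proof.
have := smooth01X N (smooth01D (smooth01_cst 1) (smooth01N (smooth01X 2 smooth01_y))).
rewrite (_ : (fun _ => _ ^+ N) = (fun y => ((1 - y ^+ 2) ^+ N)%:C)) //.
by apply/funext => y; rewrite !rmorphXn rmorphB rmorphXn rmorph1.
Qed.

Lemma smooth01_Phi k : - delta < k < k2 -> smooth01 (Phi k).
Proof.
move=> hk.
exact: (smooth01M (smooth01M (smooth01M (smooth01_cst _) smooth01_w)
  (smooth01M (smooth01_U k) (smooth01_U k))) (smooth01_I n.+1 hk)).
Qed.

Lemma smooth01_dUk : smooth01 dUk.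
Proof. exact: (smooth01M (smooth01_cst 'i) smooth01_y). Qed.

Lemma smooth01_dDk k : smooth01 (dDk T p k).
Proof.
have U := smooth01_U k; have V := smooth01_V k; have c := smooth01_cst.
have d := smooth01_dUk.
have Ud := smooth01M U d.
exact: (smooth01D (smooth01D (smooth01D Ud Ud) (smooth01M (c (p - 1)%:C)
  (smooth01D (smooth01M V (c 'i)) (smooth01M V (c 'i)))))
  (smooth01N (smooth01M (c ('i * T%:C)) (smooth01D (smooth01M V d) (smooth01M U (c 'i)))))).
Qed.

Lemma smooth01_dPhi k : - delta < k < k2 -> smooth01 (dPhi k).
Proof.
move=> hk; have U := smooth01_U k; have c := smooth01_cst.
have UU := smooth01M U U; have I1 := smooth01_I n.+1 hk; have I2 := smooth01_I n.+2 hk.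
exact: (smooth01M (smooth01M (c ((1 + k ^+ 2)%:C ^+ N)) smooth01_w)
  (smooth01D (smooth01M (smooth01M (c (n%:R * (2 * k)%:C)) UU) I1)
  (smooth01M (c (1 + k ^+ 2)%:C) (smooth01D
     (smooth01M (smooth01M (c 2) (smooth01M U smooth01_dUk)) I1)
     (smooth01N (smooth01M UU (smooth01M (smooth01M (c n.+1%:R) I2) (smooth01_dDk k)))))))).
Qed.

(** At k = 0 this is, up to the factor n, the T-derivative of the profile. *)
Let J (k : R) : R := Int01 (fun y => complex.Re (Phi k y)).

(** The k-derivative of the integrand is the y-derivative of [Xi], whose real part vanishes at both
    ends: at y = 1 by the weight, and at y = 0 because U and D are real there and [Xi] is i times a
    real number. This is why the half path over 0 <= y <= 1 suffices. *)
Lemma Int01_dPhi k : - delta < k < k2 -> Int01 (fun y => complex.Re (dPhi k y)) = 0.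
Proof.
move=> hk.
have H (y : R) : 0 <= y <= 1 ->
    is_derive y 1 (fun y => complex.Re (Xi k y)) (complex.Re (dPhi k y)).
  by move=> hy; exact: (is_derive_Re (cder_Xi N T0 p1 hk hy)).
rewrite (Int01_FTC H (smooth01_Re_cont (smooth01_dPhi hk))).
have -> : complex.Re (Xi k 1) = 0.
  by rewrite /Xi expr1n mul1r addrN rmorph0 expr0n mulr0 !mul0r.
have UE : Uc k 0 = 1 by rewrite /Uc mulr0 mulr0 addr0.
have DE : Dc k 0 = (1 - (p - 1) * k ^+ 2 + T * k)%:C.
  by rewrite DcE; apply: complex_ext => /=; ring.
rewrite /Xi UE DE expr0n /= mul0r addr0 rmorph1 expr1n !mulr1 -fmorphV -rmorphXn -mulrA -rmorphM.
by rewrite !ReImE /= mul0r mul1r subrr subrr.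
Qed.

Lemma J_derive k : - delta < k < k2 -> is_derive k 1 J 0.
Proof.
move=> hk; have [c hc] := bounded_fun_dPhi N T0 p1.
rewrite -(Int01_dPhi hk).
apply: (@Int01_derive _ (fun k y => complex.Re (Phi k y)) (fun k y => complex.Re (dPhi k y))
  (- delta) k2 k c hk).
- by move=> t y ht hy; exact: (is_derive_Re (cder_Phi N T0 p1 ht hy)).
- by move=> t ht; exact: (smooth01_Re_cont (smooth01_Phi ht)).
- by move=> t y ht hy; apply: le_trans (Re_le_nrm _) (hc t y ht hy).
Qed.

(** [ks] is the positive root of 2 p k = T (1 - k^2), the equation that makes the imaginary part of
    D vanish for every y. *)
Let P := Num.sqrt (p ^+ 2 + T ^+ 2).
Let ks := T / (P + p).

Lemma P_gt : p < P.
Proof.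
have p0 : 0 <= p := le_trans ler01 p1.
by rewrite -[p in ltLHS](ger0_norm p0) -sqrtr_sqr ltr_sqrt ?ltrDl ?exprn_gt0 // ltr_wpDl ?sqr_ge0 ?exprn_gt0.
Qed.

Lemma ks_bounds : [/\ 0 <= ks, ks <= 1, ks < k2, 2 * p * ks <= T & 2 * p * ks = T * (1 - ks ^+ 2)].
Proof.
have p0 : 0 < p := lt_le_trans ltr01 p1.
have Pp := P_gt; have P0 : 0 < P by exact: lt_trans Pp.
have PT : P ^+ 2 = p ^+ 2 + T ^+ 2 by rewrite sqr_sqrtr // addr_ge0 ?sqr_ge0.
have TP : T <= P by rewrite -(@ler_pXn2r _ 2) ?nnegrE ?(ltW P0) ?(ltW T0) // PT lerDr sqr_ge0.
have s0 : 0 < P + p by rewrite addr_gt0.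
have lt2 : ks < k2.
  by rewrite ltr_pM2l // ltf_pV2 ?posrE ?mulr_gt0 // mulr_natl mulr2n ltrD2r.
split=> //.
- by rewrite divr_ge0 ?(ltW T0) ?(ltW s0).
- by rewrite ler_pdivrMr // mul1r ler_wpDr // ltW.
- by move: (ltW lt2); rewrite ler_pdivlMr ?mulr_gt0 // mulrC.
have s1 : P + p != 0 by rewrite gt_eqF.
have H : T * (p ^+ 2 + T ^+ 2 - P ^+ 2) = 0 by rewrite PT subrr mulr0.
apply/eqP; rewrite -subr_eq0; apply/eqP.
transitivity (T * (p ^+ 2 + T ^+ 2 - P ^+ 2) / (P + p) ^+ 2); last by rewrite H mul0r.
by rewrite /ks; field.
Qed.

(** On the arc of parameter [ks] the denominator D is real and at least 1, so the integrand has the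
    sign of Re(U^2) = 1 - k^2 y^2, which is nonnegative since k and y are at most 1. *)
Lemma J_ks : 0 <= J ks.
Proof.
have [k0 k1 kk kT kE] := ks_bounds.
apply: Int01_ge0 => y y01.
have hD := ReD_ge1 T0 p1 k0 kT y01.
have DE : Dc ks y = (complex.Re (Dc ks y))%:C.
  apply: complex_ext; first by []. rewrite (ImDc T p ks y) kE /=; ring.
move: (complex.Re _) hD DE => r r1 DE.
case/andP: y01 => y0 y1.
have UE : complex.Re (Uc ks y * Uc ks y) = 1 - ks ^+ 2 * y ^+ 2.
  by rewrite UcE ReM /=; ring.
have -> : Phi ks y = ((1 + ks ^+ 2) ^+ n * (1 - y ^+ 2) ^+ N * (r^-1 ^+ n.+1))%:C *
    (Uc ks y * Uc ks y).
  have E1 : (r%:C)^-1 ^+ n.+1 = (r^-1 ^+ n.+1)%:C by rewrite rmorphXn fmorphV.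
  have E2 : (1 + ks ^+ 2)%:C ^+ n = ((1 + ks ^+ 2) ^+ n)%:C by rewrite rmorphXn.
  by rewrite /Phi DE mulr1 E1 E2 mulrAC -!rmorphM.
rewrite ReZ UE; apply: mulr_ge0.
  have a0 : 0 <= 1 + ks ^+ 2 by rewrite addr_ge0 ?sqr_ge0.
  have b0 : 0 <= 1 - y ^+ 2 by rewrite subr_ge0 exprn_ile1.
  have r0 : 0 <= r^-1 by rewrite invr_ge0 (le_trans ler01 r1).
  by rewrite mulr_ge0 ?exprn_ge0 // mulr_ge0 ?exprn_ge0.
by rewrite subr_ge0 -exprMn; apply: exprn_ile1; [exact: mulr_ge0|exact: mulr_ile1].
Qed.

(** [J] has zero derivative between 0 and [ks], hence its value on the original segment equals the
    nonnegative one on the arc. *)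
Lemma Pfam_ge0_pos : 0 <= Pfam N n%:R 0 n.+1 T p.
Proof.
have [k0 k1 kk kT kE] := ks_bounds.
have d0 : 0 < delta.
  by rewrite invr_gt0 ltr_wpDl // mulr_ge0 // addr_ge0 ?mulr_ge0 ?(ltW T0) // (le_trans ler01).
have d0' : - delta < 0 by rewrite oppr_lt0.
have JE : J ks = J 0.
  apply/eqP; rewrite -subr_eq0 -normr_le0 -[leRHS](mul0r `|ks - 0|).
  apply: (@MVT_bound _ J (fun=> 0)) => x; rewrite (min_idPl k0) (max_idPr k0) => /andP[x0 xk].
    by apply: J_derive; rewrite (lt_le_trans d0' x0) (le_lt_trans xk kk).
  by rewrite normr0.
have c0 : cont01 (fun y => complex.Re (Phi 0 y)).
  by apply: smooth01_Re_cont; apply: smooth01_Phi; rewrite d0' (le_lt_trans k0 kk).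
have -> : Pfam N n%:R 0 n.+1 T p = n%:R * J 0.
  rewrite /J -Int01Z //; apply: Int01_eq => y _.
  have UE : Uc 0 y = 1 by rewrite /Uc mul0r mulr0 addr0.
  have DE : Dc 0 y = Yc T p y by rewrite DcE /Yc; apply: complex_ext => /=; ring.
  rewrite /Pint /wt /Ac -DE /Phi UE expr0n mul0r addr0 rmorph1 expr1n !mul1r mulr1 ?expr0 ?mul1r.
  rewrite -[n%:R in LHS](rmorph_nat (real_complex R)) !ReZ.
  by move: (complex.Re _) => *; ring.
by rewrite -JE mulr_ge0 // J_ks.
Qed.

End ContourConclusion.

Lemma Pfam_ge0 {R : realType} (N : nat) (T p : R) : 0 <= T -> 1 <= p ->
  0 <= Pfam N N.+1%:R 0 N.+2 T p.
Proof.
rewrite le_eqVlt => /orP[/eqP<-|T0] p1; last exact: Pfam_ge0_pos.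
apply: Int01_ge0 => x /andP[x0 x1]; rewrite /Pint.
have -> : Ac 0 p x = ((1 + x ^+ 2 * (p - 1))^-1)%:C.
  by rewrite /Ac fmorphV /=; congr (_^-1); apply: complex_ext => //=; rewrite mulr0 oppr0.
rewrite -(rmorph_nat (real_complex R)) -rmorphXn -rmorphM /=.
have h : 0 <= 1 + x ^+ 2 * (p - 1) by rewrite addr_ge0 ?mulr_ge0 ?sqr_ge0 ?subr_ge0.
have g : 0 <= 1 - x ^+ 2 by rewrite subr_ge0 exprn_ile1.
have hi : 0 <= (1 + x ^+ 2 * (p - 1))^-1 by rewrite invr_ge0.
by rewrite /wt; apply: mulr_ge0; apply: mulr_ge0 => //; apply: exprn_ge0.
Qed.

(** * Limit of the profile for large T *)

Section IntegralBounds.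
Context {R : realType}.
Implicit Types (f g : R -> R).

Lemma cont01Z a f : cont01 f -> cont01 (fun x : R => a * f x).
Proof. by move=> cf x; apply: continuousM; [exact: cst_continuous|exact: cf]. Qed.

Arguments cont01Z : clear implicits.
Arguments cont01Z a {f} _ _.

Lemma cont01D f g : cont01 f -> cont01 g -> cont01 (fun x : R => f x + g x).
Proof. by move=> cf cg x; apply: continuousD; [exact: cf|exact: cg]. Qed.

Lemma cont01B f g : cont01 f -> cont01 g -> cont01 (fun x : R => f x - g x).
Proof. by move=> cf cg x; apply: continuousB; [exact: cf|exact: cg]. Qed.

Lemma Int01B f g : cont01 f -> cont01 g -> Int01 (fun x => f x - g x) = Int01 f - Int01 g.
Proof.
move=> cf cg; have := Int01D cf (cont01Z (-1) cg); rewrite Int01Z // mulN1r => <-.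
by apply: Int01_eq => x _; rewrite mulN1r.
Qed.

Lemma Int01_norm_le_Int01 f g : cont01 f -> cont01 g ->
  (forall x : R, 0 <= x <= 1 -> `|f x| <= g x) -> `|Int01 f| <= Int01 g.
Proof.
move=> cf cg h; rewrite ler_norml -mulN1r -Int01Z //; apply/andP; split.
  apply: Int01_le => //; first exact: cont01Z.
  by move=> x /h; rewrite ler_norml mulN1r => /andP[].
by apply: Int01_le => // x /h; rewrite ler_norml => /andP[].
Qed.

End IntegralBounds.

Arguments cont01Z {R} a {f} _ _.

Section LargeArgumentLimit.
Context {R : realType}.
Local Notation Half := (2^-1 : R).

(** The value of |A|^2 at p = 1, and an upper bound for |A|^2 when p >= 1 ([nrm2_A_le]). Its
    integral over the unit interval is explicit: arctan(T)/T. *)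
Definition Lz (T x : R) : R := (1 + x ^+ 2 * T ^+ 2)^-1.

Lemma Lz_den (T x : R) : 0 < 1 + x ^+ 2 * T ^+ 2.
Proof. by rewrite ltr_wpDr // mulr_ge0 ?sqr_ge0. Qed.

Lemma Lz_ge0 (T x : R) : 0 <= Lz T x.
Proof. by rewrite invr_ge0 ltW // Lz_den. Qed.

Lemma derivable_Lz (T x : R) : derivable (Lz T) x 1.
Proof.
have n0 : 1 + x ^+ 2 * T ^+ 2 != 0 by rewrite (gt_eqF (Lz_den T x)).
by have [d _] := is_derive_quadratic 1 (T ^+ 2) x; 
exact: (@derivableV _ _ (fun x : R => 1 + x ^+ 2 * T ^+ 2) x 1 n0 d).
Qed.

Lemma cont01_Lz (T : R) : cont01 (Lz T).
Proof. by apply: derivable_cont01 => x _; exact: derivable_Lz. Qed.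

Lemma cont01_xLz (T : R) : cont01 (fun x => x * Lz T x).
Proof.
apply: derivable_cont01 => x _; apply: derivableM; first exact: derivable_id.
exact: derivable_Lz.
Qed.

Lemma Int01_Lz (T : R) : Int01 (fun x => T * Lz T x) = atan T.
Proof.
have H (x : R) : 0 <= x <= 1 -> is_derive x 1 (fun x : R => atan (T * x)) (T * Lz T x).
  move=> _.
  have H1 : is_derive x (1 : R) (fun x : R => T * x) T.
    have := is_derive_affine 0 T x; rewrite (_ : (fun _ => _) = (fun x : R => T * x)) //.
    by apply/funext => u; rewrite add0r.
  have H2 := is_derive1_atan (T * x).
  apply: (is_derive_eq (is_derive1_comp H2 H1)).
  rewrite /Lz exprMn [T ^+ 2 * _]mulrC /GRing.scale /=; exact: mulrC.
by rewrite (Int01_FTC H (cont01Z T (@cont01_Lz T))) mulr1 mulr0 atan0 subr0.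
Qed.

Definition mLz (T : R) : R := Int01 (fun x => x * Lz T x).

(** From x T <= e (1 + x^2 T^2) + 1/(4e), the integrand T x [Lz] is at most e + [Lz]/(4e), and the
    integral of [Lz] is at most (pi/2)/T. With e free, this shows that T [mLz] tends to 0 without a
    logarithm. *)
Lemma mLz_le (e T : R) : 0 < e -> 0 < T -> T * mLz T <= e + (pi / 2) / (4 * e * T).
Proof.
move=> e0 T0; rewrite /mLz -Int01Z; last exact: cont01_xLz.
apply: (@le_trans _ _ (e + (4 * e * T)^-1 * atan T)); last first.
  rewrite lerD2l mulrC ler_wpM2r ?invr_ge0 ?mulr_ge0 ?(ltW e0) ?(ltW T0) //.
  by rewrite ltW // atan_ltpi2.
have cc : cont01 (fun=> e) by apply: derivable_cont01 => x _; exact: derivable_cst.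
have cL : cont01 (fun x => (4 * e * T)^-1 * (T * Lz T x)).
  by do 2 apply: cont01Z; exact: cont01_Lz.
have -> : e + (4 * e * T)^-1 * atan T = Int01 (fun x => e + (4 * e * T)^-1 * (T * Lz T x)).
  rewrite (Int01D cc cL) Int01_cst Int01Z ?Int01_Lz //.
  by apply: cont01Z; exact: cont01_Lz.
apply: Int01_le.
- by apply: cont01Z; exact: cont01_xLz.
- exact: (cont01D cc cL).
move=> x _; have d0 := Lz_den T x.
rewrite /Lz -subr_ge0.
have -> : e + (4 * e * T)^-1 * (T * (1 + x ^+ 2 * T ^+ 2)^-1) - T * (x * (1 + x ^+ 2 * T ^+ 2)^-1)
  = ((2 * e * (x * T) - 1) ^+ 2 + 4 * e ^+ 2) / (4 * e) * (1 + x ^+ 2 * T ^+ 2)^-1.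
  by field; rewrite exprMn !gt_eqF.
have e4 : 0 <= (4 * e)^-1 by rewrite invr_ge0 mulr_ge0 // ltW.
apply: mulr_ge0; last by rewrite invr_ge0 ltW.
apply: mulr_ge0 => //; apply: addr_ge0; first exact: sqr_ge0.
by apply: mulr_ge0 => //; exact: sqr_ge0.
Qed.

Lemma limit_rate (M e : R) : 0 < M -> 0 < e -> exists2 T0 : R, 1 <= T0 &
  forall T p : R, T0 <= T -> 1 <= p -> p <= M * T -> 2 / T + (p + 2) * mLz T <= e.
Proof.
move=> M0 e0; pose d := e / (2 * (M + 2)).
have M2 : 0 < M + 2 by rewrite addr_gt0.
have d0 : 0 < d by rewrite divr_gt0 ?mulr_gt0.
have pi0 : 0 < pi / 2 :> R by rewrite divr_gt0 ?pi_gt0.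
pose B := 2 + (M + 2) * (pi / 2 / (4 * d)).
have B0 : 0 < B.
  apply: addr_gt0 => //; apply: mulr_gt0 => //; apply: divr_gt0 => //.
  by rewrite mulr_gt0.
have Be : 0 <= 2 * B / e by rewrite divr_ge0 ?mulr_ge0 ?(ltW B0) ?(ltW e0).
exists (1 + 2 * B / e); first by rewrite lerDl.
move=> T p hT p1 pM.
have T1 : 1 <= T by apply: le_trans hT; rewrite lerDl.
have T0 : 0 < T := lt_le_trans ltr01 T1.
have m0 : 0 <= mLz T.
  by apply: Int01_ge0 => x /andP[x0 _]; rewrite mulr_ge0 ?Lz_ge0.
apply: (@le_trans _ _ (2 / T + (M + 2) * (T * mLz T))).
  rewrite lerD2l mulrA ler_wpM2r // mulrDl lerD // ler_peMr //.
apply: (@le_trans _ _ (2 / T + (M + 2) * (d + pi / 2 / (4 * d * T)))).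
  by rewrite lerD2l ler_wpM2l ?(ltW M2) // mLz_le.
have -> : 2 / T + (M + 2) * (d + pi / 2 / (4 * d * T)) = (M + 2) * d + B / T.
  by rewrite /B; move: (pi / 2) => q; field; rewrite !gt_eqF.
have -> : (M + 2) * d = e / 2 by rewrite /d; field; rewrite gt_eqF.
have : B / T <= e / 2.
  rewrite ler_pdivrMr // mulrC mulrA ler_pdivlMr // [B * 2]mulrC -ler_pdivrMr //.
  by apply: le_trans hT; rewrite lerDr.
by move: (B / T) => b hb; lra.
Qed.

Section ABounds.
Variables (T p x : R).
Hypotheses (T0 : 0 < T) (p1 : 1 <= p) (x01 : 0 <= x <= 1).

Lemma hp_half : Half < p.
Proof. by apply: lt_le_trans p1; rewrite invf_lt1 ?ltr1n. Qed.

Lemma ReY_ge1 : 1 <= complex.Re (Yc T p x).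
Proof. by rewrite /= lerDl mulr_ge0 ?sqr_ge0 ?subr_ge0. Qed.

Lemma nrm2_Y_ge : 1 + x ^+ 2 * T ^+ 2 <= nrm2 (Yc T p x).
Proof.
by rewrite /nrm2 /= sqrrN exprMn lerD2r; apply: exprn_ege1; exact: ReY_ge1.
Qed.

Lemma nrm2_A_le : nrm2 (Ac T p x) <= Lz T x.
Proof.
rewrite /Ac nrm2V lef_pV2 ?posrE ?nrm2_Y_ge ?Lz_den //.
exact: lt_le_trans (Lz_den T x) nrm2_Y_ge.
Qed.

Lemma nrm_A_le1 : nrm (Ac T p x) <= 1.
Proof.
rewrite /nrm -sqrtr1 ler_wsqrtr //; apply: le_trans nrm2_A_le _.
by rewrite /Lz invf_le1 ?Lz_den // lerDl mulr_ge0 ?sqr_ge0.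
Qed.

Lemma x_nrm_A_le : x * nrm (Ac T p x) <= T^-1.
Proof.
have /andP[x0 _] := x01; have T0' := T0.
rewrite -(@ler_pXn2r _ 2) ?nnegrE ?mulr_ge0 ?nrm_ge0 ?invr_ge0 ?(ltW T0') //.
rewrite exprMn sqr_sqrtr ?nrm2_ge0 //.
apply: (@le_trans _ _ (x ^+ 2 * Lz T x)); first by rewrite ler_wpM2l ?sqr_ge0 ?nrm2_A_le.
rewrite /Lz ler_pdivrMr ?Lz_den // exprVn mulrDr mulr1 mulrCA mulVf ?mulr1 ?lerDr ?invr_ge0 ?sqr_ge0 //.
by rewrite expf_neq0 // gt_eqF.
Qed.

Lemma wt01 N : 0 <= (1 - x ^+ 2) ^+ N <= 1.
Proof.
have /andP[x0 x1] := x01.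
have h0 : 0 <= 1 - x ^+ 2 by rewrite subr_ge0 exprn_ile1.
by rewrite exprn_ge0 //= exprn_ile1 // gerBl sqr_ge0.
Qed.

Lemma Pint_le_nrm N c m : nrm c = 1 -> `|Pint N c 1 m T p x| <= x * nrm (Ac T p x) ^+ m.
Proof.
move=> c1; have /andP[x0 _] := x01; have /andP[w0 w1] := wt01 N.
rewrite /Pint /wt expr1 normrM normrM (ger0_norm x0) (ger0_norm w0) -mulrA.
rewrite ler_wpM2l // -[leRHS]mul1r ler_pM //.
by apply: le_trans (Re_le_nrm _) _; rewrite nrmM nrmX c1 mul1r.
Qed.

Lemma Pint_le_T N c m : nrm c = 1 -> `|Pint N c 1 m.+1 T p x| <= T^-1.
Proof.
move=> c1; apply: le_trans (Pint_le_nrm N m.+1 c1) _.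
rewrite exprS mulrA; apply: le_trans x_nrm_A_le.
have /andP[x0 _] := x01.
by rewrite ler_piMr ?mulr_ge0 ?nrm_ge0 // exprn_ile1 ?nrm_ge0 // nrm_A_le1.
Qed.

Lemma Pint_le_Lz N c m : nrm c = 1 -> `|Pint N c 1 m.+2 T p x| <= x * Lz T x.
Proof.
move=> c1; apply: le_trans (Pint_le_nrm N m.+2 c1) _.
have /andP[x0 _] := x01.
rewrite ler_wpM2l // -addn2 exprD; apply: le_trans nrm2_A_le.
rewrite sqr_sqrtr ?nrm2_ge0 // ler_piMl ?nrm2_ge0 // exprn_ile1 ?nrm_ge0 //.
exact: nrm_A_le1.
Qed.

End ABounds.

Lemma nrmNi : nrm (- 'i : R[i]) = 1.
Proof. by rewrite /nrm /nrm2 /= oppr0 expr0n sqrrN expr1n add0r sqrtr1. Qed.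

End LargeArgumentLimit.

Section ExtremalLimit.
Context {R : realType}.
Local Notation Half := (2^-1 : R).
Implicit Types (T p x : R).

Lemma Fint_succ N T p x : Half < p -> 0 <= x <= 1 ->
  Fint N.+1 T p x - Fint N T p x =
  (1 - x ^+ 2) ^+ N * complex.Im (Ac T p x ^+ N.+2 * (- (x * p) +i* T)).
Proof.
move=> hp x01; have Y0 := Y_neq0 T hp x01; have [->|x0] := eqVneq x 0.
  rewrite !Fint0 Ac0 expr1n mul1r /= expr0n subr0 expr1n mul1r.
  by rewrite -[N.+2%:R]natr1; ring.
apply: (mulfI x0); rewrite mulrBr !Fint_mul //.
have -> : Ac T p x ^+ N.+1 = Yc T p x * Ac T p x ^+ N.+2.
  by rewrite [in RHS]exprS mulrA /Ac mulfV // mul1r.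
rewrite [(1 - x ^+ 2) ^+ N.+1]exprS /Yc.
move: (Ac T p x ^+ N.+2) ((1 - x ^+ 2) ^+ N) => E g.
by rewrite !ReImE /=; ring.
Qed.

(** For [N] = 0 the integrand is T/|Y|^2, and the difference with its value at p = 1 is a rational
    expression; the inequality reduces to a square plus a nonnegative term. *)
Lemma Fint_base T p x : 0 < T -> 1 <= p -> 0 <= x <= 1 ->
  `|Fint 0 T p x - T * Lz T x| <= (p - 1) * (x * Lz T x).
Proof.
move=> T0 p1 x01; have /andP[x0 x1] := x01; have hp := hp_half p1.
have d0 := Lz_den T x.
set q := x ^+ 2 * (p - 1).
have q0 : 0 <= q by rewrite mulr_ge0 ?sqr_ge0 ?subr_ge0.
have n0 : 0 < nrm2 (Yc T p x) := lt_le_trans d0 (nrm2_Y_ge T x p1).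
have nE : nrm2 (Yc T p x) = (1 + q) ^+ 2 + x ^+ 2 * T ^+ 2.
  by rewrite /nrm2 /= sqrrN exprMn.
have FE : Fint 0 T p x = T / nrm2 (Yc T p x).
  rewrite /Fint /Sc /Bc expr0 mul1r big_ord1 !expr0 !mulr1 [Ac _ _ _ * _]mulrC ReZ /Ac ReV.
  have q1 : 0 < 1 + q by rewrite ltr_wpDr.
  move: n0; rewrite nE /= -/q sqrrN exprMn => n0.
  by field; rewrite exprMn !gt_eqF.
have L0 := Lz_ge0 T x.
have E : T * Lz T x - Fint 0 T p x = T * (q * (2 + q)) / nrm2 (Yc T p x) * Lz T x.
  rewrite FE /Lz; move: n0; rewrite nE => n0.
  by field; rewrite exprMn !gt_eqF.
rewrite distrC E ger0_norm; last first.
  apply: mulr_ge0 => //; apply: divr_ge0; last exact: ltW.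
  by rewrite mulr_ge0 ?(ltW T0) // mulr_ge0 // addr_ge0.
rewrite [leRHS]mulrA ler_wpM2r // ler_pdivrMr // nE -subr_ge0.
have -> : (p - 1) * x * ((1 + q) ^+ 2 + x ^+ 2 * T ^+ 2) - T * (q * (2 + q)) =
    (p - 1) * x * ((1 + q - x * T) ^+ 2 + x * T * q) by rewrite /q; ring.
apply: mulr_ge0; first by rewrite mulr_ge0 ?subr_ge0.
by apply: addr_ge0; [exact: sqr_ge0|apply: mulr_ge0 => //; apply: mulr_ge0 => //; exact: ltW].
Qed.

Lemma Fext0_base T p : 0 < T -> 1 <= p ->
  `|Fext0 0 T p - atan T| <= (p + 2) * mLz T.
Proof.
move=> T0 p1; have hp := hp_half p1.
have cF := @Fint_cont R 0 T p hp; have cL := cont01Z T (@cont01_Lz R T).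
rewrite -Int01_Lz -(Int01B cF cL) -Int01Z; last exact: cont01_xLz.
apply: Int01_norm_le_Int01; first exact: cont01B.
  by apply: cont01Z; exact: cont01_xLz.
move=> x x01; apply: le_trans (Fint_base T0 p1 x01) _.
apply: ler_wpM2r; last by lra.
by case/andP: x01 => x0 _; rewrite mulr_ge0 ?Lz_ge0.
Qed.

(** Increasing [N] changes the integrand by the imaginary part of (1 - x^2)^[N] A^(N+2) (i T - x p).
    The part with T is, up to lower order terms, the derivative of (1 - x^2)^[N] A^(N+1) divided by
    N + 1; its boundary value and the remaining terms are small because x |A| <= 1/T and x |A|^2 <=
    x [Lz]. *)
Lemma Fext0_step N T p : 0 < T -> 1 <= p ->
  `|Fext0 N.+1 T p - Fext0 N T p| <= 2 / T + (p + 2) * mLz T.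
Proof.
move=> T0 p1; have hp := hp_half p1.
pose m := N.+1.
have m0 : 0 < m%:R :> R by rewrite ltr0n.
pose r x : R := 2 * N%:R * Pint N.-1 (- 'i) 1 m T p x + m%:R * (p - 2) * Pint N (- 'i) 1 m.+1 T p x.
pose f x : R := Fint N.+1 T p x - Fint N T p x.
have cf : cont01 f by apply: cont01B; exact: Fint_cont.
have cr : cont01 r.
  by apply: cont01D; apply: cont01Z; exact: Pint_cont.
have cD : cont01 (fun x => m%:R * f x - r x) by apply: cont01B => //; exact: cont01Z.
(* [G] absorbs the term carrying the factor T, whose absolute value would not have a small integral;
   [r] is what remains after subtracting its derivative. *)
pose G (x : R) := (1 + x ^+ 2 * -1)%:C ^+ N * Ac T p x ^+ m.
have dG (x : R) : 0 <= x <= 1 ->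
    is_derive x 1 (fun x => complex.Im (G x)) (m%:R * f x - r x).
  move=> x01; have Y0 := Y_neq0 T hp x01.
  have H1 := is_cderX N (is_cder_real (is_derive_quadratic 1 (-1) x)).
  have H2 := is_cder_invX m Y0 (cder_Y_x T p x).
  have [_ H] := is_cderM H1 H2.
  apply: (is_derive_eq H); rewrite -/(Ac T p x).
  rewrite /f Fint_succ // /r /Pint /wt expr1 -!rmorphXn mulrN1 -/m.
  rewrite -(rmorph_nat (real_complex R) N) -(rmorph_nat (real_complex R) m).
  move: (Ac T p x ^+ m) (Ac T p x ^+ m.+1) => E E'.
  rewrite !ReImE /=.
  by move: ((1 - x ^+ 2) ^+ N) ((1 - x ^+ 2) ^+ N.-1) (m%:R) (N%:R) => *; ring.
have E : m%:R * (Fext0 N.+1 T p - Fext0 N T p) = complex.Im (G 1) + Int01 r.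
  have cF k : cont01 (Fint k T p) by exact: Fint_cont.
  rewrite /Fext0 -(Int01B (cF _) (cF _)) -Int01Z //.
  have -> : Int01 (fun x => m%:R * f x) = Int01 (fun x => (m%:R * f x - r x) + r x).
    by apply: Int01_eq => x _; rewrite subrK.
  rewrite (Int01D cD cr) (Int01_FTC dG cD); congr (_ + _).
  have -> : G 0 = 1 by rewrite /G Ac0 expr0n mul0r addr0 rmorph1 !expr1n mul1r.
  by rewrite subr0.
have I01 : 0 <= (1 : R) <= 1 by rewrite ler01 lexx.
have b1 : `|complex.Im (G 1)| <= T^-1.
  have := Pint_le_T T0 p1 I01 N (c := - 'i) N nrmNi.
  rewrite /Pint /wt expr1n mul1r (_ : _ * complex.Re _ = complex.Im (G 1)) //.
  rewrite /G -rmorphXn /= mulrN1 -/m expr1n; move: (Ac _ _ _ ^+ m) => A.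
  by rewrite !ReImE /=; ring.
have b2 : `|Int01 r| <= 2 * N%:R / T + m%:R * (p + 2) * mLz T.
  have cc : cont01 (fun=> 2 * N%:R / T) by apply: derivable_cont01 => x _; exact: derivable_cst.
  have cx := cont01Z (m%:R * (p + 2)) (@cont01_xLz R T).
  rewrite -[2 * N%:R / T]Int01_cst -(Int01Z _ (@cont01_xLz R T)) -(Int01D cc cx).
  apply: Int01_norm_le_Int01 => //; first exact: cont01D.
  move=> x x01; apply: le_trans (ler_normD _ _) _; apply: lerD.
    rewrite normrM ger0_norm ?mulr_ge0 // ler_wpM2l ?mulr_ge0 //.
    exact: (Pint_le_T T0 p1 x01 N.-1 N nrmNi).
  rewrite normrM; apply: ler_pM => //.
    rewrite normrM (ger0_norm (ltW m0)) ler_wpM2l ?(ltW m0) //.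
    by rewrite ler_norml; apply/andP; split; lra.
  exact: (@Pint_le_Lz R T p x p1 x01 N (- 'i) N nrmNi).
rewrite -(ler_pM2l m0) -[X in X * `|_|](ger0_norm (ltW m0)) -normrM E.
apply: le_trans (ler_normD _ _) _; apply: le_trans (lerD b1 b2) _.
have -> : m%:R * (2 / T + (p + 2) * mLz T) = 
   T^-1 + (2 * N%:R / T + m%:R * (p + 2) * mLz T) + T^-1.
  by rewrite /m -natr1; move: (mLz T) (T^-1) => *; ring.
by rewrite lerDl invr_ge0 ltW.
Qed.

(** Induction on [N]: the base case compares the profile with arctan T, and each step costs an error
    that vanishes uniformly in the sector p <= M T. The limit is therefore the same for all [N]. *)
Lemma Fext0_limit N (M e : R) : 0 < M -> 0 < e -> exists2 T0 : R, 1 <= T0 &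
  forall T p, T0 <= T -> 1 <= p -> p <= M * T -> `|Fext0 N T p - pi / 2| <= e.
Proof.
elim: N e => [|N IH] e M0 e0; have e2 : 0 < e / 2 by rewrite divr_gt0.
  have [T0 T01 h] := limit_rate M0 e2.
  have /cvgrPdist_le/(_ _ e2) [A [_ hA]] := @cvgy_atan R.
  exists (Num.max T0 (A + 1)); first by rewrite le_max T01.
  move=> T p; rewrite ge_max => /andP[TT0 TA] p1 pM.
  have T1 := le_trans T01 TT0.
  have tp : 0 < T := lt_le_trans ltr01 T1.
  have -> : Fext0 0 T p - pi / 2 = (Fext0 0 T p - atan T) - (pi / 2 - atan T).
    by rewrite opprB addrA subrK.
  apply: le_trans (ler_normB _ _) _; rewrite [e]splitr; apply: lerD.
    apply: le_trans (Fext0_base tp p1) _; apply: le_trans (h T p TT0 p1 pM).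
    by rewrite lerDr divr_ge0 // ltW.
  by apply: hA; apply: lt_le_trans TA; rewrite ltrDl.
have [T0 T01 h] := limit_rate M0 e2.
have [T2 _ h2] := IH _ M0 e2.
exists (Num.max T0 T2); first by rewrite le_max T01.
move=> T p; rewrite ge_max => /andP[TT0 TT2] p1 pM.
have tp : 0 < T := lt_le_trans ltr01 (le_trans T01 TT0).
have -> : Fext0 N.+1 T p - pi / 2 = (Fext0 N.+1 T p - Fext0 N T p) + (Fext0 N T p - pi / 2).
  by rewrite addrA subrK.
apply: le_trans (ler_normD _ _) _; rewrite [e]splitr; apply: lerD.
  by apply: le_trans (Fext0_step N tp p1) (h T p TT0 p1 pM).
exact: h2.
Qed.

Lemma Fext0_odd N T p : Half < p -> Fext0 N (- T) p = - Fext0 N T p.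
Proof.
move=> hp; have := Int01Z (-1) (@Fint_cont R N T p hp); rewrite mulN1r => <-.
apply: Int01_eq => x x01; rewrite mulN1r; have [->|x0] := eqVneq x 0.
  by rewrite !Fint0 mulrN.
rewrite !Fint_neq0 // -!mulrN; congr (_ * (_ * _)).
have -> : Ac (- T) p x = cj (Ac T p x).
  rewrite /Ac cjV; congr (_^-1); rewrite /Yc; apply: complex_ext; rewrite !ReImE //=.
  by rewrite mulrN.
by rewrite -cjX ImJ.
Qed.

Lemma Fext0_homo N T T' p : 0 <= T -> T <= T' -> 1 <= p -> Fext0 N T p <= Fext0 N T' p.
Proof.
move=> T0 TT' p1; have hp := hp_half p1.
have H x : is_derive x (1 : R) (Fext0 N ^~ p) (Pfam N N.+1%:R 0 N.+2 x p).
  exact: Fext0_derive_T.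
have cF : {within `[T, T'], continuous (Fext0 N ^~ p)}.
  by apply: derivable_within_continuous => x _; case: (H x).
have [x xin E] := MVT_segment TT' (fun x _ => H x) cF.
move: xin; rewrite in_itv /= => /andP[Tx _]; rewrite -subr_ge0 E mulr_ge0 ?subr_ge0 //.
by apply: Pfam_ge0 => //; exact: le_trans Tx.
Qed.

(** For fixed p the profile is 0 at T = 0 by oddness, increases for T >= 0, and has limit pi/2. *)
Lemma Fext0_bounds N T p : 0 <= T -> 1 <= p -> 0 <= Fext0 N T p <= pi / 2.
Proof.
move=> T0 p1; have hp := hp_half p1; apply/andP; split.
  apply: le_trans (Fext0_homo N (lexx 0) T0 p1).
  by have := Fext0_odd N 0 hp; rewrite oppr0 => /eqP; rewrite -addr_eq0 -mulr2n mulrn_eq0 /= => /eqP ->.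
apply/ler_addgt0Pr => e e0.
have [T1 _ h] := Fext0_limit N (lt_le_trans ltr01 p1) e0.
(* With M = p the sector condition p <= M T' holds because T' >= 1. *)
pose T' := Num.max T (Num.max T1 1).
have : `|Fext0 N T' p - pi / 2| <= e.
  apply: h => //; first by rewrite /T' !le_max lexx orbT.
  by rewrite ler_peMr ?(le_trans ler01) // /T' !le_max lexx !orbT.
rewrite ler_norml => /andP[_]; rewrite lerBlDl => h'; apply: le_trans h'.
by apply: Fext0_homo => //; rewrite /T' le_max lexx.
Qed.

End ExtremalLimit.

(** * Composition of a profile with two functions on the ball *)

Section TwoVariableChain.
Context {R : realType} {n : nat}.
Variables (D : set (Cn R n)) (t p : Cn R n -> R).
Hypotheses (oD : open D) (Ct : C2 D t) (Cp : C2 D p) (pD : forall z, D z -> 2^-1 < p z).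

Let phi (w : Cn R n) : Cn R 1 := (\row__ t w, \row__ p w).

Let phi1 w : (phi w).1 0 0 = t w. Proof. by rewrite mxE. Qed.
Let phi2 w : (phi w).2 0 0 = p w. Proof. by rewrite mxE. Qed.

Lemma phi_Dp z : D z -> Dp (phi z).
Proof. by move=> Dz; rewrite /Dp /= phi2; exact: pD. Qed.

Lemma phi_C2 d : C2 D (fun w => cdir d (phi w)).
Proof.
case: d => j; rewrite [j]ord1.
  by rewrite (_ : (fun _ => _) = t) //; apply/funext => w; exact: phi1.
by rewrite (_ : (fun _ => _) = p) //; apply/funext => w; exact: phi2.
Qed.

Lemma two_var_lift G : (fun w => G (t w) (p w)) = liftR G \o phi.
Proof. by apply/funext => w; rewrite /liftR /= phi1 phi2. Qed.

Lemma two_var_C2 G : C2 Dp (liftR G : Cn R 1 -> R) -> C2 D (fun w => G (t w) (p w)).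
Proof.
by move=> CG; rewrite two_var_lift; exact: (C2_comp_gen oD open_Dp phi_Dp phi_C2 CG).
Qed.

Variables (G GT Gp : R -> R -> R).
Hypothesis CG : C1 Dp (liftR G : Cn R 1 -> R).
Hypothesis HT : forall T p : R, 2^-1 < p -> is_derive T 1 (G ^~ p) (GT T p).
Hypothesis Hp : forall T p : R, 2^-1 < p -> is_derive p 1 (G T) (Gp T p).

Let H w := G (t w) (p w).

Lemma two_var_C1 : C1 D H.
Proof.
rewrite /H two_var_lift.
exact: (C1_comp oD open_Dp phi_Dp (fun d => (phi_C2 d).1) CG).
Qed.

Lemma two_var_derive z v : D z ->
  'D_v H z = GT (t z) (p z) * 'D_v t z + Gp (t z) (p z) * 'D_v p z.
Proof.
move=> Dz; rewrite /H two_var_lift.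
have [_ ->] := is_derive_comp_Cn oD open_Dp phi_Dp (fun d => (phi_C2 d).1) v CG Dz.
rewrite big_sumType /= !big_ord1.
have Hu := pD Dz; rewrite -(phi2 z) in Hu.
have [_ E1] := is_derive_liftR (inl ord0) (HT ((phi z).1 0 0) Hu) (Hp ((phi z).1 0 0) Hu).
have [_ E2] := is_derive_liftR (inr ord0) (HT ((phi z).1 0 0) Hu) (Hp ((phi z).1 0 0) Hu).
rewrite E1 E2 phi1 phi2 [_ * GT _ _]mulrC [_ * Gp _ _]mulrC.
congr (_ * _ + _ * _).
  by congr ('D_v _ z); apply/funext => w; rewrite mxE.
by congr ('D_v _ z); apply/funext => w; rewrite mxE.
Qed.

Lemma two_var_Cderive z v : D z -> Cderive v (creal H) z =
  (GT (t z) (p z))%:C * Cderive v (creal t) z + (Gp (t z) (p z))%:C * Cderive v (creal p) z.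
Proof.
move=> Dz; rewrite !Cderive_creal two_var_derive //.
by apply: complex_ext; rewrite !ReImE /=; ring.
Qed.

Lemma two_var_dz z j : D z -> dz j (creal H) z =
  (GT (t z) (p z))%:C * dz j (creal t) z + (Gp (t z) (p z))%:C * dz j (creal p) z.
Proof. by move=> Dz; rewrite !dzE !two_var_Cderive // Wdz_M. Qed.

Lemma two_var_dzbar z j : D z -> dzbar j (creal H) z =
  (GT (t z) (p z))%:C * dzbar j (creal t) z + (Gp (t z) (p z))%:C * dzbar j (creal p) z.
Proof. by move=> Dz; rewrite !dzbarE !two_var_Cderive // Wdzbar_M. Qed.

End TwoVariableChain.

Section TwoVariableHessian.
Context {R : realType} {n : nat}.
Variables (D : set (Cn R n)) (t p : Cn R n -> R).
Hypotheses (oD : open D) (Ct : C2 D t) (Cp : C2 D p) (pD : forall z, D z -> 2^-1 < p z).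
Variables (G GT Gp GTT GTp GpT Gpp : R -> R -> R).
Hypotheses (CG : C1 Dp (liftR G : Cn R 1 -> R)) (CGT : C1 Dp (liftR GT : Cn R 1 -> R))
  (CGp : C1 Dp (liftR Gp : Cn R 1 -> R)).
Hypothesis HT : forall T p : R, 2^-1 < p -> is_derive T 1 (G ^~ p) (GT T p).
Hypothesis Hp : forall T p : R, 2^-1 < p -> is_derive p 1 (G T) (Gp T p).
Hypothesis HTT : forall T p : R, 2^-1 < p -> is_derive T 1 (GT ^~ p) (GTT T p).
Hypothesis HTp : forall T p : R, 2^-1 < p -> is_derive p 1 (GT T) (GTp T p).
Hypothesis HpT : forall T p : R, 2^-1 < p -> is_derive T 1 (Gp ^~ p) (GpT T p).
Hypothesis Hpp : forall T p : R, 2^-1 < p -> is_derive p 1 (Gp T) (Gpp T p).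

Lemma two_var_hess z i j : D z ->
  dz i (dzbar j (creal (fun w => G (t w) (p w)))) z =
  (GT (t z) (p z))%:C * dz i (dzbar j (creal t)) z +
  dzbar j (creal t) z * ((GTT (t z) (p z))%:C * dz i (creal t) z + (GTp (t z) (p z))%:C * dz i (creal p) z) +
  ((Gp (t z) (p z))%:C * dz i (dzbar j (creal p)) z +
  dzbar j (creal p) z * ((GpT (t z) (p z))%:C * dz i (creal t) z + (Gpp (t z) (p z))%:C * dz i (creal p) z)).
Proof.
move=> Dz.
have E w : D w -> dzbar j (creal (fun w => G (t w) (p w))) w =
    creal (fun w => GT (t w) (p w)) w * dzbar j (creal t) w +
    creal (fun w => Gp (t w) (p w)) w * dzbar j (creal p) w.
  by move=> Dw; rewrite (two_var_dzbar oD Ct Cp pD CG HT Hp j Dw).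
have cT := CC1_real (two_var_C1 oD Ct Cp pD CGT).
have cp := CC1_real (two_var_C1 oD Ct Cp pD CGp).
have ct' := CC1_dzbar_creal j oD Ct; have cp' := CC1_dzbar_creal j oD Cp.
rewrite (eq_on_dz oD Dz i E) (dzD oD Dz i (CC1_M oD cT ct') (CC1_M oD cp cp')).
rewrite (dzM oD Dz i cT ct') (dzM oD Dz i cp cp').
by rewrite (two_var_dz oD Ct Cp pD CGT HTT HTp i Dz) (two_var_dz oD Ct Cp pD CGp HpT Hpp i Dz).
Qed.

End TwoVariableHessian.

(** * The metric pairing of covectors *)

Section BallMetricBracket.
Context {R : realType} {n : nat}.
Variable j0 : 'I_n.
Variable z : Cn R n.
Local Notation zc := (zcoord z).
Local Notation s := (\sum_k zc k * cj (zc k)).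

Lemma sum_delta (F : 'I_n -> R[i]) j : \sum_i (i == j)%:R * F i = F j.
Proof.
rewrite (bigD1 j) //= eqxx mul1r big1 ?addr0 // => i ij.
by rewrite (negbTE ij) mul0r.
Qed.

(** The unnormalized Bergman pairing of a (1,0)-covector with a (0,1)-covector; it supplies the
    first order products in the chain rule for [LB]. *)
Definition bracket (a b : 'I_n -> R[i]) : R[i] :=
  \sum_i \sum_j ((i == j)%:R - zc i * cj (zc j)) * (a i * b j).

Lemma bracketE a b : bracket a b =
  \sum_i a i * b i - (\sum_i a i * zc i) * (\sum_j b j * cj (zc j)).
Proof.
rewrite mulr_suml -sumrB; apply: eq_bigr => i _.
under eq_bigr do rewrite mulrBl.
rewrite sumrB; congr (_ - _).
  under eq_bigr do rewrite eq_sym.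
  by rewrite (sum_delta (fun j => a i * b j)).
rewrite mulr_sumr; apply: eq_bigr => j _.
by move: (a i) (b j) (zc i) (cj (zc j)) => *; ring.
Qed.

(** All first derivatives occurring below are combinations of a basis covector and the covector of
    conj(z) or z, so this single formula evaluates every pairing. *)
Lemma bracket_affine (l m l' m' : R[i]) :
  bracket (fun i => l * (i == j0)%:R + m * cj (zc i)) (fun j => l' * (j == j0)%:R + m' * zc j) =
  l * l' * (1 - zc j0 * cj (zc j0)) + l * m' * (1 - s) * zc j0 +
  m * l' * (1 - s) * cj (zc j0) + m * m' * s * (1 - s).
Proof.
have E1 (F : 'I_n -> R[i]) (u v : R[i]) (g : 'I_n -> R[i]) :
    \sum_i (u * (i == j0)%:R + v * g i) * F i = u * F j0 + v * \sum_i g i * F i.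
  rewrite -[F j0 in RHS]sum_delta !mulr_sumr -big_split; apply: eq_bigr => i _ /=.
  by move: (_ == _)%:R (F i) (g i) => *; ring.
have sE : \sum_i cj (zc i) * zc i = s by apply: eq_bigr => i _; rewrite mulrC.
rewrite bracketE !E1 sE eqxx.
under [X in _ + m * X - _]eq_bigr do rewrite mulrC.
rewrite E1 -[true%:R]/(1 : R[i]); move: s (zc j0) (cj (zc j0)) => S a b; ring.
Qed.

Lemma bracket_trace (c : R[i]) :
  \sum_i \sum_j ((i == j)%:R - zc i * cj (zc j)) * (c * (i == j)%:R) = c * (n%:R - s).
Proof.
rewrite mulrBr mulr_sumr -[n in n%:R]card_ord -[#|_|%:R]sumr_const mulr_sumr -sumrB.
apply: eq_bigr => i _.
rewrite (bigD1 i) //= eqxx big1 ?addr0 => [|j ji].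
  rewrite -[true%:R]/(1 : R[i]); move: (zc i) (cj (zc i)) => *; ring.
by rewrite eq_sym (negbTE ji) mulr0 mulr0.
Qed.

Lemma bracket_delta (c : R[i]) :
  \sum_i \sum_j ((i == j)%:R - zc i * cj (zc j)) * (c * ((i == j0)%:R * (j == j0)%:R)) =
  c * (1 - zc j0 * cj (zc j0)).
Proof.
have := bracket_affine c 0 1 0; rewrite /bracket !mul0r !mulr0 !mul0r !addr0 mulr1 => <-.
apply: eq_bigr => i _; apply: eq_bigr => j _; congr (_ * _).
by rewrite !mul0r !addr0 mul1r mulrA.
Qed.

End BallMetricBracket.

(** * The two variables of the extremal function *)

Section ExtremalVariables.
Context {R : realType} {n : nat}.
Variable j0 : 'I_n.
Local Notation B := (Bn R n).
Let oB : open B := open_Bn.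
Local Notation zc := zcoord.

(** [tvar] is odd in Re z_1 and large near the sphere when Re z_1 is bounded away from 0; [pvar] is
    at least 1, and equal to 1 on the complex line of the coordinate [j0]. Their ratio [pvar]/[tvar]
    is at most 1/(2 Re z_1), which is what puts boundary points in a sector p <= M T. *)
Definition rad (z : Cn R n) : R := (1 - sqnorm z)^-1.
Definition tvar (z : Cn R n) : R := 2 * z.1 0 j0 * rad z.
Definition pvar (z : Cn R n) : R := (1 - nrm2 (zc z j0)) * rad z.

Lemma rad_den z : B z -> 0 < 1 - sqnorm z.
Proof. by move=> /BnP z1; rewrite subr_gt0. Qed.

Lemma rad_gt0 z : B z -> 0 < rad z.
Proof. by move=> Bz; rewrite invr_gt0 rad_den. Qed.

Lemma nrm2_le_sqnorm (z : Cn R n) k : nrm2 (zc z k) <= sqnorm z.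
Proof.
rewrite sqnorm_nrm2 (bigD1 k) //= lerDl.
by apply: sumr_ge0 => i _; exact: nrm2_ge0.
Qed.

Lemma pvar_ge1 z : B z -> 1 <= pvar z.
Proof.
move=> Bz; rewrite /pvar /rad ler_pdivlMr ?rad_den // mul1r lerD2l lerN2.
exact: nrm2_le_sqnorm.
Qed.

Lemma pvar_half z : B z -> 2^-1 < pvar z.
Proof. by move=> /pvar_ge1; exact: hp_half. Qed.

Lemma C2_V (D : set (Cn R n)) (f : Cn R n -> R) : open D -> C2 D f ->
  (forall w, D w -> f w != 0) -> C2 D (fun w => (f w)^-1).
Proof.
move=> oD [f1 f2] f0; have V := C1_V oD f1 f0.
split=> [|d]; first exact: V.
apply: (eq_on_C1 oD _ (C1_M oD (C1_N oD (C1_M oD V V)) (f2 d))) => w Dw.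
have [df _] := C1_is_derive (edir d) oD f1 Dw.
rewrite (@deriveV _ _ f w (edir d) (f0 w Dw) df) /GRing.scale /= expr2 invfM mulNr.
exact: erefl.
Qed.

Lemma C2_rad : C2 B rad.
Proof.
apply: (C2_V oB) => [|w Bw]; last by rewrite gt_eqF // rad_den.
have := C2_D oB (C2_cst 1 oB) (C2_Z (-1) oB C2_sqnorm).
rewrite (_ : (fun w => _ + _) = (fun w => 1 - sqnorm w)) //.
by apply/funext => w; rewrite mulN1r.
Qed.

Lemma C2_tvar : C2 B tvar.
Proof. exact: (C2_M oB (C2_Z 2 oB (C2_cdir (inl j0) oB)) C2_rad). Qed.

Lemma C2_pvar : C2 B pvar.
Proof.
have cx := C2_cdir (inl j0) oB; have cy := C2_cdir (inr j0) oB.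
have := C2_M oB (C2_D oB (C2_cst 1 oB) (C2_Z (-1) oB (C2_D oB (C2_M oB cx cx) (C2_M oB cy cy)))) C2_rad.
rewrite (_ : (fun w => _ * rad w) = pvar) //.
by apply/funext => w; rewrite /pvar /nrm2 /= !expr2 mulN1r.
Qed.

(* [tvar] and [pvar] are both of the form [f / (1 - |z|^2)] with the mixed
   derivatives of [f] constant. *)
Section Quotient.
Variables (q : Cn R n -> R) (f : Cn R n -> R[i]) (b : 'I_n -> Cn R n -> R[i])
  (c : 'I_n -> 'I_n -> R[i]).
Hypotheses (Cq : C2 B q) (qE : forall z, B z -> (q z)%:C = f z * (rad z)%:C).
Hypotheses (Cf : CC1 B f) (Cb : forall j, CC1 B (b j)).
Hypothesis dbf : forall j z, B z -> dzbar j f z = b j z.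
Hypothesis db : forall i j z, B z -> dz i (b j) z = c i j.

Lemma CC1_radC : CC1 B (fun w => (rad w)%:C).
Proof. exact: (CC1_real C2_rad.1). Qed.

Lemma CC1_den : CC1 B (fun w => 1 - \sum_k zc w k * cj (zc w k)).
Proof.
have Cs : CC1 B (fun w => \sum_k zc w k * cj (zc w k)).
  apply: (CC1_sum _ _ oB) => k.
  exact: (CC1_M oB (CC1_coord k oB) (CC1_J oB (CC1_coord k oB))).
exact: (CC1_D oB (@CC1_cst R n B 1) (CC1_N oB Cs)).
Qed.

Lemma radC w : (rad w)%:C = (1 - \sum_k zc w k * cj (zc w k))^-1.
Proof. by rewrite /rad -sqnormC fmorphV rmorphB rmorph1. Qed.

Lemma den_neq0 w : B w -> 1 - \sum_k zc w k * cj (zc w k) != 0.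
Proof.
move=> Bw; rewrite -sqnormC -[1]/(1%:C) -rmorphB fmorph_eq0 gt_eqF // rad_den //.
Qed.

Lemma dzbar_rad j z : B z -> dzbar j (fun w => (rad w)%:C) z = zc z j * (rad z)%:C ^+ 2.
Proof.
move=> Bz.
have Ck k : CC1 B (fun w => zc w k) := CC1_coord k oB.
have Cs : CC1 B (fun w => \sum_k zc w k * cj (zc w k)).
  by apply: (CC1_sum _ _ oB) => k; exact: (CC1_M oB (Ck k) (CC1_J oB (Ck k))).
rewrite (eq_on_dzbar oB Bz j (fun w _ => radC w)).
rewrite (dzbarV oB Bz j CC1_den (den_neq0 Bz)) radC exprVn; congr (_ * _).
rewrite (dzbarD oB Bz j (@CC1_cst R n B 1) (CC1_N oB Cs)) dzbar_cst add0r.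
have -> : dzbar j (fun w => - \sum_k zc w k * cj (zc w k)) z =
   - dzbar j (fun w => \sum_k zc w k * cj (zc w k)) z.
  have H v := is_cderN (CC1_is_cder v oB Cs Bz).
  by rewrite !dzbarE !(is_cder_Cderive (H _)) /Wdzbar; move: (Cderive _ _ _) (Cderive _ _ _) => *; ring.
rewrite opprK (dzbar_sum oB Bz j _ _ (fun k => CC1_M oB (Ck k) (CC1_J oB (Ck k)))).
rewrite (eq_bigr (fun k => (k == j)%:R * zc z k)) ?sum_delta // => k _.
rewrite (dzbarM oB Bz j (Ck k) (CC1_J oB (Ck k))) (dzbarJ oB Bz j (Ck k)) dz_coord dzbar_coord.
by rewrite mulr0 addr0 cj_nat eq_sym mulrC.
Qed.

Lemma dz_rad j z : B z -> dz j (fun w => (rad w)%:C) z = cj (zc z j) * (rad z)%:C ^+ 2.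
Proof.
move=> Bz; have := dz_creal j Bz C2_rad; rewrite /creal => ->.
by rewrite (dzbar_rad j Bz) cjM cjX cj_real.
Qed.

Lemma dzbar_quot j z : B z -> dzbar j (creal q) z = (rad z)%:C * (b j z + (q z)%:C * zc z j).
Proof.
move=> Bz; rewrite (eq_on_dzbar oB Bz j qE) (dzbarM oB Bz j Cf CC1_radC) (dbf j Bz).
rewrite (dzbar_rad j Bz) (qE Bz).
by move: (rad z)%:C (f z) (b j z) (zc z j) => *; ring.
Qed.

Lemma dz_quot i z : B z -> dz i (creal q) z = (rad z)%:C * (cj (b i z) + (q z)%:C * cj (zc z i)).
Proof.
by move=> Bz; rewrite (dz_creal i Bz Cq) (dzbar_quot i Bz) cjM cjD cjM !cj_real.
Qed.

Lemma hess_quot i j z : B z -> dz i (dzbar j (creal q)) z =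
  (rad z)%:C * c i j + (rad z * q z)%:C * (i == j)%:R +
  dz i (creal q) z * ((rad z)%:C * zc z j) +
  ((rad z)%:C * cj (zc z i)) * dzbar j (creal q) z.
Proof.
move=> Bz; have Cqr := CC1_real Cq.1; have Ck := CC1_coord j oB.
rewrite (eq_on_dz oB Bz i (dzbar_quot j)).
rewrite (dzM oB Bz i CC1_radC (CC1_D oB (Cb j) (CC1_M oB Cqr Ck))) (dz_rad i Bz).
rewrite (dzD oB Bz i (Cb j) (CC1_M oB Cqr Ck)) (db i j Bz) (dzM oB Bz i Cqr Ck) dz_coord.
rewrite (dzbar_quot j Bz) rmorphM /= -/(creal q) [i == j]eq_sym.
by move: (dz i (creal q) z) (rad z)%:C (q z)%:C (b j z) (zc z j) (cj (zc z i)) (_%:R) (c i j) => *; ring.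
Qed.

End Quotient.
End ExtremalVariables.

(** * The extremal function: equation, bounds and boundary values *)

Section ExtremalFunction.
Context {R : realType}.
Variable N : nat.
Local Notation n := N.+1.
Local Notation B := (Bn R n).
Let oB : open B := open_Bn.
Local Notation zc := zcoord.
Local Notation j0 := (ord0 : 'I_n).
Local Notation tv := (tvar j0).
Local Notation pv := (pvar j0).

(** [ft] and [fp] are the numerators of [tvar] and [pvar]; [bt], [bp] are their antiholomorphic
    derivatives and [cp] the constant mixed derivatives of [fp], those of [ft] being 0. *)
Let ft (w : Cn R n) : R[i] := zc w j0 + cj (zc w j0).
Let bt (j : 'I_n) (w : Cn R n) : R[i] := (j == j0)%:R.
Let fp (w : Cn R n) : R[i] := 1 - zc w j0 * cj (zc w j0).
Let bp (j : 'I_n) (w : Cn R n) : R[i] := - (j == j0)%:R * zc w j0.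
Let cp (i j : 'I_n) : R[i] := -1 * ((i == j0)%:R * (j == j0)%:R).

Let Cz : CC1 B (fun w => zc w j0) := CC1_coord j0 oB.
Let Czb : CC1 B (fun w => cj (zc w j0)) := CC1_J oB Cz.

Lemma tvE z : (tv z)%:C = ft z * (rad z)%:C.
Proof. by rewrite /tvar /ft /zcoord; apply: complex_ext; rewrite !ReImE /=; ring. Qed.

Lemma pvE z : (pv z)%:C = fp z * (rad z)%:C.
Proof. by rewrite /pvar /fp nrm2C rmorphM rmorphB rmorph1. Qed.

Lemma CC1_ft : CC1 B ft. Proof. exact: (CC1_D oB Cz Czb). Qed.

Lemma CC1_fp : CC1 B fp.
Proof. exact: (CC1_D oB (@CC1_cst R n B 1) (CC1_N oB (CC1_M oB Cz Czb))). Qed.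

Lemma CC1_bp j : CC1 B (bp j).
Proof. exact: (CC1_M oB (@CC1_cst R n B (- (j == j0)%:R)) Cz). Qed.

Lemma dzbar_ft j z : B z -> dzbar j ft z = bt j z.
Proof.
move=> Bz; rewrite /ft (dzbarD oB Bz j Cz Czb) dzbar_coord add0r (dzbarJ oB Bz j Cz) dz_coord.
by rewrite cj_nat.
Qed.

Lemma dzbar_fp j z : B z -> dzbar j fp z = bp j z.
Proof.
move=> Bz; have CM := CC1_M oB Cz Czb.
rewrite /fp (dzbarD oB Bz j (@CC1_cst R n B 1) (CC1_N oB CM)) dzbar_cst add0r.
have -> : dzbar j (fun w => - (zc w j0 * cj (zc w j0))) z = - dzbar j (fun w => zc w j0 * cj (zc w j0)) z.
  have H v := is_cderN (CC1_is_cder v oB CM Bz).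
  by rewrite !dzbarE !(is_cder_Cderive (H _)) /Wdzbar; move: (Cderive _ _ _) (Cderive _ _ _) => *; ring.
rewrite (dzbarM oB Bz j Cz Czb) (dzbarJ oB Bz j Cz) dz_coord dzbar_coord cj_nat mulr0 addr0.
by rewrite /bp mulNr mulrC.
Qed.

Lemma dz_bt i j z : B z -> dz i (bt j) z = 0.
Proof. by move=> _; exact: dz_cst. Qed.

Lemma dz_bp i j z : B z -> dz i (bp j) z = cp i j.
Proof.
move=> Bz; rewrite /bp (dzM oB Bz i (@CC1_cst R n B (- (j == j0)%:R)) Cz) dz_coord dz_cst.
by rewrite mulr0 addr0 /cp mulN1r mulNr mulrC.
Qed.

Section AtPoint.
Variable z : Cn R n.
Hypothesis Bz : B z.
Local Notation S := (\sum_k zc z k * cj (zc z k)).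
Local Notation r := ((rad z)%:C).
Local Notation T := ((tv z)%:C).
Local Notation P := ((pv z)%:C).
Local Notation a := (zc z j0).
Local Notation b := (cj (zc z j0)).
Local Notation L X := (\sum_i \sum_j ((i == j)%:R - zc z i * cj (zc z j)) * X i j).

Let tE := fun w (_ : B w) => tvE w.
Let pE := fun w (_ : B w) => pvE w.
Let Ct := @C2_tvar R n j0.
Let Cp := @C2_pvar R n j0.
Let Cbt j : CC1 B (bt j) := @CC1_cst R n B (j == j0)%:R.

Lemma dzbar_t j : dzbar j (creal tv) z = r * (j == j0)%:R + r * T * zc z j.
Proof. by rewrite (dzbar_quot tE CC1_ft dzbar_ft j Bz) mulrDr mulrA. Qed.

Lemma dz_t i : dz i (creal tv) z = r * (i == j0)%:R + r * T * cj (zc z i).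
Proof. by rewrite (dz_quot Ct tE CC1_ft dzbar_ft i Bz) /bt cj_nat mulrDr mulrA. Qed.

Lemma dzbar_p j : dzbar j (creal pv) z = - (r * a) * (j == j0)%:R + r * P * zc z j.
Proof.
rewrite (dzbar_quot pE CC1_fp dzbar_fp j Bz) /bp.
by move: r P a (_%:R) (zc z j) => *; ring.
Qed.

Lemma dz_p i : dz i (creal pv) z = - (r * b) * (i == j0)%:R + r * P * cj (zc z i).
Proof.
rewrite (dz_quot Cp pE CC1_fp dzbar_fp i Bz) /bp cjM cjN cj_nat.
by move: r P b (_%:R) (cj (zc z i)) => *; ring.
Qed.

Lemma eq_bracket (u v u' v' : 'I_n -> R[i]) :
  (forall i, u i = u' i) -> (forall i, v i = v' i) -> bracket z u v = bracket z u' v'.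
Proof.
by move=> E1 E2; apply: eq_bigr => i _; apply: eq_bigr => j _; rewrite E1 E2.
Qed.

Let e := 1 - S.
Let e0 : e != 0. Proof. exact: den_neq0. Qed.
Let rE : r = e^-1. Proof. exact: radC. Qed.
Let SE : S = 1 - e. Proof. by rewrite /e opprB addrC subrK. Qed.
Let TE : T = (a + b) / e. Proof. by rewrite tvE rE. Qed.
Let PE : P = (1 - a * b) / e. Proof. by rewrite pvE rE. Qed.

(** This and the three pairings that follow, together with [LB_t] and [LB_p], are the coefficients
    of [Fext0_pde] times the common factor [rad]: T and p satisfy a closed system, which is why a
    function of them alone can solve the equation. *)
Lemma bracket_tt :
  bracket z (fun i => dz i (creal tv) z) (fun j => dzbar j (creal tv) z) = (P + T ^+ 2) * r.
Proof.
rewrite (eq_bracket dz_t dzbar_t) bracket_affine TE PE rE SE.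
by move: e e0 a b => x x0 y y'; field.
Qed.

Lemma bracket_tp :
  bracket z (fun i => dz i (creal tv) z) (fun j => dzbar j (creal pv) z) = T * (P - 1) * r.
Proof.
rewrite (eq_bracket dz_t dzbar_p) bracket_affine TE PE rE SE.
by move: e e0 a b => x x0 y y'; field.
Qed.

Lemma bracket_pt :
  bracket z (fun i => dz i (creal pv) z) (fun j => dzbar j (creal tv) z) = T * (P - 1) * r.
Proof.
rewrite (eq_bracket dz_p dzbar_t) bracket_affine TE PE rE SE.
by move: e e0 a b => x x0 y y'; field.
Qed.

Lemma bracket_pp :
  bracket z (fun i => dz i (creal pv) z) (fun j => dzbar j (creal pv) z) = (P ^+ 2 - P) * r.
Proof.
rewrite (eq_bracket dz_p dzbar_p) bracket_affine PE rE SE.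
by move: e e0 a b => x x0 y y'; field.
Qed.

Lemma L_D X Y : L (fun i j => X i j + Y i j) = L X + L Y.
Proof.
rewrite -big_split; apply: eq_bigr => i _; rewrite -big_split; apply: eq_bigr => j _.
by rewrite mulrDr.
Qed.

Lemma L_Z c X : L (fun i j => c * X i j) = c * L X.
Proof.
rewrite mulr_sumr; apply: eq_bigr => i _; rewrite mulr_sumr; apply: eq_bigr => j _.
by rewrite mulrCA.
Qed.

Lemma eq_L X Y : (forall i j, X i j = Y i j) -> L X = L Y.
Proof. by move=> E; apply: eq_bigr => i _; apply: eq_bigr => j _; rewrite E. Qed.

Lemma LB_t : LB tv z = n.+1%:R * T * r.
Proof.
pose X i j := r * T * (i == j)%:R + dz i (creal tv) z * (r * zc z j) + (r * cj (zc z i)) * dzbar j (creal tv) z.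
have -> : LB tv z = L X.
  apply: eq_L => i j; rewrite (hess_quot Ct tE CC1_ft Cbt dzbar_ft dz_bt i j Bz).
  by rewrite mulr0 add0r rmorphM.
rewrite /X !L_D bracket_trace.
have -> : L (fun i j => dz i (creal tv) z * (r * zc z j)) =
    bracket z (fun i => r * (i == j0)%:R + r * T * cj (zc z i)) (fun j => 0 * (j == j0)%:R + r * zc z j).
  by apply: eq_bracket => i; rewrite ?mul0r ?add0r //; exact: dz_t.
have -> : L (fun i j => r * cj (zc z i) * dzbar j (creal tv) z) =
    bracket z (fun i => 0 * (i == j0)%:R + r * cj (zc z i)) (fun j => r * (j == j0)%:R + r * T * zc z j).
  by apply: eq_bracket => i; rewrite ?mul0r ?add0r //; exact: dzbar_t.
rewrite !bracket_affine -[n.+1%:R]natr1 TE rE SE.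
by move: e e0 a b (n%:R) => x x0 y y' k; field.
Qed.

Lemma LB_p : LB pv z = (n.+1%:R * P - 2) * r.
Proof.
pose X i j := r * cp i j + r * P * (i == j)%:R + dz i (creal pv) z * (r * zc z j) + (r * cj (zc z i)) * dzbar j (creal pv) z.
have -> : LB pv z = L X.
  apply: eq_L => i j; rewrite (hess_quot Cp pE CC1_fp CC1_bp dzbar_fp dz_bp i j Bz).
  by rewrite rmorphM.
rewrite /X !L_D bracket_trace L_Z bracket_delta.
have -> : L (fun i j => dz i (creal pv) z * (r * zc z j)) =
    bracket z (fun i => - (r * b) * (i == j0)%:R + r * P * cj (zc z i)) (fun j => 0 * (j == j0)%:R + r * zc z j).
  by apply: eq_bracket => i; rewrite ?mul0r ?add0r //; exact: dz_p.
have -> : L (fun i j => r * cj (zc z i) * dzbar j (creal pv) z) =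
    bracket z (fun i => 0 * (i == j0)%:R + r * cj (zc z i)) (fun j => - (r * a) * (j == j0)%:R + r * P * zc z j).
  by apply: eq_bracket => i; rewrite ?mul0r ?add0r //; exact: dzbar_p.
rewrite !bracket_affine -[n.+1%:R]natr1 PE rE SE.
by move: e e0 a b (n%:R) => x x0 y y' k; field.
Qed.

Definition Hext0 (w : Cn R n) : R := Fext0 N (tv w) (pv w).

Lemma Pfam_pT (T p : R) : 2^-1 < p ->
  is_derive T 1 ((Pfam N ('i * n%:R) 1 n.+1) ^~ p) (FTp N T p).
Proof.
move=> hp; rewrite /FTp.
have <- : 'i * n%:R * (n.+1%:R * 'i) = n%:R * - n.+1%:R :> R[i].
  transitivity ('i * 'i * (n%:R * n.+1%:R) : R[i]); first by ring.
  by rewrite -expr2 sqr_i; ring.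
exact: Pfam_derive_T.
Qed.

(** By the chain rule the operator applied to the profile is [rad] times the left side of
    [Fext0_pde] at ([tvar], [pvar]). The mixed derivative occurs twice, from the two pairings of t
    with p; this is the factor 2 of the cross term. *)
Lemma LB_Hext0 : LB Hext0 z = 0.
Proof.
have PTT (T p : R) : 2^-1 < p ->
    is_derive T 1 ((Pfam N n%:R 0 n.+1) ^~ p) (FTT N T p) by exact: Pfam_derive_T.
have PTp (T p : R) : 2^-1 < p ->
    is_derive p 1 ((Pfam N n%:R 0 n.+1) T) (FTp N T p) by exact: Pfam_derive_p.
have Ppp (T p : R) : 2^-1 < p ->
    is_derive p 1 ((Pfam N ('i * n%:R) 1 n.+1) T) (Fpp N T p) by exact: Pfam_derive_p.
have H i j := two_var_hess oB Ct Cp (@pvar_half R n j0) (Fext0_C2 N).1 (Pfam_C1 N _ _ _)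
  (Pfam_C1 N _ _ _) (Fext0_derive_T N) (Fext0_derive_p N) PTT PTp Pfam_pT Ppp i j Bz.
have pdeC (p t k x1 x2 x11 x12 x22 : R) :
    (p%:C + t%:C ^+ 2) * x11%:C + 2 * t%:C * (p%:C - 1) * x12%:C + (p%:C ^+ 2 - p%:C) * x22%:C
      + k%:C * t%:C * x1%:C + (k%:C * p%:C - 2) * x2%:C =
    ((p + t ^+ 2) * x11 + 2 * t * (p - 1) * x12 + (p ^+ 2 - p) * x22
      + k * t * x1 + (k * p - 2) * x2)%:C.
  by apply: complex_ext; rewrite !ReImE /=; ring.
pose c1 := (Pfam N n%:R 0 n.+1 (tv z) (pv z))%:C.
pose c2 := (Pfam N ('i * n%:R) 1 n.+1 (tv z) (pv z))%:C.
pose c11 := (FTT N (tv z) (pv z))%:C; pose c12 := (FTp N (tv z) (pv z))%:C.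
pose c22 := (Fpp N (tv z) (pv z))%:C.
pose X i j := c1 * dz i (dzbar j (creal tv)) z + c2 * dz i (dzbar j (creal pv)) z
  + c11 * (dz i (creal tv) z * dzbar j (creal tv) z)
  + c12 * (dz i (creal pv) z * dzbar j (creal tv) z)
  + c12 * (dz i (creal tv) z * dzbar j (creal pv) z)
  + c22 * (dz i (creal pv) z * dzbar j (creal pv) z).
have -> : LB Hext0 z = L X.
  apply: eq_L => i j; rewrite (H i j) /X -/c1 -/c2 -/c11 -/c12 -/c22.
  move: (dz i (dzbar j (creal tv)) z) (dz i (dzbar j (creal pv)) z) (dz i (creal tv) z)
    (dz i (creal pv) z) (dzbar j (creal tv) z) (dzbar j (creal pv) z) => *; ring.
pose A1 i j := dz i (dzbar j (creal tv)) z; pose A2 i j := dz i (dzbar j (creal pv)) z.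
pose A3 i j := dz i (creal tv) z * dzbar j (creal tv) z.
pose A4 i j := dz i (creal pv) z * dzbar j (creal tv) z.
pose A5 i j := dz i (creal tv) z * dzbar j (creal pv) z.
pose A6 i j := dz i (creal pv) z * dzbar j (creal pv) z.
have -> : L X = c1 * L A1 + c2 * L A2 + c11 * L A3 + c12 * L A4 + c12 * L A5 + c22 * L A6.
  rewrite -(L_Z c1 A1) -(L_Z c2 A2) -(L_Z c11 A3) -(L_Z c12 A4) -(L_Z c12 A5) -(L_Z c22 A6).
  by rewrite -!L_D.
suff final l1 l2 l3 l4 l5 l6 : l1 = n.+1%:R * T * r -> l2 = (n.+1%:R * P - 2) * r ->
    l3 = (P + T ^+ 2) * r -> l4 = T * (P - 1) * r -> l5 = T * (P - 1) * r ->
    l6 = (P ^+ 2 - P) * r ->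
    c1 * l1 + c2 * l2 + c11 * l3 + c12 * l4 + c12 * l5 + c22 * l6 = 0.
  exact: (final _ _ _ _ _ _ LB_t LB_p bracket_tt bracket_pt bracket_tp bracket_pp).
move=> -> -> -> -> -> ->.
have := pdeC (pv z) (tv z) n.+1%:R (Pfam N n%:R 0 n.+1 (tv z) (pv z))
  (Pfam N ('i * n%:R) 1 n.+1 (tv z) (pv z)) (FTT N (tv z) (pv z)) (FTp N (tv z) (pv z))
  (Fpp N (tv z) (pv z)).
rewrite (Fext0_pde N (tv z) (pvar_half j0 Bz)) rmorph0 rmorph_nat.
rewrite -/c1 -/c2 -/c11 -/c12 -/c22 => pde.
rewrite -[RHS](mul0r r) -pde; clear.
move: c1 c2 c11 c12 c22 r T P (n.+1%:R) => *; ring.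
Qed.

End AtPoint.

(** The factor 2/pi normalizes the limit pi/2 of the profile to the boundary value 1. *)
Definition Hext (w : Cn R n) : R := 2 / pi * Hext0 w.

Lemma C2_Hext0 : C2 B Hext0.
Proof.
exact: (two_var_C2 oB (@C2_tvar R n j0) (@C2_pvar R n j0) (@pvar_half R n j0) (Fext0_C2 N)).
Qed.

Lemma harmonic_Hext : real_invariant_harmonic Hext.
Proof.
apply: harmonic_Z; apply/harmonicP; split; first exact: C2_Hext0.
by move=> z Bz; exact: LB_Hext0.
Qed.

Lemma Hext_bounds z : B z -> 0 <= z.1 0 j0 -> 0 <= Hext z <= 1.
Proof.
move=> Bz x0; have pi0 : 0 < pi :> R := pi_gt0 R.
have t0 : 0 <= tv z by rewrite /tvar !mulr_ge0 // ltW // rad_gt0.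
have /andP[h0 h1] := Fext0_bounds N t0 (pvar_ge1 j0 Bz).
rewrite /Hext /Hext0 mulr_ge0 ?divr_ge0 ?(ltW pi0) //=.
rewrite mulrC -ler_pdivlMr ?divr_gt0 // invf_div mul1r; exact: h1.
Qed.

Lemma Hext_le1 z : B z -> `|Hext z| <= 1.
Proof.
move=> Bz; have [x0|x0] := leP 0 (z.1 0 j0).
  by have /andP[h0 h1] := Hext_bounds Bz x0; rewrite ger0_norm.
have pi0 : 0 < pi :> R := pi_gt0 R.
have t0 : 0 <= - tv z by rewrite oppr_ge0 /tvar mulr_le0_ge0 ?(ltW (rad_gt0 Bz)) // pmulr_rle0 // ltW.
have /andP[h0 h1] := Fext0_bounds N t0 (pvar_ge1 j0 Bz).
rewrite Fext0_odd ?(pvar_half j0 Bz) // in h0 h1.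
have E : `|Hext0 z| = - Hext0 z by rewrite ler0_norm // -oppr_ge0.
rewrite /Hext normrM E ger0_norm ?divr_ge0 ?(ltW pi0) //.
rewrite mulrC -ler_pdivlMr ?divr_gt0 // invf_div mul1r; exact: h1.
Qed.

(* Uniform in the whole half ball [x_1 >= eta] near the sphere, since there
   [p <= T / (2 eta)]. *)
Lemma Hext_boundary (eta e : R) : 0 < eta -> 0 < e ->
  exists2 d : R, 0 < d & forall z, B z -> eta <= z.1 0 j0 -> 1 - d <= sqnorm z -> 1 - e <= Hext z.
Proof.
move=> eta0 e0; have pi0 : 0 < pi :> R := pi_gt0 R.
have M0 : 0 < (2 * eta)^-1 by rewrite invr_gt0 mulr_gt0.
have e1 : 0 < e * (pi / 2) by rewrite !mulr_gt0 // invr_gt0.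
have [T0 T01 h] := Fext0_limit N M0 e1.
have T00 : 0 < T0 := lt_le_trans ltr01 T01.
exists (2 * eta / T0); first by rewrite divr_gt0 // mulr_gt0.
move=> z Bz xe hz; have r0 := rad_gt0 Bz.
have d0 := rad_den Bz.
have hT : T0 <= tv z.
  rewrite /tvar /rad ler_pdivlMr //.
  apply: (@le_trans _ _ (2 * eta)); last by rewrite ler_wpM2l.
  rewrite mulrC -ler_pdivlMr //; lra.
have hP : pv z <= (2 * eta)^-1 * tv z.
  rewrite /tvar /pvar mulrA ler_wpM2r ?(ltW r0) //.
  apply: (@le_trans _ _ 1); first by rewrite gerBl nrm2_ge0.
  by rewrite mulrC ler_pdivlMr ?mulr_gt0 // mul1r ler_wpM2l.
have := h _ _ hT (pvar_ge1 j0 Bz) hP; rewrite ler_norml => /andP[+ _].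
rewrite -/(Hext0 z) /Hext lerBrDr => H.
have -> : 1 - e = 2 / pi * (- (e * (pi / 2)) + pi / 2).
  by move: pi0; move: pi => q q0; field; rewrite gt_eqF.
by rewrite ler_wpM2l // divr_ge0 // ltW.
Qed.

End ExtremalFunction.

(** * The extremal function at the origin and on the first axis *)

Section ExtremalAtOrigin.
Context {R : realType}.
Variable N : nat.
Local Notation n := N.+1.
Local Notation B := (Bn R n).
Let oB : open B := open_Bn.
Local Notation j0 := (ord0 : 'I_n).

(** The holomorphic derivative of [Hext] along the first coordinate at 0, hence half of its
    Euclidean gradient there. *)
Definition sharp_const : R := 2 / pi * (n%:R * Int01 (wt N 0)).

Lemma cont01_wt k : cont01 (wt N k : R -> R).
Proof. by apply: derivable_cont01 => x _; exact: derivable_wt. Qed.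

Lemma B0 : B (0 : Cn R n).
Proof. by apply/BnP; rewrite /sqnorm big1 // => d _; rewrite linear0 expr0n. Qed.

Lemma zcoord0 k : zcoord (0 : Cn R n) k = 0.
Proof. by rewrite /zcoord /= !mxE. Qed.

Lemma sqnorm0 : sqnorm (0 : Cn R n) = 0.
Proof. by rewrite /sqnorm big1 // => d _; rewrite linear0 expr0n. Qed.

Lemma Pfam01 : Pfam N n%:R 0 n.+1 0 1 = n%:R * Int01 (wt N 0) :> R.
Proof.
rewrite -Int01Z; last exact: cont01_wt.
apply: Int01_eq => x _; rewrite /Pint.
have -> : Ac 0 1 x = 1.
  rewrite /Ac -[RHS]invr1; congr (_^-1); rewrite /Yc subrr mulr0 addr0 mulr0 oppr0.
  exact: erefl.
by rewrite expr1n mulr1 -(rmorph_nat (real_complex R)) mulrC.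
Qed.

Lemma dz_Hext0_at0 i : dz i (creal (@Hext R N)) 0 = (sharp_const)%:C * (i == j0)%:R.
Proof.
have Ct := @C2_tvar R n j0; have Cp := @C2_pvar R n j0.
have C0 := (C2_Hext0 (R := R) N).1.
have E w : B w -> creal (@Hext R N) w = (2 / pi)%:C * creal (@Hext0 R N) w.
  by move=> _; rewrite /creal -rmorphM.
rewrite (eq_on_dz oB B0 i E) (dzM oB B0 i (@CC1_cst R n B (2 / pi)%:C) (CC1_real C0)) dz_cst mulr0 addr0.
have -> : dz i (creal (@Hext0 R N)) 0 = (Pfam N n%:R 0 n.+1 0 1)%:C * (i == j0)%:R.
  rewrite (two_var_dz oB Ct Cp (@pvar_half R n j0) (Fext0_C2 N).1 (Fext0_derive_T N) (Fext0_derive_p N) i B0).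
  rewrite (dz_t B0) (dz_p B0) !zcoord0 !cj0.
  have r1 : rad (0 : Cn R n) = 1 by rewrite /rad sqnorm0 subr0 invr1.
  have t0 : tvar j0 (0 : Cn R n) = 0 by rewrite /tvar /= mxE mulr0 mul0r.
  have p1 : pvar j0 (0 : Cn R n) = 1.
    by rewrite /pvar r1 zcoord0 /nrm2 /= expr0n addr0 subr0 mulr1.
  by rewrite r1 t0 p1 rmorph1 rmorph0 !(mulr0, mul0r, mul1r, oppr0, addr0).
by rewrite /cst mulrA -rmorphM Pfam01.
Qed.

(** At p = 1 the modulus of A is at most 1, with A = 1 when T = 0, so the T-derivative is largest at
    T = 0 and the profile lies below its tangent line at 0. *)
Lemma Fext0_axis_le (T : R) : 0 <= T -> Fext0 N T 1 <= n%:R * Int01 (wt N 0) * T.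
Proof.
move=> T0; have hp : 2^-1 < (1 : R) by exact: hp_half.
have Ic : cont01 (fun x : R => n%:R * T * wt N 0 x) by apply: cont01Z; exact: cont01_wt.
have H (t : R) : is_derive t (1 : R) (Fext0 N ^~ 1) (Pfam N n%:R 0 n.+1 t 1).
  exact: Fext0_derive_T.
have cF : {within `[0, T], continuous (Fext0 N ^~ (1 : R))}.
  by apply: derivable_within_continuous => x _; case: (H x).
have [t _ E] := MVT_segment T0 (fun x _ => H x) cF.
have F0 : Fext0 N 0 (1 : R) = 0.
  by have := Fext0_odd N 0 hp; rewrite oppr0 => /eqP; rewrite -addr_eq0 -mulr2n mulrn_eq0 /= => /eqP ->.
move: E; rewrite F0 !subr0 => ->; rewrite ler_wpM2r //.
rewrite -Int01Z; last exact: cont01_wt.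
apply: Int01_le; [exact: Pint_cont|by apply: cont01Z; exact: cont01_wt|].
move=> x x01; rewrite /Pint mulrC.
have w0 : 0 <= wt N 0 x by rewrite /wt expr0 mul1r; have /andP[] := wt01 x01 N.
rewrite ler_wpM2r //; apply: le_trans (ler_norm _) _; apply: le_trans (Re_le_nrm _) _.
rewrite nrmM nrmX -(rmorph_nat (real_complex R)) nrm_real ger0_norm // ler_piMr //.
rewrite exprn_ile1 ?nrm_ge0 //; exact: nrm_A_le1.
Qed.

End ExtremalAtOrigin.

(** * The Euclidean gradient in terms of holomorphic derivatives *)

Section GradientWirtinger.
Context {R : realType} {n : nat}.

Lemma nrm2_dz_creal (h : Cn R n -> R) j z :
  'D_(e_x j) h z ^+ 2 + 'D_(e_y j) h z ^+ 2 = 4 * nrm2 (dz j (creal h) z).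
Proof.
rewrite dzE !Cderive_creal; move: ('D_(e_x j) h z) ('D_(e_y j) h z) => x y.
have -> : Wdz x%:C y%:C = (x / 2) +i* (- (y / 2)).
  have h2 : (2^-1 : R[i]) = (2^-1 : R)%:C by rewrite fmorphV rmorph_nat.
  by rewrite /Wdz h2; apply: complex_ext; rewrite !ReImE /=; ring.
by rewrite /nrm2 /=; field.
Qed.

Lemma grad_norm_dz (h : Cn R n -> R) z :
  grad_norm h z = 2 * Num.sqrt (\sum_j nrm2 (dz j (creal h) z)).
Proof.
rewrite /grad_norm; under eq_bigr do rewrite nrm2_dz_creal.
by rewrite -mulr_sumr sqrtrM // (_ : 4 = 2 ^+ 2) ?sqrtr_sqr ?ger0_norm // -natrX.
Qed.

Lemma Re_dz_creal (h : Cn R n -> R) j z :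
  complex.Re (dz j (creal h) z) = 'D_(e_x j) h z / 2.
Proof.
rewrite dzE !Cderive_creal; move: ('D_(e_x j) h z) ('D_(e_y j) h z) => x y.
have h2 : (2^-1 : R[i]) = (2^-1 : R)%:C by rewrite fmorphV rmorph_nat.
by rewrite /Wdz h2 !ReImE /=; ring.
Qed.

End GradientWirtinger.

(** * Approximation of unimodular numbers by roots of unity *)

Section RootsOfUnity.
Context {R : realType}.
Implicit Types (t : R) (a : R[i]).

Definition cis t : R[i] := cos t +i* sin t.

Lemma cisD s t : cis (s + t) = cis s * cis t.
Proof. by rewrite /cis cosD sinD; apply: complex_ext; rewrite !ReImE /=; ring. Qed.

Lemma cis0 : cis 0 = 1. Proof. by rewrite /cis cos0 sin0. Qed.

Lemma cisMn t k : cis (t *+ k) = cis t ^+ k.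
Proof. by elim: k => [|k IH]; rewrite ?cis0 // mulrS exprS cisD IH. Qed.

Lemma nrm2_cis t : nrm2 (cis t) = 1.
Proof. by rewrite /nrm2 /cis /=; exact: cos2Dsin2. Qed.

Lemma nrm_cis_sub s t : nrm (cis s - cis t) <= 2 * `|s - t|.
Proof.
have Hc x : is_derive x (1 : R) (@cos R) (- sin x) := is_derive_cos x.
have Hs x : is_derive x (1 : R) (@sin R) (cos x) := is_derive_sin x.
have bc x : `|cos x| <= 1 :> R by rewrite ler_norml cos_geN1 cos_le1.
have bs x : `|- sin x| <= 1 :> R by rewrite normrN ler_norml sin_geN1 sin_le1.
have h1 : `|cos s - cos t| <= 1 * `|s - t| by apply: (MVT_bound (fun x _ => Hc x)) => x _; exact: bs.
have h2 : `|sin s - sin t| <= 1 * `|s - t| by apply: (MVT_bound (fun x _ => Hs x)) => x _; exact: bc.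
rewrite !mul1r in h1 h2.
have -> : cis s - cis t = (cos s - cos t)%:C + 'i * (sin s - sin t)%:C.
  by rewrite /cis; apply: complex_ext; rewrite !ReImE /=; ring.
apply: le_trans (nrmD _ _) _; rewrite nrmM !nrm_real.
have -> : nrm 'i = 1 :> R by rewrite /nrm /nrm2 /= expr0n expr1n add0r sqrtr1.
by rewrite mul1r mulr_natl mulr2n lerD.
Qed.

Lemma nrmJ a : nrm (cj a) = nrm a.
Proof. by rewrite /nrm nrm2J. Qed.

Variable m : nat.
Local Notation M := m.+1.
Definition omega : R[i] := cis (pi *+ 2 / M%:R).

Let M0 : 0 < M%:R :> R. Proof. by rewrite ltr0n. Qed.

Lemma omegaM : omega ^+ M = 1.
Proof.
rewrite /omega -cisMn -[X in cis X]mulr_natr divfK ?gt_eqF //.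
by rewrite /cis cos2pi sin2pi.
Qed.

Lemma nrm2_omegaX k : nrm2 (omega ^+ k) = 1.
Proof. by rewrite /omega -cisMn nrm2_cis. Qed.

(** The number is cis t or its conjugate for t = acos of its real part, between 0 and pi. Rounding t
    down to the grid of step 2 pi / M costs at most twice that step in the plane. *)
Lemma root_approx a : nrm2 a = 1 -> exists k : 'I_M, nrm (omega ^+ k - a) <= 4 * pi / M%:R.
Proof.
move=> a1; have x1 : -1 <= complex.Re a <= 1.
  rewrite -ler_norml -(@ler_pXn2r _ 2) ?nnegrE // expr1n real_normK ?num_real //.
  by rewrite -a1 /nrm2 lerDl sqr_ge0.
have [t t0 cE] : exists2 t, 0 <= t <= pi & (a = cis t \/ a = cj (cis t)).
  exists (acos (complex.Re a)); first by rewrite acos_ge0 // acos_lepi.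
  have E : cis (acos (complex.Re a)) = complex.Re a +i* `|complex.Im a|.
    rewrite /cis sin_acos // acosK ?in_itv //=; congr (_ +i* _).
    by rewrite -sqrtr_sqr -a1 /nrm2; congr (Num.sqrt _); ring.
  have [i0|i0] := leP 0 (complex.Im a); [left|right]; rewrite E; apply: complex_ext; rewrite ?ReJ ?ImJ //=.
    by rewrite ger0_norm.
  by rewrite ltr0_norm // opprK.
have [k kM hk] : exists2 k : nat, (k <= m)%N & nrm (omega ^+ k - cis t) <= 4 * pi / M%:R.
  have pi0 : 0 < pi :> R := pi_gt0 R.
  have p2 : 0 < pi *+ 2 / M%:R :> R by rewrite divr_gt0 // pmulrn_lgt0.
  have /andP[t1 t2] := t0.
  have q0 : 0 <= t / (pi *+ 2 / M%:R) by rewrite divr_ge0 // ltW.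
  have /andP[] := truncn_itv q0; set k := Num.truncn _ => k1 k2.
  exists k.
    rewrite -ltnS -(ltr_nat R); apply: le_lt_trans k1 _.
    rewrite ltr_pdivrMr // mulrC divfK ?gt_eqF // (le_lt_trans t2) // mulr2n ltrDl //.
  rewrite /omega -cisMn; apply: le_trans (nrm_cis_sub _ _) _.
  rewrite ler_pdivlMr // in k1; rewrite ltr_pdivrMr // -natr1 mulrDl mul1r in k2.
  rewrite -[_ *+ k]mulr_natl.
  have -> : 4 * pi / M%:R = 2 * (pi *+ 2 / M%:R) :> R by rewrite -mulr_natl; ring.
  move: k1 k2; move: (pi *+ 2 / M%:R) (k%:R) => u v k1 k2.
  by rewrite ler_wpM2l // ler_norml; apply/andP; split; lra.
case: cE => ->.
  have kM' : (k < M)%N by rewrite ltnS.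
  by exists (Ordinal kM').
(* The conjugate of a root of unity is its inverse, so the exponent is M - k; the reduction modulo M
   accounts for k = 0. *)
have kM' : ((M - k) %% M < M)%N by rewrite ltn_mod.
exists (Ordinal kM') => /=; rewrite expr_mod ?omegaM //.
have -> : omega ^+ (M - k) = cj (omega ^+ k).
  have n0 : omega ^+ k != 0 by rewrite -nrm2_eq0 nrm2_omegaX oner_eq0.
  apply: (mulIf n0); rewrite -exprD subnK ?(leq_trans kM) // omegaM mulrC nrm2C nrm2_omegaX.
  exact: erefl.
by rewrite -cjB nrmJ.
Qed.

(** For a nonzero, conj(a)/a has modulus 1, so conjugating a amounts to rotating it, and the
    rotation is approximated by a root of unity depending on a. *)
Lemma conj_approx a : nrm a <= 1 -> exists k : 'I_M, nrm (omega ^+ k * a - cj a) <= 4 * pi / M%:R.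
Proof.
move=> a1; have [->|a0] := eqVneq a 0.
  exists ord0; rewrite mulr0 cj0 subr0 /nrm /nrm2 /= expr0n addr0 sqrtr0.
  by rewrite divr_ge0 ?mulr_ge0 ?pi_ge0 // ltW.
have u1 : nrm2 (cj a / a) = 1 by rewrite nrm2M nrm2V nrm2J mulfV // nrm2_eq0.
have [k hk] := root_approx u1; exists k.
have -> : omega ^+ k * a - cj a = (omega ^+ k - cj a / a) * a by rewrite mulrBl divfK.
rewrite nrmM; apply: le_trans hk; rewrite ler_piMr ?nrm_ge0 //.
Qed.

End RootsOfUnity.

(** * Averages over a finite torus *)

Section TorusAverage.
Context {R : realType}.
Variable N : nat.
Local Notation n := N.+1.
Local Notation B := (Bn R n).
Local Notation V := (Cn R n).
Local Notation j0 := (ord0 : 'I_n).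

Definition dmap (u : 'I_n -> R[i]) : V -> V :=
  aut (fun k i => u k * (k == i)%:R) (fun _ => 0) (fun _ => 0) 1.

Lemma dmap_coord (u : 'I_n -> R[i]) (z : V) k : zcoord (dmap u z) k = u k * zcoord z k.
Proof.
rewrite aut_unitary -[RHS](sum_delta (fun i => u k * zcoord z i)); apply: eq_bigr => i _.
by rewrite [i == k]eq_sym; move: (u k) (zcoord z i) (_%:R) => *; ring.
Qed.

Lemma dmap_U_n1 (u : 'I_n -> R[i]) : (forall k, nrm2 (u k) = 1) ->
  U_n1 (fun k i => u k * (k == i)%:R) (fun _ => 0) (fun _ => 0) 1.
Proof.
move=> u1; apply: U_n1_unitary => k l.
transitivity (\sum_i (i == k)%:R * (u k * cj (u l) * (l == i)%:R)).
  by apply: eq_bigr => i _; rewrite cjM cj_nat eq_sym; move: (_%:R) (_%:R) => *; ring.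
rewrite sum_delta eq_sym; case: eqP => [->|_]; last by rewrite mulr0.
by rewrite nrm2C u1 mulr1.
Qed.

Lemma dmap_Bn (u : 'I_n -> R[i]) (z : V) : (forall k, nrm2 (u k) = 1) -> B z -> B (dmap u z).
Proof. by move=> u1; exact: (aut_Bn (dmap_U_n1 u1)). Qed.

Lemma dmap_sqnorm (u : 'I_n -> R[i]) (z : V) : (forall k, nrm2 (u k) = 1) -> sqnorm (dmap u z) = sqnorm z.
Proof.
by move=> u1; rewrite !sqnorm_nrm2; apply: eq_bigr => k _; rewrite dmap_coord nrm2M u1 mul1r.
Qed.

Variable m : nat.
Local Notation M := m.+1.
Local Notation w := (omega (R := R) m).

(** The first coordinate is left fixed, so the first axis is pointwise fixed and averaging does not
    change values there. *)
Definition tor (k : {ffun 'I_n -> 'I_M}) (j : 'I_n) : R[i] := if j == j0 then 1 else w ^+ k j.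

Lemma tor1 k j : nrm2 (tor k j) = 1.
Proof.
rewrite /tor; case: eqP => _; last exact: nrm2_omegaX.
by rewrite /nrm2 /= expr0n expr1n addr0.
Qed.

(** A finite group of rotations makes the average a finite sum, hence harmonic by linearity; exact
    invariance under the full torus is replaced by approximate invariance as [m] grows. *)
Definition torus_avg (h : V -> R) (z : V) : R :=
  (#|{ffun 'I_n -> 'I_M}|%:R)^-1 * \sum_k h (dmap (tor k) z).

Lemma torus_avg_harmonic h : real_invariant_harmonic h ->
  real_invariant_harmonic (torus_avg h).
Proof.
move=> Hh; apply: harmonic_Z; apply: harmonic_sum => k.
exact: (harmonic_aut (dmap_U_n1 (tor1 k)) Hh).
Qed.

Lemma card_tor_gt0 : 0 < #|{ffun 'I_n -> 'I_M}|%:R :> R.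
Proof. by rewrite ltr0n; apply/card_gt0P; exists [ffun=> ord0]. Qed.

Lemma torus_avg_le h z c : (forall k, `|h (dmap (tor k) z)| <= c) -> `|torus_avg h z| <= c.
Proof.
move=> hc; have c0 := card_tor_gt0.
rewrite /torus_avg normrM ger0_norm ?invr_ge0 ?(ltW c0) // mulrC ler_pdivrMr //.
apply: le_trans (ler_norm_sum _ _ _) _; apply: le_trans (ler_sum _ (fun k _ => hc k)) _.
by rewrite sumr_const mulr_natr.
Qed.

Lemma torus_avg_sub h z z' c :
  (forall k, `|h (dmap (tor k) z) - h (dmap (tor k) z')| <= c) ->
  `|torus_avg h z - torus_avg h z'| <= c.
Proof.
move=> hc; have c0 := card_tor_gt0.
rewrite /torus_avg -mulrBr -sumrB normrM ger0_norm ?invr_ge0 ?(ltW c0) // mulrC ler_pdivrMr //.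
apply: le_trans (ler_norm_sum _ _ _) _; apply: le_trans (ler_sum _ (fun k _ => hc k)) _.
by rewrite sumr_const mulr_natr.
Qed.

Lemma torus_avg_cst h z c : (forall k, h (dmap (tor k) z) = c) -> torus_avg h z = c.
Proof.
move=> hc; rewrite /torus_avg; under eq_bigr do rewrite hc.
by rewrite sumr_const -[c *+ _]mulr_natl mulrA mulVf ?mul1r // gt_eqF // card_tor_gt0.
Qed.

(** Rotating the argument translates the summation index in the group of exponents modulo M, which
    is consistent since the M-th power of [omega] is 1. *)
Lemma torus_avg_inv h l z : torus_avg h (dmap (tor l) z) = torus_avg h z.
Proof.
rewrite /torus_avg; congr (_ * _).
rewrite [RHS](reindex_inj (addIr l)) /=; apply: eq_bigr => k _; congr (h _).
apply: zcoord_inj => j; rewrite !dmap_coord mulrA; congr (_ * _).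
rewrite /tor; case: eqP => _; first by rewrite mulr1.
by rewrite ffunE /= expr_mod ?omegaM // exprD.
Qed.

End TorusAverage.

(** * Uniform continuity on compact sets *)

Section UniformContinuity.
Context {R : realType} {n : nat}.
Local Notation B := (Bn R n).

Lemma norm_le_cdir (v : Cn R n) c : 0 <= c -> (forall d, `|cdir d v| <= c) -> `|v| <= c.
Proof.
move=> c0 H; rewrite [leLHS]/Num.norm /= ge_max; apply/andP; split.
  rewrite [leLHS]/Num.norm /= mx_normrE; apply: bigmax_le => // -[k j] _ /=.
  by rewrite [k]ord1; exact: (H (inl j)).
rewrite [leLHS]/Num.norm /= mx_normrE; apply: bigmax_le => // -[k j] _ /=.
by rewrite [k]ord1; exact: (H (inr j)).
Qed.

Lemma norm_le_zcoord (w z : Cn R n) c : 0 <= c ->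
  (forall j, nrm (zcoord w j - zcoord z j) <= c) -> `|w - z| <= c.
Proof.
move=> c0 H; apply: norm_le_cdir => // -[j|j]; apply: le_trans (H j).
  by apply: le_trans (Re_le_nrm _); rewrite ReD ReN /= !mxE.
have -> : cdir (inr j) (w - z) = complex.Im (zcoord w j - zcoord z j).
  by rewrite ImD ImN /= !mxE.
rewrite -(@ler_pXn2r _ 2) ?nnegrE ?nrm_ge0 // real_normK ?num_real //.
by rewrite sqr_sqrtr ?nrm2_ge0 // /nrm2 lerDr sqr_ge0.
Qed.

Lemma unif_on_compact (K : set (Cn R n)) (h : Cn R n -> R) (e : R) : compact K -> K `<=` B ->
  C1 B h -> 0 < e -> exists2 d : R, 0 < d &
  forall z w, K z -> `|w - z| <= d -> `|h w - h z| <= e.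
Proof.
move=> /compact_near_coveringP cK KB Ch e0.
have e2 : 0 < e / 2 by rewrite divr_gt0.
have := cK R (0^'+) (fun d z => forall w, `|w - z| <= d -> `|h w - h z| <= e) _.
case.
  move=> z Kz; have := C1_continuous open_Bn Ch (KB z Kz).
  move=> /cvgrPdist_le/(_ _ e2)/nbhs_ballP[r /= r0 hr].
  have r2 : 0 < r / 2 by rewrite divr_gt0.
  exists (ball z (r / 2), [set d | d < r / 2]).
    by split => /=; [exact: nbhsx_ballx|exact: nbhs_right_lt].
  move=> [z' d] [/= zz' dr] w wz'.
  rewrite -ball_normE /= in zz'.
  have h1 : `|h z - h z'| <= e / 2.
    apply: hr; rewrite -ball_normE /=; apply: lt_trans zz' _.
    by rewrite ltr_pdivrMr // ltr_pMr // ltr1n.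
  have h2 : `|h z - h w| <= e / 2.
    apply: hr; rewrite -ball_normE /=.
    have -> : z - w = (z - z') + (z' - w) by rewrite addrA subrK.
    apply: le_lt_trans (ler_normD _ _) _; rewrite [r]splitr ltrD //.
    by rewrite distrC; exact: le_lt_trans wz' dr.
  have -> : h w - h z' = (h z - h z') - (h z - h w).
    by move: (h w) (h z') (h z) => *; ring.
  by apply: le_trans (ler_normB _ _) _; rewrite [e]splitr lerD.
move=> d /= d0 Hd; exists (d / 2); first by rewrite divr_gt0.
move=> z w Kz; apply: (Hd (d / 2)) => //=.
  by rewrite sub0r normrN ger0_norm ?ltr_pdivrMr ?ltr_pMr ?ltr1n // ltW // divr_gt0.
by rewrite divr_gt0.
Qed.

End UniformContinuity.

(** * Translation along the first axis *)

Section AutomorphismNorm.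
Context {R : realType} {n : nat}.
Variables (A : 'I_n -> 'I_n -> R[i]) (b c : 'I_n -> R[i]) (d : R[i]).
Hypothesis HU : U_n1 A b c d.
Local Notation B := (Bn R n).

Lemma aut_one_minus_sqnorm z : B z ->
  1 - sqnorm (aut A b c d z) = (1 - sqnorm z) / nrm2 (autD c d z).
Proof.
move=> Bz; have n0 : nrm2 (autD c d z) != 0 by rewrite nrm2_eq0 (autD_neq0 HU Bz).
rewrite sqnorm_nrm2; under eq_bigr do rewrite aut_coord nrm2M nrm2V.
rewrite -mulr_suml; apply: (mulIf n0); rewrite mulrBl mul1r !divfK //.
by rewrite (autD_norm HU z) addrK.
Qed.

End AutomorphismNorm.

Section AxisTranslation.
Context {R : realType}.
Variable N : nat.
Local Notation n := N.+1.
Local Notation B := (Bn R n).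
Local Notation V := (Cn R n).
Local Notation j0 := (ord0 : 'I_n).

Definition axis (x : R) : V := x *: e_x j0.

Lemma zcoord_axis x j : zcoord (axis x) j = x%:C * (j == j0)%:R.
Proof.
rewrite -(rmorph_nat (real_complex R)) -rmorphM /zcoord /axis /e_x /= !mxE eqxx /= mulr0.
exact: erefl.
Qed.

Lemma sqnorm_axis x : sqnorm (axis x) = x ^+ 2.
Proof.
rewrite sqnorm_nrm2 (bigD1 j0) //= big1 ?addr0 => [|j jj]; rewrite zcoord_axis.
  by rewrite eqxx mulr1 /nrm2 /= expr0n addr0.
by rewrite (negbTE jj) mulr0 /nrm2 /= expr0n addr0.
Qed.

Lemma axis_Bn x : `|x| < 1 -> B (axis x).
Proof. by move=> x1; apply/BnP; rewrite sqnorm_axis -real_normK ?num_real // exprn_ilt1. Qed.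

Variable a : R.
Hypotheses (a0 : 0 < a) (a1 : a < 1).

Let Ba : B (axis a). Proof. by apply: axis_Bn; rewrite ger0_norm // ltW. Qed.
Let s := Num.sqrt (1 - sqnorm (axis a)).
Let s2 : s ^+ 2 = 1 - a ^+ 2.
Proof. by rewrite sqr_sqrtr sqnorm_axis // subr_ge0 exprn_ile1 // ltW. Qed.
Let s_gt0 : 0 < s.
Proof. by rewrite sqrtr_gt0 sqnorm_axis subr_gt0 exprn_ilt1 // ltW. Qed.

Lemma axis_autD w : autD (trc (axis a)) (trd (axis a)) w =
  (s^-1)%:C * (1 + a%:C * zcoord w j0).
Proof.
rewrite /autD /trc /trd -/s mulrDr mulr1 addrC; congr (_ + _).
rewrite -[zcoord w j0](sum_delta (fun k => zcoord w k)) !mulr_sumr.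
apply: eq_bigr => k _; rewrite zcoord_axis cjM cj_real cj_nat.
by move: (s^-1)%:C a%:C (_%:R) (zcoord w k) => *; ring.
Qed.

Lemma axis_autN w k : autN (trA (axis a)) (trb (axis a)) k w =
  if k == j0 then (s^-1)%:C * (zcoord w j0 + a%:C) else zcoord w k.
Proof.
rewrite /autN /trA /trb -/s.
have E (u : R[i]) : \sum_i ((k == i)%:R + u * (zcoord (axis a) k * cj (zcoord (axis a) i))) * zcoord w i =
    zcoord w k + u * zcoord (axis a) k * (a%:C * zcoord w j0).
  under eq_bigr do rewrite mulrDl.
  rewrite big_split /=; congr (_ + _).
    by under eq_bigr do rewrite eq_sym; rewrite (sum_delta (fun i => zcoord w i)).
  rewrite -[zcoord w j0](sum_delta (fun i => zcoord w i)) !mulr_sumr.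
  apply: eq_bigr => i _; rewrite (zcoord_axis a i) cjM cj_real cj_nat.
  by move: (zcoord (axis a) k) (_%:R) a%:C (zcoord w i) => *; ring.
rewrite E zcoord_axis; case: eqP => [->|_]; last first.
  by rewrite mulr0 !(mulr0, mul0r, addr0).
rewrite mulr1.
have Q : (s^-1)%:C = 1 + ((s * (1 + s))^-1)%:C * (a%:C * a%:C).
  rewrite -rmorphM -rmorphM -(rmorph1 (real_complex R)) -rmorphD; congr (_%:C).
  have -> : a * a = 1 - s ^+ 2 by rewrite s2; ring.
  by field; rewrite !gt_eqF // ltr_wpDl // ltW.
by rewrite Q; move: ((s * (1 + s))^-1)%:C a%:C (zcoord w j0) => *; ring.
Qed.

Let T := trans (axis a).
Let D w := nrm2 (1 + a%:C * zcoord w j0).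

Lemma axis_nrm2D w : nrm2 (autD (trc (axis a)) (trd (axis a)) w) = D w / s ^+ 2.
Proof. by rewrite axis_autD nrm2M /D mulrC /nrm2 /= expr0n addr0 exprVn. Qed.

Lemma axis_D_gt0 w : B w -> 0 < D w.
Proof.
move=> Bw; have := autD_neq0 (U_n1_translation Ba) Bw; rewrite -nrm2_eq0 axis_nrm2D mulf_eq0.
by rewrite negb_or => /andP[h _]; rewrite lt_neqAle eq_sym h nrm2_ge0.
Qed.

Lemma axis_trans_sqnorm w : B w -> 1 - sqnorm (T w) = s ^+ 2 * (1 - sqnorm w) / D w.
Proof.
move=> Bw; rewrite (aut_one_minus_sqnorm (U_n1_translation Ba) Bw) axis_nrm2D.
by rewrite invf_div; move: (D w)^-1 => *; ring.
Qed.

Lemma axis_trans_Re w : B w ->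
  (T w).1 0 j0 = (w.1 0 j0 * (1 + a ^+ 2) + a * (1 + nrm2 (zcoord w j0))) / D w.
Proof.
move=> Bw; have D0 := axis_D_gt0 Bw.
have -> : (T w).1 0 j0 = complex.Re (zcoord (T w) j0) by [].
rewrite /T /trans aut_coord axis_autN axis_autD eqxx.
have -> : (s^-1)%:C * (zcoord w j0 + a%:C) / ((s^-1)%:C * (1 + a%:C * zcoord w j0)) =
    (zcoord w j0 + a%:C) / (1 + a%:C * zcoord w j0).
  have c0 : 1 + a%:C * zcoord w j0 != 0 by rewrite -nrm2_eq0 gt_eqF.
  have sC : (s^-1)%:C != 0 :> R[i] by rewrite fmorph_eq0 invr_eq0 gt_eqF.
  move: (zcoord w j0 + a%:C) (1 + a%:C * zcoord w j0) c0 ((s^-1)%:C) sC => x u u0 v v0.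
  by field; rewrite u0 v0.
have -> : zcoord w j0 = w.1 0 j0 +i* w.2 0 j0 by [].
move: D0; rewrite /D (_ : zcoord w j0 = w.1 0 j0 +i* w.2 0 j0) //.
move: (w.1 0 j0) (w.2 0 j0) => x y.
rewrite /nrm2 ReM ReV ImV !ReImE /=.
rewrite ?(mul0r, mulr0, addr0, add0r, subr0, oppr0) => D0.
by field; rewrite gt_eqF.
Qed.

(** The translated half ball stays at distance from the hyperplane Re z_1 = 0, where the boundary
    values of [Hext] jump, and points near the sphere stay near it. This is what makes
    [Hext_boundary] applicable uniformly. The squared denominator |1 + a w_1|^2 lies between 1 and 4
    on the half ball, which gives both estimates. *)
Lemma axis_trans_half w : B w -> 0 <= w.1 0 j0 ->
  a / 4 <= (T w).1 0 j0 /\ sqnorm w <= sqnorm (T w).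
Proof.
move=> Bw x0; have D0 := axis_D_gt0 Bw.
have r0 : 0 < 1 - sqnorm w by rewrite subr_gt0; exact/BnP.
have DE : D w = 1 + 2 * a * w.1 0 j0 + a ^+ 2 * nrm2 (zcoord w j0).
  by rewrite /D /nrm2 !ReImE /=; ring.
have D1 : 1 <= D w.
  by rewrite DE -addrA lerDl addr_ge0 ?mulr_ge0 ?sqr_ge0 ?nrm2_ge0 ?(ltW a0).
have z1 : nrm2 (zcoord w j0) <= 1.
  by apply: le_trans (nrm2_le_sqnorm w j0) _; rewrite ltW //; exact/BnP.
have x1 : w.1 0 j0 <= 1.
  rewrite -(@ler_pXn2r _ 2) ?nnegrE // expr1n; apply: le_trans z1.
  by rewrite /nrm2 /= lerDl sqr_ge0.
have a2 : a ^+ 2 <= 1 by rewrite exprn_ile1 // ltW.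
have D4 : D w <= 4.
  have h1 : a * w.1 0 j0 <= 1 by rewrite mulr_ile1 // ltW.
  have h2 : a ^+ 2 * nrm2 (zcoord w j0) <= 1 by rewrite mulr_ile1 ?sqr_ge0 ?nrm2_ge0.
  by rewrite DE -mulrA; move: h1 h2; move: (_ * w.1 0 j0) (_ * nrm2 _) => u v; lra.
split.
  rewrite (axis_trans_Re Bw) ler_pdivlMr // mulrAC ler_pdivrMr //.
  apply: (@le_trans _ _ (a * 4)); first by rewrite ler_wpM2l // ltW.
  rewrite ler_wpM2r //; apply: (@le_trans _ _ (0 + a * 1)); first by rewrite add0r mulr1.
  apply: lerD; first by rewrite mulr_ge0 // addr_ge0 ?sqr_ge0.
  by rewrite ler_wpM2l ?(ltW a0) // lerDl nrm2_ge0.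
rewrite -(lerN2 (sqnorm (T w))) -(lerD2l 1) (axis_trans_sqnorm Bw) ler_pdivrMr // mulrC.
rewrite ler_wpM2l ?(ltW r0) //; apply: le_trans D1.
by rewrite s2 gerBl sqr_ge0.
Qed.

(** The translation preserves the axis, where p = 1, so the tangent line bound [Fext0_axis_le]
    applies with an explicit T. *)
Lemma Hext_axis_trans x : 0 <= x < 1 ->
  Hext (T (axis x)) <= sharp_const N *
    (2 * (x * (1 + a ^+ 2) + a * (1 + x ^+ 2)) / ((1 - a ^+ 2) * (1 - x ^+ 2))).
Proof.
move=> /andP[x0 x1].
have Bx : B (axis x) by apply: axis_Bn; rewrite ger0_norm.
have BT : B (T (axis x)) by exact: (aut_Bn (U_n1_translation Ba) Bx).
have D0 := axis_D_gt0 Bx.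
have x11 : (axis x).1 0 j0 = x.
  by have := congr1 (@complex.Re R) (zcoord_axis x j0); rewrite eqxx mulr1.
have n1 : nrm2 (zcoord (axis x) j0) = x ^+ 2.
  by rewrite zcoord_axis eqxx mulr1 /nrm2 /= expr0n addr0.
have r0 : 1 - x ^+ 2 != 0 by rewrite gt_eqF // subr_gt0 exprn_ilt1.
have r1 : 1 - a ^+ 2 != 0 by rewrite gt_eqF // subr_gt0 exprn_ilt1 // ltW.
have tE : tvar j0 (T (axis x)) =
    2 * (x * (1 + a ^+ 2) + a * (1 + x ^+ 2)) / ((1 - a ^+ 2) * (1 - x ^+ 2)).
  rewrite /tvar /rad (axis_trans_Re Bx) (axis_trans_sqnorm Bx) x11 n1 s2 sqnorm_axis.
  by move: D0; move: (D _) => u u0; field; rewrite r0 r1 gt_eqF.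
have pE : pvar j0 (T (axis x)) = 1.
  rewrite /pvar /rad.
  have -> : sqnorm (T (axis x)) = nrm2 (zcoord (T (axis x)) j0).
    rewrite sqnorm_nrm2 (bigD1 j0) //= big1 ?addr0 // => k kj.
    rewrite /T /trans aut_coord axis_autN (negbTE kj) zcoord_axis (negbTE kj) mulr0 mul0r.
    by rewrite /nrm2 /= expr0n addr0.
  rewrite mulfV // gt_eqF // subr_gt0; apply: le_lt_trans (nrm2_le_sqnorm _ _) _; exact/BnP.
rewrite /Hext /Hext0 pE tE /sharp_const -[leRHS]mulrA ler_wpM2l ?divr_ge0 ?pi_ge0 //.
have a0' := ltW a0.
apply: Fext0_axis_le; apply: divr_ge0.
  by apply: mulr_ge0 => //; apply: addr_ge0; apply: mulr_ge0 => //; apply: addr_ge0 => //; exact: sqr_ge0.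
by apply: mulr_ge0; rewrite subr_ge0 exprn_ile1 // ltW.
Qed.

End AxisTranslation.

(** * Comparison with the extremal function on the half ball *)

Section Comparison.
Context {R : realType}.
Variable N : nat.
Local Notation n := N.+1.
Local Notation B := (Bn R n).
Local Notation V := (Cn R n).
Local Notation j0 := (ord0 : 'I_n).
Let oB : open B := open_Bn.

(** The reflection in the hyperplane Re z_1 = 0 composed with conjugation of z_2, ..., z_n. The
    conjugation is forced: only holomorphic and antiholomorphic maps are at hand as symmetries of
    the equation. *)
Definition refl (z : V) : V := dmap (fun j => if j == j0 then -1 else 1) (conjmap z).

Lemma refl_coord z j : zcoord (refl z) j = (if j == j0 then -1 else 1) * cj (zcoord z j).
Proof. by rewrite dmap_coord conjmap_coord. Qed.

Let u1 (j : 'I_n) : nrm2 (if j == j0 then -1 else 1 : R[i]) = 1.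
Proof. by case: eqP => _; rewrite /nrm2 /= ?oppr0 expr0n ?sqrrN expr1n addr0. Qed.

Lemma refl_Bn z : B z -> B (refl z).
Proof. by move=> Bz; apply: (dmap_Bn u1); exact: conjmap_Bn. Qed.

Lemma refl_sqnorm z : sqnorm (refl z) = sqnorm z.
Proof.
rewrite !sqnorm_nrm2; apply: eq_bigr => j _.
by rewrite refl_coord nrm2M u1 mul1r nrm2J.
Qed.

Lemma refl_harmonic h : real_invariant_harmonic h -> real_invariant_harmonic (h \o refl).
Proof. by move=> Hh; exact: (harmonic_conjmap (harmonic_aut (dmap_U_n1 u1) Hh)). Qed.

Variable h : V -> R.
Hypotheses (Hh : real_invariant_harmonic h) (h1 : forall z, B z -> `|h z| <= 1).

(** The odd part, under [refl], of the torus average. The averaging compensates the conjugations in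
    [refl], so that oddness yields small values on the hyperplane Re z_1 = 0. *)
Definition odd_avg (m : nat) (z : V) : R :=
  2^-1 * (torus_avg m h z + -1 * torus_avg m h (refl z)).

Lemma odd_avg_harmonic m : real_invariant_harmonic (odd_avg m).
Proof.
have HA := torus_avg_harmonic m Hh.
by apply: harmonic_Z; apply: (harmonic_D HA); apply: harmonic_Z; exact: (refl_harmonic HA).
Qed.

Lemma odd_avg_le1 m z : B z -> odd_avg m z <= 1.
Proof.
move=> Bz; have A z' : B z' -> `|torus_avg m h z'| <= 1.
  by move=> Bz'; apply: torus_avg_le => k; apply: h1; exact: (dmap_Bn (tor1 k)).
have := A z Bz; have := A _ (refl_Bn Bz); rewrite !ler_norml /odd_avg.
by move: (torus_avg m h z) (torus_avg m h (refl z)) => x y /andP[? ?] /andP[? ?]; lra.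
Qed.

(** When Re z_1 = 0, the reflection fixes z_1 and conjugates the other coordinates, and some element
    of the finite torus comes as close to this as desired. The average is invariant under that
    element, so by uniform continuity it takes nearly equal values at z and at its reflection. *)
Lemma odd_avg_flat (rho e : R) : rho < 1 -> 0 < e -> exists m, forall z,
  sqnorm z <= rho -> z.1 0 j0 = 0 -> odd_avg m z <= e.
Proof.
move=> rho1 e0.
pose K : set V := [set z | sqnorm z <= rho].
have KB : K `<=` B by move=> z Kz; apply/BnP; exact: le_lt_trans rho1.
have clK : closed K.
  have -> : K = sqnorm @^-1` [set x | x <= rho] by [].
  by apply: closed_comp => [z _|]; [exact: continuous_sqnorm|exact: closed_le].
have [Ch _] := (harmonicP h).1 Hh.
have [d d0 Hd] := unif_on_compact (compact_closed_sub clK KB) KB Ch.1 e0.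
have q0 : 0 <= 4 * pi / d by rewrite divr_ge0 ?mulr_ge0 ?pi_ge0 // ltW.
(* The order m + 1 is chosen so that the approximation error 4 pi / (m + 1) is at most the modulus
   of uniform continuity [d]. *)
pose m := Num.truncn (4 * pi / d); exists m => z zr z0.
have hm : 4 * pi / m.+1%:R <= d.
  have /andP[_ /ltW] := truncn_itv q0; rewrite -/m (ler_pdivrMr _ _ d0) => H.
  by rewrite ler_pdivrMr ?ltr0n // [d * _]mulrC.
have Bz : B z by exact: KB.
have z1 j : nrm (zcoord z j) <= 1.
  rewrite /nrm -sqrtr1 ler_wsqrtr //; apply: le_trans (nrm2_le_sqnorm z j) _.
  by rewrite ltW //; exact/BnP.
have [l hl] := fin_all_exists (fun j => conj_approx m (z1 j)).
(* The rotation depends on the point z, which is harmless because the average is invariant under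
   every element of the torus. *)
pose L : {ffun 'I_n -> 'I_m.+1} := [ffun j => l j].
have E : `|torus_avg m h (dmap (tor L) z) - torus_avg m h (refl z)| <= e.
  apply: torus_avg_sub => k; apply: Hd.
    by rewrite /K /= (dmap_sqnorm _ (tor1 k)) refl_sqnorm.
  apply: norm_le_zcoord => [|j]; first exact: ltW.
  rewrite !dmap_coord -mulrBr nrmM.
  have -> : nrm (tor (R := R) k j) = 1 by rewrite /nrm tor1 sqrtr1.
  rewrite mul1r conjmap_coord /tor; case: eqP => [->|_].
    have -> : 1 * zcoord z j0 - -1 * cj (zcoord z j0) = 0.
      by apply: complex_ext; rewrite !ReImE /= z0; ring.
    by rewrite /nrm /nrm2 /= expr0n addr0 sqrtr0 ltW.
  by rewrite ffunE mul1r; apply: le_trans (hl j) hm.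
rewrite torus_avg_inv in E; move: E; rewrite /odd_avg ler_norml => /andP[_].
by move: (torus_avg m h z) (torus_avg m h (refl z)) => x y ?; lra.
Qed.

Variable a : R.
Hypotheses (a0 : 0 < a) (a1 : a < 1).
Local Notation T := (trans (axis N a)).

Let Ba : B (axis N a). Proof. by apply: axis_Bn; rewrite ger0_norm // ltW. Qed.

(** Maximum principle for the difference on the part |z|^2 <= [rho] of the half ball Re z_1 >= 0. On
    the flat part of the boundary the odd average is at most e and the translated [Hext] is
    nonnegative; on the spherical part the odd average is at most 1 and the translated [Hext] at
    least 1 - e. *)
Lemma half_ball_comparison (e x : R) : 0 < e -> 0 <= x < 1 -> exists m,
  odd_avg m (axis N x) <= Hext (T (axis N x)) + e.
Proof.
move=> e0 /andP[x0 x1].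
have Bx : B (axis N x) by apply: axis_Bn; rewrite ger0_norm.
have a4 : 0 < a / 4 by rewrite divr_gt0.
have [d d0 Hd] := Hext_boundary N a4 e0.
(* Close enough to 1 for the boundary estimate, and large enough for the half ball to contain the
   point [x] of the axis. *)
pose rho := Num.max (1 - d) (x ^+ 2).
have rho1 : rho < 1 by rewrite /rho gt_max gtrBl d0 exprn_ilt1.
have [m Hm] := odd_avg_flat rho1 e0; exists m.
pose K : set V := [set z | sqnorm z <= rho] `&` [set z | 0 <= cdir (inl j0) z].
pose U : set V := [set z | sqnorm z < rho] `&` [set z | 0 < cdir (inl j0) z].
have KB : K `<=` B by move=> z [Kz _]; apply/BnP; exact: le_lt_trans rho1.
have cc : continuous (cdir (inl j0) : V -> R).
  by move=> z; exact: (C1_continuous openT (C1_cdir (inl j0) openT) (I : setT z)).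
have clK : closed K.
  apply: closedI.
    have -> : [set z : V | sqnorm z <= rho] = sqnorm @^-1` [set x | x <= rho] by [].
    by apply: closed_comp => [z _|]; [exact: continuous_sqnorm|exact: closed_le].
  have -> : [set z : V | 0 <= cdir (inl j0) z] = cdir (inl j0) @^-1` [set x | 0 <= x] by [].
  by apply: closed_comp => [z _|]; [exact: cc|exact: closed_ge].
have oU : open U.
  apply: openI.
    have -> : [set z : V | sqnorm z < rho] = sqnorm @^-1` [set x | x < rho] by [].
    by apply: open_comp => [z _|]; [exact: continuous_sqnorm|exact: open_lt].
  have -> : [set z : V | 0 < cdir (inl j0) z] = cdir (inl j0) @^-1` [set x | 0 < x] by [].
  by apply: open_comp => [z _|]; [exact: cc|exact: open_gt].
have UK : U `<=` K by move=> z [/ltW h2 /ltW h3].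
have HT : real_invariant_harmonic (@Hext R N \o T).
  exact: (harmonic_aut (U_n1_translation Ba) (harmonic_Hext N)).
have HG := harmonic_D (odd_avg_harmonic m) (harmonic_Z (-1) HT).
have [CG LG] := (harmonicP _).1 HG.
pose G w := odd_avg m w + -1 * (@Hext R N \o T) w.
suff : G (axis N x) <= e by rewrite /G mulN1r lerBlDl.
apply: (@maximum_principle R n _ K U G e) => //.
- exact: (compact_closed_sub clK KB).
- by move=> z /UK/KB Bz; rewrite (LG z Bz).
- move=> z Kz nU; have Bz := KB z Kz; case: Kz => /= zr z0.
  have [h2 h3] := axis_trans_half a0 a1 Bz z0.
  have BT : B (T z) := aut_Bn (U_n1_translation Ba) Bz.
  have H0 : 0 <= Hext (T z).
    have T0 : 0 <= (T z).1 0 j0 by apply: le_trans h2; exact: ltW.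
    by have /andP[] := Hext_bounds BT T0.
  rewrite /G mulN1r lerBlDl /=.
  have [zp|zn] := ltP 0 (z.1 0 j0).
    have zrho : rho <= sqnorm z.
      by rewrite leNgt; apply/negP => zlt; apply: nU; split.
    have : 1 - e <= Hext (T z).
      apply: Hd => //; apply: le_trans h3; apply: le_trans zrho.
      by rewrite /rho le_max lexx.
    by move: (odd_avg_le1 m Bz); move: (odd_avg m z) (Hext _) => u v; lra.
  have zE : z.1 0 j0 = 0 by apply/eqP; rewrite eq_le zn.
  by apply: le_trans (Hm z zr zE) _; rewrite lerDr.
- by split => /=; [rewrite sqnorm_axis /rho le_max lexx orbT|rewrite !mxE eqxx mulr1].
Qed.

(** The torus fixes the first axis and the reflection reverses it, so the value no longer depends on
    [m] and the limit e -> 0 can be taken although [m] depends on e. *)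
Lemma odd_avg_axis m (x : R) : odd_avg m (axis N x) = 2^-1 * (h (axis N x) - h (axis N (- x))).
Proof.
have E (y : R) k : dmap (tor (m := m) k) (axis N y) = axis N y.
  apply: zcoord_inj => j; rewrite dmap_coord zcoord_axis /tor; case: eqP => _.
    by rewrite mul1r.
  by rewrite !mulr0.
have -> : odd_avg m (axis N x) = 2^-1 * (torus_avg m h (axis N x) + -1 * torus_avg m h (axis N (- x))).
  rewrite /odd_avg; congr (_ * (_ + _ * torus_avg m h _)); apply: zcoord_inj => j.
  rewrite refl_coord !zcoord_axis cjM cj_real cj_nat; case: eqP => _.
    by rewrite rmorphN mulN1r mulNr.
  by rewrite !mulr0.
rewrite mulN1r (torus_avg_cst (c := h (axis N x))) => [|k]; last by rewrite E.
by rewrite (torus_avg_cst (c := h (axis N (- x)))) // => k; rewrite E.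
Qed.

Lemma axis_difference_le x : 0 <= x < 1 ->
  2^-1 * (h (axis N x) - h (axis N (- x))) <= sharp_const N *
    (2 * (x * (1 + a ^+ 2) + a * (1 + x ^+ 2)) / ((1 - a ^+ 2) * (1 - x ^+ 2))).
Proof.
move=> x01; apply: le_trans _ (Hext_axis_trans N a0 a1 x01); apply/ler_addgt0Pr => e e0.
by have [m] := half_ball_comparison e0 x01; rewrite odd_avg_axis.
Qed.

End Comparison.

(** * Bound for one derivative at the origin *)

Section OriginBound.
Context {R : realType}.
Variable N : nat.
Local Notation n := N.+1.
Local Notation B := (Bn R n).
Local Notation V := (Cn R n).
Local Notation j0 := (ord0 : 'I_n).
Let oB : open B := open_Bn.

Lemma derive_right_le0 (k : R -> R) (c : R) : is_derive (0 : R) (1 : R) k c -> k 0 = 0 ->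
  (forall x : R, 0 < x < 1 -> k x <= 0) -> c <= 0.
Proof.
move=> [dk <-] k0 kn; rewrite leNgt; apply/negP => pos.
have p2 : 0 < 'D_1 k 0 / 2 by rewrite divr_gt0.
move/cvg_ex: dk => [l kl]; have lE : 'D_1 k 0 = l by apply: cvg_lim.
rewrite lE in pos p2.
move/cvgrPdist_lt : kl => /(_ _ pos) [r /= r0 Hr].
pose x := Num.min (r / 2) 2^-1.
have x0 : 0 < x by rewrite lt_min !divr_gt0 //= invr_gt0.
have xr : `|0 - x| < r.
  rewrite sub0r normrN ger0_norm ?(ltW x0) // /x gt_min ltr_pdivrMr // ltr_pMr // ltr1n.
  exact: erefl.
have x1 : x < 1 by rewrite /x gt_min [2^-1 < 1]invf_lt1 ?ltr1n ?orbT.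
have := Hr x xr (lt0r_neq0 x0); rewrite /= k0 subr0 addr0 [x *: 1]mulr1.
have kx : x^-1 *: k x <= 0 by rewrite pmulr_rle0 ?invr_gt0 // kn // x0 x1.
rewrite ger0_norm; last by rewrite subr_ge0 (le_trans kx) // ltW.
by rewrite ltrBlDr -ltrBlDl subrr ltNge kx.
Qed.

Variable h : V -> R.
Hypotheses (Hh : real_invariant_harmonic h) (h1 : forall z, B z -> `|h z| <= 1).

Let q (x : R) : R := ((1 + x ^+ 4) + x * (1 + x ^+ 2)) / ((1 - x ^+ 4) * (1 - x ^+ 2)).

(** Both sides of [axis_difference_le] vanish to first order in x once a = x^2. Their difference is
    nonpositive for x > 0 and zero at x = 0, so its derivative at 0 is nonpositive; the factor [q],
    equal to 1 at 0, collects everything that does not affect this derivative. *)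
Lemma origin_dx_le : 'D_(e_x j0) h 0 <= 2 * sharp_const N.
Proof.
have [Ch _] := (harmonicP h).1 Hh.
have dh : derivable h (0 : V) (e_x j0) := C1_derivable oB Ch.1 (B0 N).
have H1 : is_derive (0 : R) (1 : R) (fun x : R => h (axis N x)) ('D_(e_x j0) h 0).
  have E : (fun u : R => u^-1 *: (((fun x : R => h (axis N x)) \o shift 0) (u *: 1) - h (axis N 0))) =
      (fun u : R => u^-1 *: ((h \o shift 0) (u *: e_x j0) - h 0)).
    apply/funext => u; rewrite /= /axis !addr0 scale0r.
    by rewrite [u *: 1]mulr1.
  by split; rewrite /derivable /derive E.
have H2 : is_derive (0 : R) (1 : R) (fun x : R => h (axis N (- x))) (- 'D_(e_x j0) h 0).
  have HN : is_derive (0 : R) (1 : R) (fun x : R => - x) (- 1).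
    exact: (is_deriveN (is_derive_id (0 : R) 1)).
  have H1' : is_derive (- 0 : R) (1 : R) (fun x : R => h (axis N x)) ('D_(e_x j0) h 0).
    by rewrite oppr0.
  by apply: (is_derive_eq (is_derive1_comp H1' HN)); rewrite /GRing.scale /= mulrN1.
have dq : derivable q 0 1.
  have dX k : derivable (fun x : R => x ^+ k) 0 1.
    elim: k => [|k IH]; first by under eq_fun do rewrite expr0; exact: derivable_cst.
    under eq_fun do rewrite exprS.
    exact: (derivableM (@derivable_id R R 0 1) IH).
  apply: derivableM.
    apply: derivableD; first by apply: derivableD; [exact: derivable_cst|exact: dX].
    apply: derivableM; first exact: derivable_id.
    by apply: derivableD; [exact: derivable_cst|exact: dX].
  apply: (@derivableV _ _ (fun x : R => (1 - x ^+ 4) * (1 - x ^+ 2))).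
    by rewrite !expr0n !subr0 mulr1 oner_eq0.
  apply: derivableM; by apply: derivableB; [exact: derivable_cst|exact: dX].
have q0 : q 0 = 1 by rewrite /q !expr0n !subr0 mul0r !addr0 mulr1 divr1.
have H3 : is_derive (0 : R) (1 : R) (fun x : R => 4 * sharp_const N * (x * q x)) (4 * sharp_const N).
  have Hq : is_derive (0 : R) (1 : R) q ('D_1 q 0) by exact: derivableP.
  have Hi : is_derive (0 : R) (1 : R) (id : R -> R) 1 := is_derive_id (0 : R) 1.
  apply: (is_derive_eq (is_derive_scal (4 * sharp_const N) (is_deriveM Hi Hq))).
  by rewrite /GRing.scale /= q0 mul0r add0r mulr1 mulr1.
pose k (x : R) := h (axis N x) - h (axis N (- x)) - 4 * sharp_const N * (x * q x).
have Hk : is_derive (0 : R) (1 : R) k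
    ('D_(e_x j0) h 0 - (- 'D_(e_x j0) h 0) - 4 * sharp_const N).
  exact: (is_deriveB (is_deriveB H1 H2) H3).
have k0 : k 0 = 0 by rewrite /k oppr0 mul0r mulr0 subrr subrr.
have kn (x : R) : 0 < x < 1 -> k x <= 0.
  move=> /andP[x0 x1].
  (* The translation parameter is x^2: positive, as the comparison requires, yet negligible against
     x. *)
  have a0 : 0 < x ^+ 2 by rewrite exprn_gt0.
  have a1 : x ^+ 2 < 1 by rewrite exprn_ilt1 // ltW.
  have x01 : 0 <= x < 1 by rewrite x1 ltW.
  have := axis_difference_le Hh h1 a0 a1 x01.
  have -> : 2 * (x * (1 + (x ^+ 2) ^+ 2) + x ^+ 2 * (1 + x ^+ 2)) /
      ((1 - (x ^+ 2) ^+ 2) * (1 - x ^+ 2)) = 2 * (x * q x).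
    by rewrite /q -exprM; move: (_ * _)^-1 => *; ring.
  by rewrite /k; move: (x * q x) (h _) (h _) (sharp_const N) => *; lra.
have := derive_right_le0 Hk k0 kn.
by move: ('D_(e_x j0) h 0) (sharp_const N) => *; lra.
Qed.

End OriginBound.

(** * Gamma at half-integers and the value of the constant *)

Section GammaHalfIntegers.
Context {R : realType}.
Implicit Types (t x : R) (m : nat).
Local Notation mu := (@lebesgue_measure R).

(* The integrand of [Gamma (m / 2 + 1)]. *)
Definition hgam m t : R := Num.sqrt t ^+ m * expR (- t).

Lemma continuous_hgam m : continuous (hgam m).
Proof.
move=> t; apply: (@continuousM _ _ (fun t => Num.sqrt t ^+ m)).
  apply: (@continuous_comp _ _ _ Num.sqrt (fun s : R => s ^+ m)).
    exact: sqrt_continuous.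
  exact: exprn_continuous.
apply: (@continuous_comp _ _ _ -%R expR); first exact: continuousN.
exact: continuous_expR.
Qed.

Lemma hgam_ge0 m t : 0 <= hgam m t.
Proof. by rewrite mulr_ge0 ?expR_ge0 // exprn_ge0 // sqrtr_ge0. Qed.

Lemma cvg_hgam m : hgam m t @[t --> +oo] --> (0 : R).
Proof.
apply/cvgrPdist_le => e e0; pose C : R := m.+1%:R ^+ m.+1.
have C0 : 0 < C by rewrite exprn_gt0 // ltr0n.
near=> t.
have t1 : 1 <= t by near: t; exact: nbhs_pinfty_ge.
have tC : C / e <= t by near: t; apply: nbhs_pinfty_ge; exact: num_real.
have t0 : 0 < t := lt_le_trans ltr01 t1.
rewrite sub0r normrN ger0_norm ?hgam_ge0 //.
have s1 : Num.sqrt t ^+ m <= t ^+ m.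
  apply: lerXn2r; rewrite ?nnegrE ?sqrtr_ge0 ?(ltW t0) //.
  rewrite -[leRHS]ger0_norm ?(ltW t0) // -sqrtr_sqr ler_wsqrtr // expr2.
  by rewrite ler_peMr // ltW.
(* Comes from raising exp(t/(m+1)) >= 1 + t/(m+1) to the power m + 1. *)
have E1 : t ^+ m.+1 <= C * expR t.
  have -> : expR t = expR (t / m.+1%:R) ^+ m.+1.
    by rewrite -expRM_natl mulrC divfK // pnatr_eq0.
  rewrite /C -exprMn; apply: lerXn2r.
  - by rewrite nnegrE ltW.
  - by rewrite nnegrE mulr_ge0 ?expR_ge0.
  apply: (@le_trans _ _ (m.+1%:R * (1 + t / m.+1%:R))).
    by rewrite mulrDr mulr1 mulrCA divff ?pnatr_eq0 // mulr1 lerDr.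
  by rewrite ler_wpM2l // expR_ge1Dx.
have E2 : t ^+ m * expR (- t) <= C / t.
  rewrite ler_pdivlMr // mulrAC -exprSr expRN ler_pdivrMr ?expR_gt0 //.
rewrite /hgam; apply: le_trans (_ : t ^+ m * expR (- t) <= e).
  by rewrite ler_wpM2r // expR_ge0.
apply: le_trans E2 _; rewrite ler_pdivrMr // mulrC -ler_pdivrMr //.
Unshelve. all: by end_near. Qed.

(** An explicit primitive with its values at both ends, as needed by the fundamental theorem of
    calculus on a half line; the induction over m then runs on primitives instead of on improper
    integrals. *)
Record gamma_primitive m (L : R) (F : R -> R) : Prop := {
  gp_derive : forall t, 0 < t -> is_derive t 1 F (hgam m t);
  gp_0 : F 0 = 0;
  gp_right : F t @[t --> (0 : R)^'+] --> (0 : R);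
  gp_lim : F t @[t --> +oo] --> L }.

Lemma integral_hgam m L F : gamma_primitive m L F ->
  \int[mu]_(t in `[0, +oo[) (hgam m t) = L.
Proof.
move=> [dF F0 Fr Fl].
rewrite (@Rintegral_ge0_continuous_FTC2y R (hgam m) F 0 L).
- by rewrite F0 subr0.
- by move=> x _; exact: hgam_ge0.
- by apply: continuous_subspaceT; exact: continuous_hgam.
- exact: Fl.
- by move=> x x0; case: (dF x x0).
- by rewrite F0.
- by move=> x; rewrite in_itv /= andbT => x0; rewrite derive1E; case: (dF x x0) => _ ->.
Qed.

Lemma derive_hgam m t : 0 < t ->
  is_derive t 1 (hgam m.+2) ((m%:R / 2 + 1) * hgam m t - hgam m.+2 t).
Proof.
move=> t0; have s0 : 0 < Num.sqrt t by rewrite sqrtr_gt0.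
have H1 := is_derive1_sqrt t0.
have H2 : is_derive (Num.sqrt t) (1 : R) (fun s : R => s ^+ m.+2) (m.+2%:R * Num.sqrt t ^+ m.+1).
  split; first exact: exprn_derivable.
  by rewrite exp_derive -[_ *: 1]/(_ * 1) mulr1.
have H3 := is_derive1_comp H2 H1.
have H4 : is_derive t (1 : R) (fun t : R => expR (- t)) (- expR (- t)).
  have HN : is_derive t (1 : R) (fun x : R => - x) (- 1).
    exact: (is_deriveN (is_derive_id t 1)).
  by apply: (is_derive_eq (is_derive1_comp (is_derive_expR (- t)) HN)); rewrite /GRing.scale /= mulrN1.
apply: (is_derive_eq (is_deriveM H3 H4)).
rewrite /hgam /GRing.scale /= -[m.+2%:R]natr1 -[m.+1%:R]natr1 !exprS.
move: s0; move: (Num.sqrt t) (expR _) (_ ^+ m) (m%:R) => s E q k s0.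
by field; rewrite gt_eqF.
Qed.

(** Integration by parts, that is, the functional equation of Gamma with argument m/2 + 1, carried
    out on primitives; the boundary terms vanish at 0 and at infinity. *)
Lemma gamma_primitive_step m L F : gamma_primitive m L F ->
  gamma_primitive m.+2 ((m%:R / 2 + 1) * L) (fun t => (m%:R / 2 + 1) * F t - hgam m.+2 t).
Proof.
move=> [dF F0 Fr Fl]; split.
- move=> t t0; apply: (is_derive_eq (is_deriveB (is_derive_scal _ (dF t t0)) (derive_hgam m t0))).
  by ring.
- by rewrite F0 /hgam sqrtr0 exprS !mul0r mulr0 subrr.
- have H0 : hgam m.+2 t @[t --> (0 : R)^'+] --> (0 : R).
    have E0 : hgam m.+2 0 = 0 by rewrite /hgam sqrtr0 exprS !mul0r.
    by rewrite -[X in _ --> X]E0; apply: cvg_at_right_filter; exact: continuous_hgam.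
  have := cvgB (cvgM (cvg_cst (m%:R / 2 + 1 : R)) Fr) H0.
  by rewrite mulr0 subrr => H; exact: H.
- have := cvgB (cvgM (cvg_cst (m%:R / 2 + 1 : R)) Fl) (cvg_hgam m.+2).
  by rewrite subr0 => H; exact: H.
Qed.

Lemma is_derive_expRN t : is_derive t (1 : R) (fun t : R => expR (- t)) (- expR (- t)).
Proof.
have HN : is_derive t (1 : R) (fun x : R => - x) (- 1).
  exact: (is_deriveN (is_derive_id t 1)).
by apply: (is_derive_eq (is_derive1_comp (is_derive_expR (- t)) HN)); rewrite /GRing.scale /= mulrN1.
Qed.

Lemma gamma_primitive0 : gamma_primitive 0 1 (fun t => 1 - expR (- t)).
Proof.
split.
- move=> t _; have H1 : is_derive t (1 : R) (cst 1 : R -> R) 0 := is_derive_cst (1 : R) t (1 : R).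
  apply: (is_derive_eq (is_deriveB H1 (is_derive_expRN t))).
  by rewrite /hgam expr0 mul1r sub0r opprK.
- by rewrite oppr0 expR0 subrr.
- rewrite -[X in _ --> X](subrr (1 : R)); apply: cvgB; first exact: cvg_cst.
  apply: cvg_at_right_filter; rewrite -[X in _ --> X]expR0 -[X in expR X]oppr0.
  apply: (@continuous_comp _ _ _ -%R expR); first exact: continuousN.
  exact: continuous_expR.
- rewrite -[X in _ --> X]subr0; apply: cvgB; first exact: cvg_cst.
  exact: cvgr_expR.
Qed.

Let E x : R := gauss_integral_proof.integral0_gauss x.

Lemma gauss_bounds x : 0 <= x -> 0 <= E x <= x.
Proof.
move=> x0; rewrite gauss_integral_proof.integral0_gauss_ge0 /=.
have ci : mu.-integrable `[0, x] (EFin \o (fun=> 1 : R)).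
  apply: continuous_compact_integrable => //; first exact: segment_compact.
  by apply: continuous_subspaceT => ?; exact: cst_continuous.
have gi : mu.-integrable `[0, x] (EFin \o (@gauss_fun R)).
  apply: continuous_compact_integrable => //; first exact: segment_compact.
  by apply: continuous_subspaceT; exact: continuous_gauss_fun.
apply: le_trans (_ : \int[mu]_(t in `[0, x]) 1 <= x).
  by apply: le_Rintegral => // t _; exact: gauss_fun_le1.
rewrite Rintegral_cst //= mul1r lebesgue_measure_itv /= lte_fin.
by case: ltP => //= _; rewrite subr0.
Qed.

Lemma derive_gauss x : 0 < x -> is_derive x 1 E (expR (- x ^+ 2)).
Proof.
move=> x0.
have [d e] : derivable E x 1 /\ (E^`()%classic) x = gauss_fun x.
  apply: (@continuous_FTC1_closed R (@gauss_fun R) 0 x (x + 1)) => //.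
  - by rewrite ltrDl.
  - apply: continuous_compact_integrable => //; first exact: segment_compact.
    by apply: continuous_subspaceT; exact: continuous_gauss_fun.
  - exact: continuous_gauss_fun.
by split; [exact: d|rewrite -derive1E; exact: e].
Qed.

Lemma cvg_gauss : E x @[x --> +oo] --> Num.sqrt pi / 2.
Proof.
have -> : Num.sqrt pi / 2 = Num.sqrt (pi / 4) :> R.
  rewrite sqrtrM ?pi_ge0 // sqrtrV // (_ : 4 = 2 ^+ 2); last by rewrite -natrX.
  by rewrite sqrtr_sqr ger0_norm.
have -> : E = (fun x => Num.sqrt (E x ^+ 2)).
  by apply/funext => r; rewrite sqrtr_sqr ger0_norm // gauss_integral_proof.integral0_gauss_ge0.
apply: continuous_cvg; first exact: sqrt_continuous.
exact: gauss_integral_proof.cvg_integral0_gauss_sqr.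
Qed.

Lemma cvg_sqrt_pinfty : Num.sqrt t @[t --> +oo] --> (+oo : set_system R).
Proof.
apply/cvgryPge => A; near=> t.
have h : A ^+ 2 <= t by near: t; apply: nbhs_pinfty_ge; exact: num_real.
apply: le_trans (ler_norm A) _; rewrite -sqrtr_sqr; exact: ler_wsqrtr.
Unshelve. all: by end_near. Qed.

(** After the substitution t = s^2 and an integration by parts, the integral of Gamma(3/2) is the
    Gaussian one, which supplies the value sqrt(pi)/2. *)
Lemma gamma_primitive1 :
  gamma_primitive 1 (Num.sqrt pi / 2) (fun t => E (Num.sqrt t) - hgam 1 t).
Proof.
have E0 : E 0 = 0 by apply/eqP; rewrite eq_le andbC; exact: gauss_bounds.
have cs : Num.sqrt t @[t --> (0 : R)^'+] --> (0 : R).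
  by rewrite -[X in _ --> X]sqrtr0; apply: cvg_at_right_filter; exact: sqrt_continuous.
split.
- move=> t t0; have s0 : 0 < Num.sqrt t by rewrite sqrtr_gt0.
  have H1 := is_derive1_sqrt t0.
  have H2 := is_derive1_comp (derive_gauss s0) H1.
  have H3 : is_derive t (1 : R) (hgam 1) ((2 * Num.sqrt t)^-1 * expR (- t) - hgam 1 t).
    apply: (is_derive_eq (is_deriveM H1 (is_derive_expRN t))).
    by rewrite /hgam /GRing.scale /= expr1; ring.
  apply: (is_derive_eq (is_deriveB H2 H3)).
  by rewrite sqr_sqrtr ?(ltW t0) // /GRing.scale /=; ring.
- by rewrite sqrtr0 E0 /hgam sqrtr0 expr1 mul0r subrr.
- have H0 : hgam 1 t @[t --> (0 : R)^'+] --> (0 : R).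
    have e0 : hgam 1 0 = 0 by rewrite /hgam sqrtr0 expr1 mul0r.
    by rewrite -[X in _ --> X]e0; apply: cvg_at_right_filter; exact: continuous_hgam.
  have HE : E (Num.sqrt t) @[t --> (0 : R)^'+] --> (0 : R).
    apply: (@squeeze_cvgr _ _ _ _ (cst 0) Num.sqrt) => //; last exact: cvg_cst.
    by apply: nearW => t; apply: gauss_bounds; exact: sqrtr_ge0.
  by have := cvgB HE H0; rewrite subrr => H; exact: H.
- have HE : E (Num.sqrt t) @[t --> +oo] --> Num.sqrt pi / 2.
    exact: (cvg_comp _ _ cvg_sqrt_pinfty cvg_gauss).
  have := cvgB HE (cvg_hgam 1).
  by rewrite subr0 => H; exact: H.
Qed.

Fixpoint hgam_val m : R :=
  match m with
  | 0 => 1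
  | 1 => Num.sqrt pi / 2
  | k.+2 => (k%:R / 2 + 1) * hgam_val k
  end.

Lemma gamma_primitive_ex m : exists F, gamma_primitive m (hgam_val m) F.
Proof.
have [k km] := ubnP m; elim: k m km => // k IH [|[|m]] km.
- by exists (fun t => 1 - expR (- t)); exact: gamma_primitive0.
- by exists (fun t => E (Num.sqrt t) - hgam 1 t); exact: gamma_primitive1.
have [F hF] := IH m (leq_trans (leqnSn _) km).
by eexists; exact: (gamma_primitive_step hF).
Qed.

Lemma Gamma_half m : Gamma (m%:R / 2 + 1) = hgam_val m.
Proof.
have [F hF] := gamma_primitive_ex m; rewrite -(integral_hgam hF).
transitivity (\int[mu]_(t in `]0%R, +oo[) hgam m t).
  apply: eq_Rintegral => t; rewrite inE /= in_itv /= andbT => t0.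
  rewrite addrK /hgam; congr (_ * _).
  by rewrite mulrC powRrM powR12_sqrt ?(ltW t0) // powR_mulrn // sqrtr_ge0.
rewrite /Rintegral integral_itv_obnd_cbnd //.
apply/measurable_EFinP; apply: measurable_funTS.
by apply: continuous_measurable_fun; exact: continuous_hgam.
Qed.

(** Both sides satisfy the same first order recursion in [N], the Gamma quotient through its
    functional equation and the constant through Wallis' recursion for the integrals of (1 -
    x^2)^[N], and they agree at [N] = 0, where the common value is 4/pi. *)
Lemma sharp_const_Gamma N :
  2 * Gamma (N.+1%:R + 1) / (Num.sqrt pi * Gamma (N.+1%:R + 1 / 2)) = 2 * sharp_const N :> R.
Proof.
have e1 : N.+1%:R + 1 = (N.+1.*2)%:R / 2 + 1 :> R by rewrite -muln2 natrM mulfK.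
have e2 : N.+1%:R + 1 / 2 = (N.*2.+1)%:R / 2 + 1 :> R.
  by rewrite -natr1 -[N.*2.+1%:R]natr1 -muln2 natrM; field.
have p0 : 0 < Num.sqrt pi :> R by rewrite sqrtr_gt0 pi_gt0.
have L0 m : 0 < hgam_val m.
  have [k km] := ubnP m; elim: k m km => // k IH [|[|m]] km //=.
    by rewrite divr_gt0.
  by rewrite mulr_gt0 ?ltr_wpDl ?divr_ge0 //; exact: (IH m (ltnW km)).
rewrite e1 e2 !Gamma_half; elim: N {e1 e2} => [|N IH].
  have I1 : Int01 (wt 0 0) = 1 :> R.
    by rewrite -[RHS]Int01_cst; apply: Int01_eq => x _; rewrite /wt !expr0 mulr1.
  rewrite /sharp_const I1 /= !mul0r add0r mul1r !mulr1.
  have pE : Num.sqrt pi * Num.sqrt pi = pi :> R by rewrite -expr2 sqr_sqrtr ?pi_ge0.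
  rewrite -{3}pE; field; exact: lt0r_neq0.
(* Wallis' recursion: the difference of the two sides is the integral of the derivative of x (1 -
   x^2)^(N+1), which vanishes at 0 and 1. *)
have IN : (2 * N%:R + 3) * Int01 (wt N.+1 0) = (2 * N%:R + 2) * Int01 (wt N 0) :> R.
  have c1 := cont01Z (2 * N%:R + 3) (@cont01_wt R N.+1 0).
  have c0 := cont01Z (2 * N%:R + 2) (@cont01_wt R N 0).
  apply/eqP; rewrite -subr_eq0 -!Int01Z ?cont01_wt //; try exact: cont01_wt.
  rewrite -(Int01B c1 c0).
  pose F x := x * (1 + x ^+ 2 * -1) ^+ N.+1.
  suff HF (x : R) : 0 <= x <= 1 ->
      is_derive x 1 F ((2 * N%:R + 3) * wt N.+1 0 x - (2 * N%:R + 2) * wt N 0 x).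
    rewrite (Int01_FTC HF (cont01B c1 c0)).
    by rewrite /F mul0r subr0 expr1n !mul1r addrN exprS mul0r.
  move=> _.
  have H1 := is_derive_quadratic 1 (-1) x.
  have H2 : is_derive (1 + x ^+ 2 * -1) (1 : R) (fun s : R => s ^+ N.+1)
      (N.+1%:R * (1 + x ^+ 2 * -1) ^+ N).
    split; first exact: exprn_derivable.
    by rewrite exp_derive -[_ *: 1]/(_ * 1) mulr1.
  have H3 := @is_derive1_comp R (fun s : R => s ^+ N.+1) (fun t : R => 1 + t ^+ 2 * -1) x _ _ H2 H1.
  have Hi : is_derive x (1 : R) (id : R -> R) 1 := is_derive_id x 1.
  apply: (is_derive_eq (is_deriveM Hi H3)).
  rewrite /wt !expr0 !mul1r /GRing.scale /= mulr1 -[N.+1%:R]natr1 !mulrN1 [(1 - x ^+ 2) ^+ N.+1]exprS.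
  by move: ((1 - x ^+ 2) ^+ N) => g; ring.
have -> : sharp_const N.+1 = (N%:R + 2) * 2 / (2 * N%:R + 3) * sharp_const N :> R.
  have n3 : 2 * N%:R + 3 != 0 :> R by rewrite gt_eqF // ltr_wpDl // mulr_ge0.
  apply: (mulfI n3); rewrite /sharp_const -[N.+2%:R]natr1 -[N.+1%:R]natr1.
  transitivity (2 / pi * (N%:R + 2) * ((2 * N%:R + 3) * Int01 (wt N.+1 0)) : R).
    by move: (Int01 _) (pi^-1) => *; ring.
  by rewrite IN; move: (Int01 _) (pi^-1) => *; field.

have h4 : hgam_val N.+2.*2 = (N%:R + 2) * hgam_val N.+1.*2.
  rewrite [N.+2.*2]doubleS -[hgam_val _.+2]/((N.+1.*2%:R / 2 + 1) * hgam_val N.+1.*2).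
  by rewrite -muln2 natrM mulfK // -[N.+1%:R]natr1; congr (_ * _); ring.
have h3 : hgam_val N.+1.*2.+1 = (2 * N%:R + 3) / 2 * hgam_val N.*2.+1.
  rewrite [N.+1.*2]doubleS -[hgam_val _.+3]/((N.*2.+1%:R / 2 + 1) * hgam_val N.*2.+1).
  by rewrite -[N.*2.+1%:R]natr1 -muln2 natrM; congr (_ * _); field.
have sE : sharp_const N = hgam_val N.+1.*2 / (Num.sqrt pi * hgam_val N.*2.+1).
  have t0 : (2 : R) != 0 by rewrite pnatr_eq0.
  by apply: (mulfI t0); rewrite [RHS]mulrA; exact: (esym IH).
have := L0 N.*2.+1; rewrite h4 h3 sE; move: p0; move: (Num.sqrt pi) (hgam_val N.+1.*2) (hgam_val N.*2.+1).
have n3 : 2 * N%:R + 3 != 0 :> R by rewrite gt_eqF // ltr_wpDl // mulr_ge0.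
move: (N%:R) n3 => k n3 u X Y u0 Y0; field.
by rewrite n3 !gt_eqF.
Qed.

End GammaHalfIntegers.

(** * Unitary matrices with a prescribed row; Cauchy-Schwarz *)

Section UnitaryCompletion.
Context {R : realType} {n : nat}.
Implicit Types (a u w : 'I_n -> R[i]).

Lemma unit_direction (j0 : 'I_n) a : exists u (r : R),
  [/\ 0 <= r, \sum_k nrm2 (u k) = 1, r ^+ 2 = \sum_k nrm2 (a k) &
      forall k, a k = r%:C * u k].
Proof.
set S := \sum_k nrm2 (a k).
have S0 : 0 <= S by apply: sumr_ge0 => k _; exact: nrm2_ge0.
(* A zero vector has no direction of its own; a basis vector is returned so that [u] is always a
   unit vector. *)
have [SE|Sn] := eqVneq S 0.
  exists (fun k => (k == j0)%:R), 0; split => //.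
  - rewrite (bigD1 j0) //= big1 => [|k kj]; rewrite ?eqxx ?(negbTE kj) /nrm2 /=.
      by rewrite expr1n expr0n /= !addr0.
    by rewrite expr0n addr0.
  - by rewrite expr0n.
  move=> k; rewrite rmorph0 mul0r; apply/eqP; rewrite -nrm2_eq0; apply/eqP.
  exact: (psumr_eq0P (fun i _ => nrm2_ge0 (a i)) SE).
have r0 : 0 < Num.sqrt S by rewrite sqrtr_gt0 lt_neqAle eq_sym Sn.
exists (fun k => ((Num.sqrt S)^-1)%:C * a k), (Num.sqrt S); split.
- exact: sqrtr_ge0.
- under eq_bigr do rewrite nrm2M.
  rewrite -mulr_sumr -/S /nrm2 /= expr0n addr0 exprVn sqr_sqrtr // mulVf //.
- by rewrite sqr_sqrtr.
by move=> k; rewrite mulrA -rmorphM mulfV ?gt_eqF // mul1r.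
Qed.

(** A Householder reflection, multiplied by -e so that row [j0] becomes exactly [u], where e is the
    phase of the entry [u j0]. *)
Lemma unitary_first_row (j0 : 'I_n) u : \sum_k nrm2 (u k) = 1 ->
  exists U : 'I_n -> 'I_n -> R[i],
    (forall k l, \sum_i U k i * cj (U l i) = (k == l)%:R) /\ forall j, U j0 j = u j.
Proof.
move=> u1; pose c := u j0; pose r := nrm c.
have r0 : 0 <= r := nrm_ge0 c.
have [e [e1 eE]] : exists e, nrm2 e = 1 /\ c = r%:C * e.
  have [c0|c0] := eqVneq c 0.
    exists 1; split; first by rewrite /nrm2 /= expr1n expr0n addr0.
    have -> : r = 0 by rewrite /r c0 /nrm /nrm2 /= expr0n addr0 sqrtr0.
    by rewrite c0 rmorph0 mul0r.
  have rp : 0 < r by rewrite sqrtr_gt0 nrm2_gt0.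
  exists ((r^-1)%:C * c); split; last by rewrite mulrA -rmorphM mulfV ?gt_eqF // mul1r.
  have c2 : nrm2 c = r ^+ 2 by rewrite sqr_sqrtr ?nrm2_ge0.
  by rewrite nrm2M c2 /nrm2 /= expr0n addr0 exprVn mulVf // expf_neq0 // gt_eqF.
have ee : e * cj e = 1 by rewrite nrm2C e1.
pose k0 : R[i] := ((1 + r)^-1)%:C.
have r1 : 1 + r != 0 by rewrite gt_eqF // ltr_wpDr.
have k0E : k0 * (1 + r%:C) = 1.
  by rewrite /k0 -(rmorph1 (real_complex R)) -rmorphD -rmorphM mulVf.
(* Adding the basis vector with the phase of [u j0] excludes cancellation: |w|^2 = 2(1 + r) is at
   least 2, and [k0] is 2/|w|^2. *)
pose w k := u k + e * (k == j0)%:R.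
have ww : \sum_k w k * cj (w k) = 2 * (1 + r%:C).
  transitivity (\sum_k (u k * cj (u k) + (k == j0)%:R * (e * cj (u k) + cj e * u k + e * cj e * (k == j0)%:R))).
    apply: eq_bigr => k _; rewrite /w cjD cjM cj_nat.
    by move: (u k) (cj (u k)) (cj e) (e) (_%:R) => *; ring.
  rewrite big_split /= (sum_delta (fun k => e * cj (u k) + cj e * u k + e * cj e * (k == j0)%:R)) eqxx.
  have -> : \sum_k u k * cj (u k) = 1.
    under eq_bigr do rewrite nrm2C.
    by rewrite -rmorph_sum u1 rmorph1.
  rewrite -/c eE cjM cj_real -[true%:R]/(1 : R[i]).
  transitivity (1 + (2 * r%:C + 1) * (e * cj e)); first by move: (cj e) (e) r%:C => *; ring.
  by rewrite ee; ring.
exists (fun i j => - e * ((i == j)%:R - k0 * (cj (w i) * w j))); split; last first.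
  move=> j; have w0 : cj (w j0) = cj e * (1 + r%:C).
    by rewrite /w eqxx -/c eE cjD !cjM cj_nat cj_real -[true%:R]/(1 : R[i]); ring.
  rewrite w0 /w.
  transitivity (- e * (j0 == j)%:R + (e * cj e) * (k0 * (1 + r%:C)) * (u j + e * (j == j0)%:R)).
    by move: (cj e) (e) (k0) (1 + r%:C) (u j) (_%:R) (_%:R) => *; ring.
  by rewrite ee k0E eq_sym; ring.
move=> k l.
have k0r : cj k0 = k0 by rewrite /k0 cj_real.
transitivity (\sum_i ((i == k)%:R * (e * cj e * (l == i)%:R) - e * cj e * k0 * ((i == k)%:R * (w l * cj (w i)))
   - e * cj e * k0 * ((i == l)%:R * (cj (w k) * w i)) + e * cj e * (k0 * k0) * (cj (w k) * w l) * (w i * cj (w i)))).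
  apply: eq_bigr => i _; rewrite cjM cjN cjB !cjM cj_nat cjK k0r [k == i]eq_sym [l == i in RHS]eq_sym [l == i in LHS]eq_sym.
  by move: (cj e) (e) (k0) (w i) (cj (w i)) (w l) (cj (w k)) (_%:R) (_%:R) => *; ring.
rewrite big_split /= sumrB sumrB -!mulr_sumr.
rewrite (sum_delta (fun i => e * cj e * (l == i)%:R)) (sum_delta (fun i => w l * cj (w i))).
rewrite (sum_delta (fun i => cj (w k) * w i)) ww ee [l == k]eq_sym.
transitivity ((k == l)%:R + 2 * k0 * (k0 * (1 + r%:C) - 1) * (cj (w k) * w l)).
  by move: (k0) (1 + r%:C) (w l) (cj (w k)) (_%:R) => *; ring.
by rewrite k0E subrr mulr0 mul0r addr0.
Qed.

Lemma unitary_transpose (U : 'I_n -> 'I_n -> R[i]) :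
  (forall k l, \sum_i U k i * cj (U l i) = (k == l)%:R) ->
  forall k l, \sum_i U i k * cj (U i l) = (k == l)%:R.
Proof.
move=> H k l; rewrite eq_sym -(unitary_cols H l k); apply: eq_bigr => i _.
exact: mulrC.
Qed.

Lemma sum_nrm2_comb (G v : 'I_n -> R[i]) (al be : R) :
  let g := \sum_k G k * v k in
  \sum_j nrm2 (al%:C * G j - be%:C * (cj (v j) * g)) =
  al ^+ 2 * \sum_j nrm2 (G j) - 2 * al * be * nrm2 g + be ^+ 2 * (\sum_j nrm2 (v j)) * nrm2 g.
Proof.
move=> g.
have inj (x y : R) : x%:C = y%:C -> x = y by case.
apply: inj; rewrite rmorph_sum.
transitivity (\sum_j (al%:C ^+ 2 * (G j * cj (G j)) - al%:C * be%:C * cj g * (G j * v j)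
   - al%:C * be%:C * g * cj (G j * v j) + be%:C ^+ 2 * (g * cj g) * (v j * cj (v j)))).
  apply: eq_bigr => j _; rewrite -[LHS]/((nrm2 _)%:C) -nrm2C cjB !cjM cjK !cj_real.
  by move: al%:C be%:C (cj g) (g) (G j) (cj (G j)) (v j) (cj (v j)) => *; ring.
rewrite big_split /= !sumrB -!mulr_sumr -cj_sum -/g.
have sC (F : 'I_n -> R[i]) : \sum_k F k * cj (F k) = (\sum_k nrm2 (F k))%:C.
  by rewrite rmorph_sum; apply: eq_bigr => k _; rewrite nrm2C.
rewrite !sC; have -> : al%:C * be%:C * cj g * g = al%:C * be%:C * (nrm2 g)%:C by rewrite -nrm2C; ring.
have -> : al%:C * be%:C * g * cj g = al%:C * be%:C * (nrm2 g)%:C by rewrite -nrm2C; ring.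
rewrite nrm2C; apply: complex_ext; rewrite !ReImE /=.
  by move: (nrm2 g) (\sum_j _) (\sum_j _) => *; ring.
by move: (nrm2 g) (\sum_j _) (\sum_j _) => *; ring.
Qed.

(** The vector A G - conj(v) g, with A = |v|^2 and g the sum of the products G_k v_k, has squared
    norm A (A |G|^2 - |g|^2), which must be nonnegative. *)
Lemma cauchy_schwarz_nrm2 (G v : 'I_n -> R[i]) :
  nrm2 (\sum_k G k * v k) <= (\sum_k nrm2 (G k)) * \sum_k nrm2 (v k).
Proof.
set g := \sum_k _; set A := \sum_k nrm2 (v k).
have A0 : 0 <= A by apply: sumr_ge0 => k _; exact: nrm2_ge0.
have [AE|An] := eqVneq A 0.
  have v0 k : v k = 0.
    apply/eqP; rewrite -nrm2_eq0; apply/eqP.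
    exact: (psumr_eq0P (fun i _ => nrm2_ge0 (v i)) AE).
  rewrite AE mulr0 /g big1 => [|k _]; last by rewrite v0 mulr0.
  by rewrite /nrm2 /= expr0n addr0.
have Ap : 0 < A by rewrite lt_neqAle eq_sym An.
have := sum_nrm2_comb G v A 1; rewrite -/g -/A => E.
have : 0 <= \sum_j nrm2 (A%:C * G j - 1%:C * (cj (v j) * g)).
  by apply: sumr_ge0 => k _; exact: nrm2_ge0.
rewrite E; move: (\sum_j nrm2 (G j)) (nrm2 g) => S x.
have -> : A ^+ 2 * S - 2 * A * 1 * x + 1 ^+ 2 * A * x = A * (S * A - x) by ring.
by rewrite pmulr_rge0 // subr_ge0.
Qed.

End UnitaryCompletion.

(** * From the origin to every point; attainment *)

Section SharpGradient.
Context {R : realType}.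
Variable N : nat.
Local Notation n := N.+1.
Local Notation B := (Bn R n).
Local Notation V := (Cn R n).
Local Notation j0 := (ord0 : 'I_n).
Local Notation unitary U := (forall k l, \sum_i U k i * cj (U l i) = (k == l)%:R).
Let oB : open B := open_Bn.

Lemma dz_comp_aut (A : 'I_n -> 'I_n -> R[i]) b c d (HU : U_n1 A b c d) (f : V -> R) j z :
  C1 B f -> B z -> dz j (creal (f \o aut A b c d)) z =
  \sum_k dz k (creal f) (aut A b c d z) * dz j (fun w => zcoord (aut A b c d w) k) z.
Proof.
move=> Cf Bz; have Hk := aut_holo HU.
have Ck k : CC1 B (fun w => zcoord (aut A b c d w) k) by have [] := Hk k.
have -> : creal (f \o aut A b c d) = (fun w => creal f (aut A b c d w)) by [].
rewrite (dz_comp oB oB (aut_Bn HU) Ck j (CC1_real Cf) Bz).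
by apply: eq_bigr => k _; have [_ -> // _ _] := Hk k; rewrite cj0 mulr0 addr0.
Qed.

Lemma unitary0 (U : 'I_n -> 'I_n -> R[i]) : aut U (fun _ => 0) (fun _ => 0) 1 (0 : V) = 0.
Proof.
apply: zcoord_inj => k; rewrite aut_unitary zcoord0 big1 // => i _.
by rewrite zcoord0 mulr0.
Qed.

Lemma dz_comp_unitary (U : 'I_n -> 'I_n -> R[i]) (f : V -> R) j : unitary U -> C1 B f ->
  dz j (creal (f \o aut U (fun _ => 0) (fun _ => 0) 1)) 0 =
  \sum_k dz k (creal f) 0 * U k j.
Proof.
move=> HU Cf; rewrite (dz_comp_aut (U_n1_unitary HU) j Cf (B0 N)) unitary0.
apply: eq_bigr => k _; congr (_ * _).
have -> : (fun w : V => zcoord (aut U (fun _ => 0) (fun _ => 0) 1 w) k) =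
    (fun w => \sum_i U k i * zcoord w i + 0).
  by apply/funext => w; rewrite aut_unitary addr0.
exact: (dz_affine (U k) 0 j (B0 N)).
Qed.

(** A unitary change of variables aligns the gradient at 0 with the real direction of the first
    coordinate, so the bound on one derivative becomes a bound on the norm. *)
Lemma origin_gradient_le (g : V -> R) : real_invariant_harmonic g ->
  (forall z, B z -> `|g z| <= 1) ->
  0 <= sharp_const N :> R /\ \sum_j nrm2 (dz j (creal g) 0) <= sharp_const N ^+ 2.
Proof.
move=> Hg g1; have [Cg _] := (harmonicP g).1 Hg.
have [u [r [r0 u1 rE aE]]] := unit_direction j0 (fun k => dz k (creal g) 0).
have uJ : \sum_k nrm2 (cj (u k)) = 1 by rewrite -u1; apply: eq_bigr => k _; rewrite nrm2J.
have [W [HW W0]] := unitary_first_row j0 uJ.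
(* The transpose is taken because column [j0], and not the row, must be the conjugate of the unit
   gradient direction. *)
pose U k i := W i k.
have HU : unitary U := unitary_transpose HW.
have HUn := U_n1_unitary HU.
have Hf := harmonic_aut HUn Hg.
have f1 z : B z -> `|(g \o aut U (fun _ => 0) (fun _ => 0) 1) z| <= 1.
  by move=> Bz; apply: g1; exact: (aut_Bn HUn).
have := origin_dx_le Hf f1.
have -> : 'D_(e_x j0) (g \o aut U (fun _ => 0) (fun _ => 0) 1) 0 = 2 * r.
  have := Re_dz_creal (g \o aut U (fun _ => 0) (fun _ => 0) 1) j0 0.
  rewrite (dz_comp_unitary j0 HU Cg.1).
  have -> : \sum_k dz k (creal g) 0 * U k j0 = r%:C.
    transitivity (r%:C * \sum_k u k * cj (u k)).
      by rewrite mulr_sumr; apply: eq_bigr => k _; rewrite aE /U W0 mulrA.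
    have -> : \sum_k u k * cj (u k) = 1.
      by under eq_bigr do rewrite nrm2C; rewrite -rmorph_sum u1 rmorph1.
    by rewrite mulr1.
  by move=> /= ->; rewrite mulrC divfK // pnatr_eq0.
rewrite ler_pM2l // => rs; split; first exact: le_trans r0 rs.
by rewrite -rE lerXn2r // nnegrE (le_trans r0).
Qed.

(** With G the holomorphic gradient of h at z, s^2 = 1 - |z|^2 and g the sum of the G_k z_k, the
    gradient of the composite at 0 has squared norm s^2 (|G|^2 - |g|^2). Cauchy-Schwarz gives |g|^2
    <= (1 - s^2) |G|^2, so this is at least s^4 |G|^2, and the bound at the origin applies. *)
Lemma grad_norm_le (h : V -> R) z : real_invariant_harmonic h ->
  (forall z, B z -> `|h z| <= 1) -> B z ->
  grad_norm h z <= 2 * sharp_const N * (1 / (1 - enorm z ^+ 2)).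
Proof.
move=> Hh h1 Bz; have [Ch _] := (harmonicP h).1 Hh.
have HT := U_n1_translation Bz.
have Hg := harmonic_aut HT Hh.
have g1 w : B w -> `|(h \o trans z) w| <= 1 by move=> Bw; apply: h1; exact: (aut_Bn HT).
have [c0] := origin_gradient_le Hg g1.
pose G k := dz k (creal h) z; pose s := Num.sqrt (1 - sqnorm z).
have q0 : 0 < 1 - sqnorm z by rewrite subr_gt0; exact/BnP.
have s2 : s ^+ 2 = 1 - sqnorm z by rewrite sqr_sqrtr // ltW.
have sp : 0 < s by rewrite sqrtr_gt0.
have -> : \sum_j nrm2 (dz j (creal (h \o trans z)) 0) =
    \sum_j nrm2 (s%:C * G j - (s / (1 + s))%:C * (cj (zcoord z j) * \sum_k G k * zcoord z k)).
  apply: eq_bigr => j _; congr nrm2.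
  rewrite (dz_comp_aut HT j Ch.1 (B0 N)) -/(trans z) (trans0 Bz).
  transitivity (\sum_k ((k == j)%:R * (s%:C * G k) -
      (s / (1 + s))%:C * cj (zcoord z j) * (G k * zcoord z k))).
    apply: eq_bigr => k _; rewrite -/(trans z) (dz_trans0 Bz) -/(G k) -/s.
    by move: s%:C (s / _)%:C (G k) (zcoord z k) (cj _) (_%:R) => *; ring.
  rewrite sumrB (sum_delta (fun k => s%:C * G k)) -mulr_sumr; congr (_ - _).
  exact: (esym (mulrA _ _ _)).
rewrite sum_nrm2_comb -sqnorm_nrm2.
have := cauchy_schwarz_nrm2 G (zcoord z); rewrite -sqnorm_nrm2.
have zE : sqnorm z = 1 - s ^+ 2 by rewrite s2; ring.
rewrite grad_norm_dz enorm_sqr -/G zE; set S := \sum_j nrm2 (G j).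
have S0 : 0 <= S by apply: sumr_ge0 => k _; exact: nrm2_ge0.
move: (nrm2 _) => x xS.
have -> : s ^+ 2 * S - 2 * s * (s / (1 + s)) * x + (s / (1 + s)) ^+ 2 * (1 - s ^+ 2) * x =
    s ^+ 2 * (S - x).
  by field; rewrite gt_eqF // addr_gt0.
move=> H; rewrite -mulrA ler_pM2l // opprB addrC subrK mul1r.
have s20 : 0 < s ^+ 2 by rewrite exprn_gt0.
have hL : 0 <= Num.sqrt S * s ^+ 2 by rewrite mulr_ge0 ?sqrtr_ge0 ?(ltW s20).
rewrite ler_pdivlMr // -(@ler_pXn2r _ 2) ?nnegrE //.
rewrite exprMn sqr_sqrtr //; apply: le_trans H.
rewrite [_ ^+ 2 in leLHS]expr2 mulrCA ler_wpM2l ?(ltW s20) //.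
by move: xS; rewrite mulrBr mulr1 => xS; lra.
Qed.

(** The translation taking z to 0 is followed by a unitary map that aligns the gradient of [Hext]
    with the direction of z, the case of equality in Cauchy-Schwarz. *)
Lemma grad_norm_attained (z : V) : B z -> exists h : V -> R,
  [/\ real_invariant_harmonic h, (forall w, B w -> `|h w| <= 1) &
      grad_norm h z = 2 * sharp_const N * (1 / (1 - enorm z ^+ 2))].
Proof.
move=> Bz; have [u [r [r0 u1 rE zE]]] := unit_direction j0 (fun k => cj (zcoord z k)).
have [U [HU U0]] := unitary_first_row j0 u1.
have HUn := U_n1_unitary HU; have HT := U_n1_translation (BnN Bz).
have HH := harmonic_Hext (R := R) N; have [CH _] := (harmonicP _).1 HH.
pose f := @Hext R N \o aut U (fun _ => 0) (fun _ => 0) 1.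
have Hf : real_invariant_harmonic f := harmonic_aut HUn HH.
have [Cf _] := (harmonicP _).1 Hf.
have Hh := harmonic_aut HT Hf.
exists (f \o trans (- z)); split => //.
  by move=> w Bw; apply: Hext_le1; apply: (aut_Bn HUn); exact: (aut_Bn HT).
have [c0 _] := origin_gradient_le HH (@Hext_le1 R N).
have df j : dz j (creal f) 0 = (sharp_const N)%:C * u j.
  rewrite (dz_comp_unitary j HU CH.1).
  transitivity (\sum_k (k == j0)%:R * ((sharp_const N)%:C * U k j)).
    apply: eq_bigr => k _; rewrite dz_Hext0_at0.
    by move: (sharp_const N)%:C (U k j) (_%:R) => *; ring.
  by rewrite (sum_delta (fun k => (sharp_const N)%:C * U k j)) U0.
pose s := Num.sqrt (1 - sqnorm z).
have q0 : 0 < 1 - sqnorm z by rewrite subr_gt0; exact/BnP.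
have s2 : s ^+ 2 = 1 - sqnorm z by rewrite sqr_sqrtr // ltW.
have sp : 0 < s by rewrite sqrtr_gt0.
have rs : r ^+ 2 = 1 - s ^+ 2.
  by rewrite rE s2 sqnorm_nrm2; under eq_bigr do rewrite nrm2J; ring.
have zk k : zcoord z k = r%:C * cj (u k) by rewrite -[LHS]cjK zE cjM cj_real.
have uz : \sum_k u k * zcoord z k = r%:C.
  transitivity (r%:C * \sum_k u k * cj (u k)).
    by rewrite mulr_sumr; apply: eq_bigr => k _; rewrite zk mulrCA.
  have -> : \sum_k u k * cj (u k) = 1.
    by under eq_bigr do rewrite nrm2C; rewrite -rmorph_sum u1 rmorph1.
  by rewrite mulr1.
(* In the direction of z the differential of the translation at z is 1/s^2, so the gradient keeps
   its direction and is multiplied by 1/(1 - |z|^2). *)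
have dh j : dz j (creal (f \o trans (- z))) z = (sharp_const N / s ^+ 2)%:C * u j.
  rewrite (dz_comp_aut HT j Cf.1 Bz) -/(trans (- z)) (trans_inv Bz).
  pose q := (s * (1 + s))^-1.
  transitivity (\sum_k ((k == j)%:R * ((sharp_const N)%:C * u k / s%:C) +
      (sharp_const N)%:C * q%:C * cj (zcoord z j) / s%:C * (u k * zcoord z k))).
    apply: eq_bigr => k _; rewrite df (dz_trans_inv Bz) -/s -/q.
    by move: (sharp_const N)%:C q%:C (u k) (zcoord z k) (cj _) (s%:C^-1) (_%:R) => *; ring.
  rewrite big_split /= (sum_delta (fun k => (sharp_const N)%:C * u k / s%:C)) -mulr_sumr uz zE.
  have E : (sharp_const N / s ^+ 2)%:C = (sharp_const N)%:C / s%:C * (1 + q%:C * (r%:C * r%:C)).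
    rewrite -rmorphM -rmorphM -(rmorph1 (real_complex R)) -rmorphD -fmorphV -!rmorphM.
    congr (_%:C); rewrite -[r * r]expr2 rs /q.
    by field; rewrite !gt_eqF // addr_gt0.
  by rewrite E; move: (sharp_const N)%:C q%:C (r%:C) (u j) (s%:C^-1) => *; ring.
rewrite grad_norm_dz; under eq_bigr do rewrite dh nrm2M.
rewrite -mulr_sumr u1 mulr1 enorm_sqr -s2.
have -> : nrm2 (sharp_const N / s ^+ 2)%:C = (sharp_const N / s ^+ 2) ^+ 2.
  by rewrite /nrm2 /= expr0n addr0.
by rewrite sqrtr_sqr ger0_norm ?divr_ge0 ?sqr_ge0 // mul1r mulrA.
Qed.

End SharpGradient.

Theorem theorem1 (R : realType) (n : nat) (hn : (1 <= n)%N) :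
  (forall h : Cn R n -> R,
     real_invariant_harmonic h ->
     (forall z, Bn R n z -> `|h z| <= 1) ->
     forall z, Bn R n z ->
       grad_norm h z <=
         2 * Gamma (n%:R + 1) / (Num.sqrt pi * Gamma (n%:R + 1 / 2))
         * (1 / (1 - enorm z ^+ 2)))
  /\
  (forall z : Cn R n, Bn R n z ->
     exists h : Cn R n -> R,
       [/\ real_invariant_harmonic h,
           (forall w, Bn R n w -> `|h w| <= 1) &
           grad_norm h z =
             2 * Gamma (n%:R + 1) / (Num.sqrt pi * Gamma (n%:R + 1 / 2))
             * (1 / (1 - enorm z ^+ 2))]).
Proof.
case: n hn => // N _; rewrite sharp_const_Gamma; split.
  by move=> h Hh h1 z Bz; exact: grad_norm_le.
exact: grad_norm_attained.
Qed.
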